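(* Let $n\in\mathbb{N}$, let $\Gamma$ be a countable group of type $\mathrm{FP}_{n+1}$, and let $\alpha,\beta$ be standard $\Gamma$-actions with $\alpha\prec\beta$. Then $$\mathrm{medim}^Z_n(\beta)\le\mathrm{medim}^Z_n(\alpha)\quad\text{if $Z$ is $\mathbb{Z}$ or a finite field},\qquad \mathrm{mevol}_n(\beta)\le\mathrm{mevol}_n(\alpha).$$
   Context: $\mathbb{N}$ contains $0$. $Z$ denotes $\mathbb{Z}$ with the usual absolute value or a finite field with the trivial norm ($|0|=0$, $|x|=1$ for $x\neq 0$). A group $\Gamma$ is of type $\mathrm{FP}_m$ if the trivial $\mathbb{Z}\Gamma$-module $\mathbb{Z}$ has a projective resolution that is finitely generated in degrees $\le m$. Weak containment. Let $\alpha\colon\Gamma\curvearrowright(X,\mu)$ and $\beta\colon\Gamma\curvearrowright(Y,\nu)$ be probability measure preserving actions on standard probability spaces. $\alpha$ is weakly contained in $\beta$, written $\alpha\prec\beta$, if for all $m\in\mathbb{N}$, measurable $A_1,\dots,A_m\subset X$, finite $F\subset\Gamma$ and $\epsilon>0$ there are measurable $B_1,\dots,B_m\subset Y$ with $|\mu(\gamma A_i\cap A_j)-\nu(\gamma B_i\cap B_j)|<\epsilon$ for all $\gamma\in F$ and $i,j\in\{1,\dots,m\}$. Standard actions. A standard $\Gamma$-action $\alpha\colon\Gamma\curvearrowright(X,\mu)$ is an essentially free, probability measure preserving action of a countable group on a standard Borel probability space. $L^\infty(\alpha,Z)=L^\infty(X,\mu,Z)$ is the ring of essentially bounded measurable functions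 $X\to Z$ modulo a.e. equality, with $(\gamma\cdot\lambda)(x)=\lambda(\gamma^{-1}x)$. The crossed product ring $R=L^\infty(\alpha,Z)*\Gamma$ is the free $L^\infty(\alpha,Z)$-module with basis $\Gamma$ (elements are finite sums of terms $(\lambda,\gamma)$) with multiplication $(\lambda,\gamma)(\lambda',\gamma')=(\lambda\cdot(\gamma\cdot\lambda'),\gamma\gamma')$. It contains $Z\Gamma$ via $\gamma\mapsto(1,\gamma)$ and acts on $L^\infty(\alpha,Z)$ by $(\lambda,\gamma)\cdot f=\lambda\cdot(\gamma\cdot f)$. Marked modules. For measurable $A\subset X$ put $\langle A\rangle=R\cdot(\chi_A,1)$. A marked projective $R$-module is an $R$-module $M$ with a finite family $(A_i)_{i\in I}$ of measurable subsets of $X$ and an isomorphism $M\cong\bigoplus_{i\in I}\langle A_i\rangle$ (suppressed from notation); $\dim_R(M)=\sum_i\mu(A_i)$. On $R$ let $|\sum_\gamma(\lambda_\gamma,\gamma)|_1=\sum_\gamma\int_X|\lambda_\gamma|\,d\mu$; elements of $M\subset\bigoplus_I R$ have norm $\|\sum_i\lambda_ie_i\|_1=\sum_i|\lambda_i|_1$. For an $R$-homomorphism $f\colon M\to N$ of marked projective modules, $\|f\|$ is the least $c$ with $\|f(z)\|_1\le c\|z\|_1$ for all $z$ (always finite). A marked direct summand of $\bigoplus_j\langle B_j\rangle$ is a submodule $\bigoplus_j\langle B_j'\rangle$ with $B_j'\subset B_j$ measurable. A finite marked decomposition of $M=\bigoplus_i\langle A_i\rangle$ is a finite family $(M_k)_k$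 with $M_k=\bigoplus_i\langle A_{i,k}\rangle$ for measurable partitions $A_i=\bigsqcup_kA_{i,k}$. Logarithmic norm. $\log_+(t)=\max\{\log t,0\}$ (and $\log_+0=0$). $\mathrm{rk}(f)=\inf\{\dim N'\mid N'\subset N\text{ marked direct summand with }f(M)\subset N'\}$; $\mathrm{lognorm}'(f)=\min\{\dim(M)\log_+\|f\|,\ \mathrm{rk}(f)\log_+\|f\|\}$; $\mathrm{lognorm}(f)=\inf\sum_k\mathrm{lognorm}'(f|_{M_k}\colon M_k\to N)$, the infimum over all finite marked decompositions $(M_k)_k$ of $M$. Measured embeddings. A marked projective augmented $R$-chain complex $D_*\twoheadrightarrow L^\infty(\alpha,Z)$ is a chain complex $(D_k)_{k\ge0}$ of marked projective $R$-modules with a surjective $R$-homomorphism $\eta\colon D_0\to L^\infty(\alpha,Z)$, $\eta\circ\partial_1=0$. Fix a free $Z\Gamma$-resolution $C_*\twoheadrightarrow Z$ (the following is independent of the choice). An $\alpha$-embedding (up to degree $n$) is such a complex together with a $Z\Gamma$-chain map $C_*\to D_*$ up to degree $n+1$ extending the inclusion $Z\to L^\infty(\alpha,Z)$ as constant functions. $A_n(\alpha)$ is the class of all augmented complexes $D_*$ arising in this way. For $\Gamma$ of type $\mathrm{FP}_{n+1}$: $\mathrm{medim}^Z_n(\alpha)=\inf_{D_*\in A_n(\alpha)}\dim_R(D_n)$, and (for $Z=\mathbb{Z}$) $\mathrm{mevol}_n(\alpha)=\inf_{D_*\in A_n(\alpha)}\mathrm{lognorm}(\partial^D_{n+1})$.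 *)

(* Defs.v *)
From HB Require Import structures.
From mathcomp Require Import all_boot all_order all_algebra finmap.
From mathcomp Require Import all_classical all_reals all_analysis.
Set Implicit Arguments.
Unset Strict Implicit.
Unset Printing Implicit Defensive.
Import Order.TTheory GRing.Theory Num.Theory.
Local Open Scope classical_set_scope.
Local Open Scope ring_scope.

Record ringAction (G : groupType) (A : pzRingType) := RingAction {
  ract :> G -> {rmorphism A -> A};
  ract1 : forall a, ract 1%g a = a;
  ractM : forall g h a, ract (g * h)%g a = ract g (ract h a) }.

(* Finite sums of terms (l, g), stored through their coefficient function; the
   product, set up below, is (l, g) (m, h) = (l * (g . m), g h). *)
Definition crossed (G : groupType) (A : pzRingType) (ac : ringAction G A)
  : Type := {fsfun G -> A with 0}.

(* The module A over A * G, where (l, g) acts by a |-> l * (g . a). *)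
Definition coefmod (G : groupType) (A : pzRingType) (ac : ringAction G A)
  : Type := A.

Section Crossed.
Variables (G : groupType) (A : pzRingType) (ac : ringAction G A).
Local Notation R := (crossed ac).

HB.instance Definition _ := Choice.on R.

Definition cp_coef (x : R) (g : G) : A := (x : {fsfun G -> A with 0}) g.
Definition cp_supp (x : R) : {fset G} := finsupp (x : {fsfun G -> A with 0}).

(* The element (l, g) of A * G. *)
Definition cp_mono (l : A) (g : G) : R := [fsfun x in [fset g]%fset => l].

Definition cp_zero : R := [fsfun].
Definition cp_add (x y : R) : R :=
  [fsfun g in (cp_supp x `|` cp_supp y)%fset => cp_coef x g + cp_coef y g].
Definition cp_opp (x : R) : R := [fsfun g in cp_supp x => - cp_coef x g].

Lemma cpP (x y : R) : (forall g, cp_coef x g = cp_coef y g) -> x = y.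
Proof. by move=> h; apply/fsfunP. Qed.

Lemma cp_coef_out (x : R) g : g \notin cp_supp x -> cp_coef x g = 0.
Proof. by move=> h; rewrite /cp_coef fsfun_dflt. Qed.

Lemma cp_zeroE g : cp_coef cp_zero g = 0.
Proof. by rewrite /cp_coef fsfunE. Qed.

Lemma cp_addE x y g : cp_coef (cp_add x y) g = cp_coef x g + cp_coef y g.
Proof.
rewrite {1}/cp_coef fsfunE in_fsetU.
case: ifPn => //; rewrite negb_or => /andP[hx hy].
by rewrite !cp_coef_out ?addr0.
Qed.

Lemma cp_oppE x g : cp_coef (cp_opp x) g = - cp_coef x g.
Proof.
rewrite {1}/cp_coef fsfunE; case: ifPn => // hx.
by rewrite cp_coef_out ?oppr0.
Qed.

Lemma cp_monoE l g h : cp_coef (cp_mono l g) h = if h == g then l else 0.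
Proof. by rewrite /cp_coef fsfunE in_fset1. Qed.

Fact cp_addA : associative cp_add.
Proof. by move=> x y z; apply: cpP => g; rewrite !cp_addE addrA. Qed.
Fact cp_addC : commutative cp_add.
Proof. by move=> x y; apply: cpP => g; rewrite !cp_addE addrC. Qed.
Fact cp_add0 : left_id cp_zero cp_add.
Proof. by move=> x; apply: cpP => g; rewrite cp_addE cp_zeroE add0r. Qed.
Fact cp_addN : left_inverse cp_zero cp_opp cp_add.
Proof. by move=> x; apply: cpP => g; rewrite cp_addE cp_oppE cp_zeroE addNr. Qed.

HB.instance Definition _ :=
  GRing.isZmodule.Build R cp_addA cp_addC cp_add0 cp_addN.

Lemma cp_coefD x y g : cp_coef (x + y) g = cp_coef x g + cp_coef y g.
Proof. exact: cp_addE. Qed.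
Lemma cp_coef0 g : cp_coef 0 g = 0.
Proof. exact: cp_zeroE. Qed.
Lemma cp_coef_sum (I : Type) (s : seq I) (P : pred I) (F : I -> R) g :
  cp_coef (\sum_(i <- s | P i) F i) g = \sum_(i <- s | P i) cp_coef (F i) g.
Proof.
apply: (big_morph (cp_coef ^~ g)); last exact: cp_coef0.
by move=> x y; rewrite cp_coefD.
Qed.

Lemma cp_monoD l m g : cp_mono (l + m) g = cp_mono l g + cp_mono m g.
Proof.
by apply: cpP => h; rewrite cp_coefD !cp_monoE; case: ifP; rewrite ?addr0.
Qed.
Lemma cp_mono0 g : cp_mono 0 g = 0.
Proof. by apply: cpP => h; rewrite cp_monoE cp_coef0 if_same. Qed.

Lemma cp_sumE (x : R) : x = \sum_(g <- cp_supp x) cp_mono (cp_coef x g) g.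
Proof.
apply: cpP => h; rewrite cp_coef_sum.
have [hx|hx] := boolP (h \in cp_supp x).
  rewrite (big_fsetD1 h) //= cp_monoE eqxx big1_fset ?addr0 // => g.
  by rewrite in_fsetD1 cp_monoE eq_sym => /andP[/negPf ->].
rewrite cp_coef_out // big1_fset // => g gx _.
by rewrite cp_monoE; case: eqP => // hg; rewrite hg gx in hx.
Qed.

Lemma cp_ind (P : R -> Prop) : P 0 ->
  (forall l g x, P x -> P (cp_mono l g + x)) -> forall x, P x.
Proof.
by move=> P0 PD x; rewrite (cp_sumE x); elim: (cp_supp x : seq G) => [|g s IH]; rewrite ?big_nil // big_cons; exact: PD.
Qed.

(* The additive extension of (l, g) |-> F g l, for F additive in l. *)
Definition cp_ext (V : zmodType) (F : G -> A -> V) (x : R) : V :=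
  \sum_(g <- cp_supp x) F g (cp_coef x g).

Section Ext.
Variables (V : zmodType) (F : G -> A -> V).
Hypothesis FD : forall g l m, F g (l + m) = F g l + F g m.

Let F0 g : F g 0 = 0.
Proof. by apply: (addrI (F g 0)); rewrite -FD !addr0. Qed.

Lemma cp_extw (S : {fset G}) (x : R) : (cp_supp x `<=` S)%fset ->
  cp_ext F x = \sum_(g <- S) F g (cp_coef x g).
Proof.
move=> xS; apply: big_fset_incl => // g _ gx.
by rewrite cp_coef_out // F0.
Qed.

Lemma cp_extD x y : cp_ext F (x + y) = cp_ext F x + cp_ext F y.
Proof.
pose S := (cp_supp x `|` cp_supp y `|` cp_supp (x + y)%R)%fset.
rewrite (@cp_extw S (x + y)) ?(@cp_extw S x) ?(@cp_extw S y).
- by rewrite -big_split /=; apply: eq_bigr => g _; rewrite cp_coefD FD.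
- by apply/fsubsetP => g; rewrite !in_fsetU => ->; rewrite orbT.
- by apply/fsubsetP => g; rewrite !in_fsetU => ->.
- by apply/fsubsetP => g; rewrite !in_fsetU => ->; rewrite orbT.
Qed.

Lemma cp_ext0 : cp_ext F 0 = 0.
Proof. by apply: (addrI (cp_ext F 0)); rewrite -cp_extD !addr0. Qed.

Lemma cp_ext_mono l g : cp_ext F (cp_mono l g) = F g l.
Proof.
rewrite (@cp_extw [fset g]%fset) ?big_seq_fset1 ?cp_monoE ?eqxx //.
by apply/fsubsetP => h; rewrite /cp_supp; apply: contraTT => hg;
  rewrite memNfinsupp -/(cp_coef _ _) cp_monoE; move: hg; rewrite in_fset1 => /negPf ->.
Qed.

End Ext.

Definition cp_one : R := cp_mono 1 1%g.

Definition cp_mul (x y : R) : R :=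
  cp_ext (fun g l => cp_ext (fun h m => cp_mono (l * ac g m) (g * h)%g) y) x.

Let inD g l h m1 m2 : cp_mono (l * ac g (m1 + m2)) (g * h)%g =
  cp_mono (l * ac g m1) (g * h)%g + cp_mono (l * ac g m2) (g * h)%g.
Proof. by rewrite rmorphD mulrDr cp_monoD. Qed.

Let outD y g l1 l2 :
  cp_ext (fun h m => cp_mono ((l1 + l2) * ac g m) (g * h)%g) y =
  cp_ext (fun h m => cp_mono (l1 * ac g m) (g * h)%g) y +
  cp_ext (fun h m => cp_mono (l2 * ac g m) (g * h)%g) y.
Proof.
rewrite /cp_ext -big_split /=; apply: eq_bigr => h _.
by rewrite mulrDl cp_monoD.
Qed.

Lemma cp_mul_mono l g m h :
  cp_mul (cp_mono l g) (cp_mono m h) = cp_mono (l * ac g m) (g * h)%g.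
Proof. by rewrite /cp_mul cp_ext_mono ?cp_ext_mono. Qed.

Fact cp_mulDl : left_distributive cp_mul +%R.
Proof. by move=> x y z; rewrite /cp_mul cp_extD. Qed.

Fact cp_mulDr : right_distributive cp_mul +%R.
Proof.
move=> x y z; rewrite /cp_mul {1 3 5}/cp_ext -big_split /=.
by apply: eq_bigr => g _; rewrite cp_extD.
Qed.

Let cpm0l x : cp_mul 0 x = 0.
Proof. by apply: (addrI (cp_mul 0 x)); rewrite -cp_mulDl !addr0. Qed.
Let cpm0r x : cp_mul x 0 = 0.
Proof. by apply: (addrI (cp_mul x 0)); rewrite -cp_mulDr !addr0. Qed.

Fact cp_mul1 : left_id cp_one cp_mul.
Proof.
elim/cp_ind => [|l g x IH]; first exact: cpm0r.
by rewrite cp_mulDr IH cp_mul_mono ract1 mul1r mul1g.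
Qed.

Fact cp_mulr1 : right_id cp_one cp_mul.
Proof.
elim/cp_ind => [|l g x IH]; first exact: cpm0l.
by rewrite cp_mulDl IH cp_mul_mono rmorph1 mulr1 mulg1.
Qed.

Fact cp_mulA : associative cp_mul.
Proof.
move=> x y z; elim/cp_ind: x => [|l g x IHx]; first by rewrite !cpm0l.
rewrite !cp_mulDl IHx {IHx}; congr (_ + _).
elim/cp_ind: y => [|m h y IHy]; first by rewrite cpm0l !cpm0r cpm0l.
rewrite !cp_mulDr cp_mulDl cp_mulDr IHy {IHy} cp_mulDl; congr (_ + _).
elim/cp_ind: z => [|n k z IHz]; first by rewrite !cpm0r.
by rewrite !cp_mulDr IHz !cp_mul_mono rmorphM ractM mulrA mulgA.
Qed.

HB.instance Definition _ := GRing.Zmodule_isPzRing.Build R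
  cp_mulA cp_mul1 cp_mulr1 cp_mulDl cp_mulDr.

Lemma cp_monoM l g m h :
  cp_mono l g * cp_mono m h = cp_mono (l * ac g m) (g * h)%g.
Proof. exact: cp_mul_mono. Qed.

Local Notation M := (coefmod ac).

HB.instance Definition _ := GRing.Zmodule.on M.

Definition coef_scale (x : R) (a : M) : M :=
  cp_ext (fun g l => l * ac g a) x.

Let scD a g l1 l2 : (l1 + l2) * ac g a = l1 * ac g a + l2 * ac g a.
Proof. exact: mulrDl. Qed.

Lemma coef_scale_mono l g a : coef_scale (cp_mono l g) a = l * ac g a.
Proof. by rewrite /coef_scale (cp_ext_mono (scD a)). Qed.

Fact coef_scaleDl a x y :
  coef_scale (x + y) a = coef_scale x a + coef_scale y a.
Proof. exact: (cp_extD (scD a)). Qed.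

Fact coef_scaleDr : right_distributive coef_scale +%R.
Proof.
move=> x a b; rewrite /coef_scale /cp_ext -big_split /=.
by apply: eq_bigr => g _; rewrite rmorphD mulrDr.
Qed.

Let sc0 a : coef_scale 0 a = 0.
Proof. by apply: (addrI (coef_scale 0 a)); rewrite -coef_scaleDl !addr0. Qed.

Let scr0 x : coef_scale x 0 = 0.
Proof. by apply: (addrI (coef_scale x 0)); rewrite -coef_scaleDr !addr0. Qed.

Fact coef_scaleA x y a : coef_scale x (coef_scale y a) = coef_scale (x * y) a.
Proof.
elim/cp_ind: x => [|l g x IHx]; first by rewrite mul0r !sc0.
rewrite mulrDl !coef_scaleDl IHx {IHx}; congr (_ + _).
elim/cp_ind: y => [|m h y IHy]; first by rewrite mulr0 sc0 scr0.
rewrite mulrDr !coef_scaleDl coef_scaleDr IHy {IHy}; congr (_ + _).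
by rewrite cp_monoM !coef_scale_mono rmorphM ractM mulrA.
Qed.

Fact coef_scale1 : left_id 1 coef_scale.
Proof. by move=> a; rewrite coef_scale_mono ract1 mul1r. Qed.

HB.instance Definition _ := GRing.Zmodule_isLmodule.Build R M
  coef_scaleA coef_scale1 coef_scaleDr coef_scaleDl.

End Crossed.

Section TrivialAction.
Variables (G : groupType) (Z : pzRingType).

(* For the trivial action, Z * G is the group ring and [coefmod] is the trivial
   module Z, (z, g) acting as multiplication by z. *)
Definition triv_action : ringAction G Z :=
  @RingAction G Z (fun=> idfun) (fun=> erefl) (fun _ _ _ => erefl).

Definition groupRing : pzRingType := crossed triv_action.
Definition trivmod : lmodType groupRing := coefmod triv_action.

End TrivialAction.

(* [ch_bd C k] is the differential from degree k + 1 to degree k. *)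
Record augComplex (S : pzRingType) (V : lmodType S) := AugComplex {
  ch_mod :> nat -> lmodType S;
  ch_bd : forall k, {linear ch_mod k.+1 -> ch_mod k};
  ch_aug : {linear ch_mod 0%N -> V};
  ch_bdbd : forall k x, ch_bd k (ch_bd k.+1 x) = 0;
  ch_augbd : forall x, ch_aug (ch_bd 0 x) = 0;
  ch_aug_surj : forall v, exists x, ch_aug x = v }.

Definition resolution (S : pzRingType) (V : lmodType S) (C : augComplex V) :=
  (forall x, ch_aug C x = 0 -> exists y, ch_bd C 0 y = x) /\
  (forall k x, ch_bd C k x = 0 -> exists y, ch_bd C k.+1 y = x).

Definition projective (S : pzRingType) (P : lmodType S) :=
  forall (M N : lmodType S) (p : {linear M -> N}) (f : {linear P -> N}),
    (forall y, exists x, p x = y) ->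
    exists h : {linear P -> M}, forall x, p (h x) = f x.

Definition fin_gen (S : pzRingType) (M : lmodType S) :=
  exists (m : nat) (e : 'I_m -> M),
    forall x, exists c : 'I_m -> S, x = \sum_(i < m) c i *: e i.

Definition is_free (S : pzRingType) (M : lmodType S) :=
  exists (J : choiceType) (e : J -> M), forall x,
    exists! c : {fsfun J -> S with 0}, x = \sum_(j <- finsupp c) c j *: e j.

Definition free_resolution (S : pzRingType) (V : lmodType S)
    (C : augComplex V) :=
  resolution C /\ forall k, is_free (C k).

Definition type_FP (G : groupType) (m : nat) :=
  exists P : augComplex (trivmod G int),
    [/\ resolution P, forall k, projective (P k) &
        forall k, (k <= m)%N -> fin_gen (P k)].

(* A countable commutative ring with a norm: just enough for the essentially
   bounded functions to form a ring. Only [intZ] and [finZ] are meant. *)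
Record normedRing (R : realType) := NormedRing {
  nr_ring :> countComNzRingType;
  nr_norm : nr_ring -> R;
  nr_norm_ge0 : forall x, 0 <= nr_norm x;
  nr_norm_eq0 : forall x, nr_norm x = 0 <-> x = 0;
  nr_normN : forall x, nr_norm (- x) = nr_norm x;
  nr_normD : forall x y, nr_norm (x + y) <= nr_norm x + nr_norm y;
  nr_normM : forall x y, nr_norm (x * y) <= nr_norm x * nr_norm y }.

Section CoefficientRings.
Variable R : realType.

Definition int_norm (z : int) : R := `|z%:~R|.

Fact int_norm_ge0 z : 0 <= int_norm z.
Proof. exact: normr_ge0. Qed.
Fact int_norm_eq0 z : int_norm z = 0 <-> z = 0.
Proof.
rewrite /int_norm; split=> [/normr0_eq0/eqP|->]; last by rewrite normr0.
by rewrite intr_eq0 => /eqP.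
Qed.
Fact int_normN z : int_norm (- z) = int_norm z.
Proof. by rewrite /int_norm rmorphN normrN. Qed.
Fact int_normD z t : int_norm (z + t) <= int_norm z + int_norm t.
Proof. by rewrite /int_norm rmorphD ler_normD. Qed.
Fact int_normM z t : int_norm (z * t) <= int_norm z * int_norm t.
Proof. by rewrite /int_norm rmorphM normrM. Qed.

Definition intZ : normedRing R :=
  @NormedRing R int int_norm int_norm_ge0 int_norm_eq0 int_normN int_normD
    int_normM.

Variable F : finFieldType.

Definition triv_norm (x : F) : R := (x != 0)%:R.

Fact triv_norm_ge0 x : 0 <= triv_norm x.
Proof. exact: ler0n. Qed.
Fact triv_norm_eq0 x : triv_norm x = 0 <-> x = 0.
Proof.
rewrite /triv_norm; split=> [|->]; last by rewrite eqxx.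
by case: eqP => //= _ /eqP; rewrite oner_eq0.
Qed.
Fact triv_normN x : triv_norm (- x) = triv_norm x.
Proof. by rewrite /triv_norm oppr_eq0. Qed.
Fact triv_normD x y : triv_norm (x + y) <= triv_norm x + triv_norm y.
Proof.
rewrite /triv_norm -natrD ler_nat.
have [->|x0] := eqVneq x 0; first by rewrite add0r.
by rewrite (leq_trans (leq_b1 _)).
Qed.
Fact triv_normM x y : triv_norm (x * y) <= triv_norm x * triv_norm y.
Proof. by rewrite /triv_norm -natrM ler_nat mulf_eq0; do 2!case: eqP. Qed.

Definition finZ : normedRing R :=
  @NormedRing R F triv_norm triv_norm_ge0 triv_norm_eq0 triv_normN triv_normD
    triv_normM.

End CoefficientRings.

(* The sigma-algebra of X is the Borel sigma-algebra of a Polish topology, here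
   presented on a copy P of X. *)
Definition standard_borel (R : realType) (d : measure_display)
    (X : measurableType d) :=
  exists (P : completePseudoMetricType R) (f : X -> P),
    [/\ hausdorff_space P, @second_countable P, bijective f &
        @measurable d X = [set f @^-1` B | B in <<s [set U : set P | open U] >>]].

Record pmpAction (R : realType) (G : groupType) (d : measure_display)
    (X : measurableType d) (mu : probability X R) := PmpAction {
  pact :> G -> X -> X;
  pact1 : forall x, pact 1%g x = x;
  pactM : forall g h x, pact (g * h)%g x = pact g (pact h x);
  pact_measurable : forall g, measurable_fun setT (pact g);
  pact_preserving : forall g A, measurable A -> mu (pact g @^-1` A) = mu A }.

Definition standard_action (R : realType) (G : groupType) (d : measure_display)
    (X : measurableType d) (mu : probability X R) (a : pmpAction G mu) :=
  [/\ countable [set: G], standard_borel R X &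
      {ae mu, forall x, forall g, a g x = x -> g = 1%g}].

Definition weakly_contained (R : realType) (G : groupType)
    (d d' : measure_display) (X : measurableType d) (Y : measurableType d')
    (mu : probability X R) (nu : probability Y R)
    (a : pmpAction G mu) (b : pmpAction G nu) :=
  forall (m : nat) (A : 'I_m -> set X) (F : {fset G}) (e : R),
    (forall i, measurable (A i)) -> 0 < e ->
    exists2 B : 'I_m -> set Y, forall i, measurable (B i) &
      forall g i j, g \in F ->
        `| fine (mu ((a g @` A i) `&` A j)) -
           fine (nu ((b g @` B i) `&` B j)) | < e.

Section Linf.
Variables (R : realType) (d : measure_display) (X : measurableType d).
Variables (mu : probability X R) (Z : normedRing R).

(* Z carries the discrete sigma-algebra. *)
Definition ess_bounded_measurable (f : X -> Z) : bool :=
  `[< (forall B : set Z, measurable (f @^-1` B)) /\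
      exists c : R, {ae mu, forall x, nr_norm (f x) <= c} >].

Lemma ebm_op2 (op : Z -> Z -> Z) (k : R -> R -> R) (f g : X -> Z) :
  (forall a b r s, nr_norm a <= r -> nr_norm b <= s ->
    nr_norm (op a b) <= k r s) ->
  ess_bounded_measurable f -> ess_bounded_measurable g ->
  ess_bounded_measurable (fun x => op (f x) (g x)).
Proof.
move=> opk /asboolP[mf [r fr]] /asboolP[mg [s gs]]; apply/asboolP; split.
  move=> B.
  have -> : (fun x => op (f x) (g x)) @^-1` B =
    \bigcup_(ab : Z * Z) ((f @^-1` [set ab.1] `&` g @^-1` [set ab.2]) `&`
      [set _ | B (op ab.1 ab.2)]).
    apply/seteqP; split => x /=; first by move=> Bx; exists (f x, g x).
    by case=> -[a b] /= _ [[-> ->]].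
  apply: countable_bigcupT_measurable; first exact: countableP.
  move=> -[a b]; apply: measurableI; last first.
    have [Bab|Bab] := pselect (B (op a b)).
      by rewrite (_ : [set _ | _] = setT) //; apply/seteqP; split.
    by rewrite (_ : [set _ | _] = set0) //; apply/seteqP; split.
  by apply: measurableI; [exact: mf|exact: mg].
exists (k r s); apply: filterS2 fr gs => x; exact: opk.
Qed.


Lemma ebm_cst (z : Z) : ess_bounded_measurable (cst z).
Proof.
apply/asboolP; split; last by exists (nr_norm z); apply: aeW.
move=> B; have [Bz|Bz] := pselect (B z).
  by rewrite (_ : _ @^-1` _ = setT) //; apply/seteqP; split.
by rewrite (_ : _ @^-1` _ = set0) //; apply/seteqP; split.
Qed.

Fact ebm_subring : subring_closed (ess_bounded_measurable : {pred X -> Z}).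
Proof.
split; first exact: ebm_cst.
- move=> f g hf hg; apply: (@ebm_op2 (fun a b => a - b) +%R) => // a b r s ar bs.
  by rewrite (le_trans (nr_normD _ _)) // nr_normN lerD.
- move=> f g hf hg; apply: (@ebm_op2 *%R *%R) => // a b r s ar bs.
  by rewrite (le_trans (nr_normM _ _)) // ler_pM // nr_norm_ge0.
Qed.

HB.instance Definition _ := GRing.isSubringClosed.Build (X -> Z)
  ess_bounded_measurable ebm_subring.

Record bddfun := Bddfun {
  bdd_val :> X -> Z;
  bdd_valP : bdd_val \in ess_bounded_measurable }.

HB.instance Definition _ := [isSub for bdd_val].
HB.instance Definition _ := [Choice of bddfun by <:].
HB.instance Definition _ :=
  GRing.SubChoice_isSubComPzRing.Build (X -> Z) ess_bounded_measurable bddfun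
    (subringClosedP _).

Lemma prob_witness (P : X -> Prop) : {ae mu, forall x, P x} -> exists x, P x.
Proof.
move=> h; apply: contrapT => /forallNP nP.
have : mu.-negligible [set: X].
  by apply: negligibleS h => x _ /=; exact: nP.
move=> /negligibleP -/(_ measurableT) mu0.
by have := probability_setT mu; rewrite mu0 => /esym/eqP; rewrite onee_eq0.
Qed.

Fact bddfun_nonzero : (1 : bddfun) != 0.
Proof.
have [x _] : exists x : X, True by apply: prob_witness; apply: aeW.
apply/eqP => /(congr1 (fun f : bddfun => bdd_val f x)) /eqP.
by rewrite /= oner_eq0.
Qed.

HB.instance Definition _ := GRing.PzSemiRing_isNonZero.Build bddfun bddfun_nonzero.

Definition ae_zero (f : bddfun) : bool := `[< {ae mu, forall x, f x = 0} >].

Fact ae_zero_ideal : idealr_closed ae_zero.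
Proof.
split.
- by apply/asboolP; apply: aeW.
- apply/negP => /asboolP/prob_witness [x] /eqP.
  by rewrite /= oner_eq0.
- move=> f g h /asboolP g0 /asboolP h0; apply/asboolP.
  apply: filterS2 g0 h0 => x gx hx.
  change (bdd_val f x * bdd_val g x + bdd_val h x = 0).
  by rewrite gx hx mulr0 addr0.
Qed.

HB.instance Definition _ := isIdealr.Build bddfun ae_zero ae_zero_ideal.

Definition Linf : comNzRingType := Quotient.quot (ae_zero : idealr bddfun).

End Linf.

Section LinfClass.
Variables (R : realType) (d : measure_display) (X : measurableType d).
Variables (mu : probability X R) (Z : normedRing R).
Local Notation bddfun := (bddfun mu Z).
Local Notation Linf := (Linf mu Z).

Definition linf_class (f : bddfun) : Linf := \pi%qT f.
Definition linf_repr (l : Linf) : bddfun := repr l.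

Lemma linf_reprK l : linf_class (linf_repr l) = l.
Proof. exact: reprK. Qed.

Lemma linf_classP (f g : bddfun) :
  linf_class f = linf_class g <-> {ae mu, forall x, f x = g x}.
Proof.
have -> : (linf_class f = linf_class g) <-> ae_zero (f - g).
  split=> [/eqP|] h; last apply/eqP; last by rewrite -Quotient.idealrBE.
  by move: h; rewrite -Quotient.idealrBE.
split=> [/asboolP h|h]; last apply/asboolP; apply: filterS h => x.
  by move=> /eqP; rewrite [_ == _]subr_eq0 => /eqP.
by move=> fg; change (bdd_val f x - bdd_val g x = 0); rewrite fg subrr.
Qed.

Lemma linf_classD f g : linf_class (f + g) = linf_class f + linf_class g.
Proof. exact: rmorphD. Qed.
Lemma linf_classB f g : linf_class (f - g) = linf_class f - linf_class g.
Proof. exact: rmorphB. Qed.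
Lemma linf_classM f g : linf_class (f * g) = linf_class f * linf_class g.
Proof. exact: rmorphM. Qed.
Lemma linf_class1 : linf_class 1 = 1.
Proof. exact: rmorph1. Qed.

Definition linf_const (z : Z) : Linf := linf_class (Bddfun (ebm_cst mu z)).

Fact linf_const_is_additive : zmod_morphism linf_const.
Proof.
by move=> a b; rewrite /linf_const -linf_classB; apply/linf_classP; apply: aeW.
Qed.
Fact linf_const_is_multiplicative : monoid_morphism linf_const.
Proof.
split; first by rewrite -linf_class1; apply/linf_classP; apply: aeW.
by move=> a b; rewrite /linf_const -linf_classM; apply/linf_classP; apply: aeW.
Qed.
HB.instance Definition _ :=
  GRing.isZmodMorphism.Build Z Linf linf_const linf_const_is_additive.
HB.instance Definition _ :=
  GRing.isMonoidMorphism.Build Z Linf linf_const linf_const_is_multiplicative.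

Lemma ebm_indic (A : set X) :
  measurable A -> ess_bounded_measurable mu (\1_A : X -> Z).
Proof.
move=> mA; apply/asboolP; split.
  move=> B; rewrite preimage_indic.
  by case: ifP => _; case: ifP => _ //; exact: measurableC.
exists (nr_norm (1 : Z) + nr_norm (0 : Z)); apply: aeW => x; rewrite indicE.
by case: (x \in A); rewrite ?lerDl ?lerDr nr_norm_ge0.
Qed.

(* The class of chi_A when A is measurable, 0 otherwise. *)
Definition linf_indic (A : set X) : Linf :=
  linf_class (insubd (0 : bddfun) (\1_A : X -> Z)).

Definition linf_norm1 (l : Linf) : R := \int[mu]_x nr_norm (linf_repr l x).

End LinfClass.

Section LinfAction.
Variables (R : realType) (G : groupType) (d : measure_display).
Variables (X : measurableType d) (mu : probability X R) (a : pmpAction G mu).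
Variable Z : normedRing R.
Local Notation bddfun := (bddfun mu Z).
Local Notation Linf := (Linf mu Z).

Lemma pact_meas_preimage g (A : set X) :
  measurable A -> measurable (a g @^-1` A).
Proof.
by move=> mA; have := pact_measurable a g measurableT mA; rewrite setTI.
Qed.

Lemma pact_ae g (P : X -> Prop) :
  {ae mu, forall x, P x} -> {ae mu, forall x, P (a g x)}.
Proof.
move=> [N [mN N0 PN]]; exists (a g @^-1` N); split.
- exact: pact_meas_preimage.
- by rewrite pact_preserving.
- by move=> x /= nP; apply: PN.
Qed.

Fact shift_subproof g (f : bddfun) :
  (fun x => f (a g^-1%g x)) \in @ess_bounded_measurable _ _ _ mu Z.
Proof.
have /asboolP[mf [c fc]] := bdd_valP f; apply/asboolP; split.
  by move=> B; exact: (pact_meas_preimage g^-1%g (mf B)).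
by exists c; exact: (pact_ae g^-1%g fc).
Qed.

(* (g . f)(x) = f (g^-1 x) *)
Definition shift g (f : bddfun) : bddfun := Bddfun (shift_subproof g f).

Definition linf_act (g : G) (l : Linf) : Linf :=
  linf_class (shift g (linf_repr l)).

Lemma linf_act_class g f : linf_act g (linf_class f) = linf_class (shift g f).
Proof.
apply/linf_classP.
have /linf_classP h := linf_reprK (linf_class f).
exact: (pact_ae g^-1%g h).
Qed.

Fact linf_act_is_additive g : zmod_morphism (linf_act g).
Proof.
move=> l m; rewrite -[l]linf_reprK -[m]linf_reprK -linf_classB !linf_act_class.
by rewrite -linf_classB; apply/linf_classP; apply: aeW.
Qed.
Fact linf_act_is_multiplicative g : monoid_morphism (linf_act g).
Proof.
split.
  rewrite -linf_class1 linf_act_class.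
  by apply/linf_classP; apply: aeW.
move=> l m; rewrite -[l]linf_reprK -[m]linf_reprK -linf_classM !linf_act_class.
by rewrite -linf_classM; apply/linf_classP; apply: aeW.
Qed.
HB.instance Definition _ g :=
  GRing.isZmodMorphism.Build Linf Linf (linf_act g) (linf_act_is_additive g).
HB.instance Definition _ g :=
  GRing.isMonoidMorphism.Build Linf Linf (linf_act g)
    (linf_act_is_multiplicative g).

Fact linf_act1 l : linf_act 1%g l = l.
Proof.
rewrite -[l]linf_reprK linf_act_class; apply/linf_classP; apply: aeW => x /=.
by rewrite invg1 pact1.
Qed.
Fact linf_actM g h l : linf_act (g * h)%g l = linf_act g (linf_act h l).
Proof.
rewrite -[l]linf_reprK !linf_act_class; apply/linf_classP; apply: aeW => x /=.
by rewrite invgM pactM.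
Qed.

Definition linf_action : ringAction G Linf :=
  @RingAction G Linf (fun g => linf_act g) linf_act1 linf_actM.

Definition crossedLinf : pzRingType := crossed linf_action.
Definition linfMod : lmodType crossedLinf := coefmod linf_action.

(* The inclusion Z[G] -> Linf * G. *)
Definition grp_incl (x : groupRing G Z) : crossedLinf :=
  cp_ext (fun g z => cp_mono linf_action (linf_const mu z) g) x.

Let inclD g (l m : Z) : cp_mono linf_action (linf_const mu (l + m)) g =
  cp_mono linf_action (linf_const mu l) g +
  cp_mono linf_action (linf_const mu m) g.
Proof. by rewrite rmorphD cp_monoD. Qed.

Let grp_inclD x y : grp_incl (x + y) = grp_incl x + grp_incl y.
Proof. exact: (cp_extD inclD). Qed.
Let grp_incl0 : grp_incl 0 = 0.
Proof. exact: (cp_ext0 _ inclD). Qed.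
Let grp_incl_mono l g : grp_incl (cp_mono (triv_action G Z) l g) =
  cp_mono linf_action (linf_const mu l) g.
Proof. exact: (cp_ext_mono _ inclD). Qed.

Fact grp_incl_is_additive : zmod_morphism grp_incl.
Proof.
move=> x y; apply: (addIr (grp_incl y)).
by rewrite -grp_inclD !subrK.
Qed.

Fact linf_act_const g z : linf_act g (linf_const mu z) = linf_const mu z.
Proof. by rewrite linf_act_class; apply/linf_classP; apply: aeW. Qed.

Fact grp_incl_is_multiplicative : monoid_morphism grp_incl.
Proof.
split; first by rewrite [LHS]grp_incl_mono rmorph1.
move=> x y; elim/cp_ind: x => [|l g x IHx]; first by rewrite mul0r grp_incl0 mul0r.
rewrite mulrDl !grp_inclD IHx mulrDl {IHx}; congr (_ + _).
elim/cp_ind: y => [|m h y IHy]; first by rewrite mulr0 grp_incl0 mulr0.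
rewrite mulrDr !grp_inclD IHy mulrDr {IHy}; congr (_ + _).
by rewrite cp_monoM !grp_incl_mono cp_monoM /= linf_act_const rmorphM.
Qed.

HB.instance Definition _ :=
  GRing.isZmodMorphism.Build (groupRing G Z) crossedLinf grp_incl
    grp_incl_is_additive.
HB.instance Definition _ :=
  GRing.isMonoidMorphism.Build (groupRing G Z) crossedLinf grp_incl
    grp_incl_is_multiplicative.

End LinfAction.

Section Marked.
Variables (R : realType) (G : groupType) (d : measure_display).
Variables (X : measurableType d) (mu : probability X R) (a : pmpAction G mu).
Variable Z : normedRing R.
Local Notation S := (crossedLinf a Z).

(* The left ideal S (chi_A, 1). *)
Definition cyc (A : set X) : set S :=
  [set x | exists r : S,
     x = r * cp_mono (linf_action a Z) (linf_indic mu Z A) 1%g].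

(* A finite family of measurable sets together with an isomorphism, [mk_coord],
   from M onto the direct sum of the left ideals [cyc (mk_set i)]. *)
Record marking (M : lmodType S) := Marking {
  mk_idx : finType;
  mk_set : mk_idx -> set X;
  mk_measurable : forall i, measurable (mk_set i);
  mk_coord : {linear M -> {ffun mk_idx -> S^o}};
  mk_coord_inj : injective mk_coord;
  mk_coord_image : forall v : {ffun mk_idx -> S^o},
    (exists z, mk_coord z = v) <-> (forall i, cyc (mk_set i) (v i)) }.

Arguments mk_set {M} m i.

Definition fam_dim (I : finType) (B : I -> set X) : R :=
  \sum_i fine (mu (B i)).

Definition mdim (M : lmodType S) (m : marking M) : R := fam_dim (mk_set m).

Definition summand (M : lmodType S) (m : marking M) (B : mk_idx m -> set X)
  : set M := [set z | forall i, cyc (B i) (mk_coord m z i)].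

Definition subfamily (M : lmodType S) (m : marking M) (B : mk_idx m -> set X) :=
  forall i, measurable (B i) /\ B i `<=` mk_set m i.

Arguments summand {M} m B.
Arguments subfamily {M} m B.

Definition cp_norm1 (x : S) : R :=
  \sum_(g <- cp_supp x) linf_norm1 (cp_coef x g).

Definition mnorm (M : lmodType S) (m : marking M) (z : M) : R :=
  \sum_i cp_norm1 (mk_coord m z i).

Definition log_plus (t : R) : R := Num.max (ln t) 0.

Section Lognorm.
Variables (M N : lmodType S) (mM : marking M) (mN : marking N).
Variable f : {linear M -> N}.

(* In the next three definitions [A] is a subfamily of the marking of M, and the
   quantity is that of f restricted to [summand mM A]; [A := mk_set mM] gives
   that of f itself. The set of constants c below is never empty, since
   homomorphisms between marked projective modules are bounded; the condition
   0 <= c only matters when [summand mM A] is zero. *)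
Definition opnorm (A : mk_idx mM -> set X) : R :=
  inf [set c | 0 <= c /\
    forall z, summand mM A z -> mnorm mN (f z) <= c * mnorm mM z].

Definition rk (A : mk_idx mM -> set X) : R :=
  inf [set fam_dim B | B in
    [set B | subfamily mN B /\ forall z, summand mM A z -> summand mN B (f z)]].

Definition lognorm' (A : mk_idx mM -> set X) : R :=
  Num.min (fam_dim A * log_plus (opnorm A)) (rk A * log_plus (opnorm A)).

Definition marked_decomposition (p : nat) (A : 'I_p -> mk_idx mM -> set X) :=
  (forall k i, measurable (A k i)) /\
  (forall i, trivIset setT (A ^~ i) /\ \bigcup_k A k i = mk_set mM i).

Definition lognorm : R :=
  inf [set s | exists (p : nat) (A : 'I_p -> mk_idx mM -> set X),
    marked_decomposition A /\ s = \sum_(k < p) lognorm' (A k)].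

End Lognorm.

Record markedComplex := MarkedComplex {
  mc_cplx :> augComplex (linfMod a Z);
  mc_mark : forall k, marking (mc_cplx k) }.

Section Embedding.
Variables (C : augComplex (trivmod G Z)) (n : nat).

(* The condition only involves the maps f_0, ..., f_(n+1): those of higher degree
   are arbitrary and may be taken to be 0. *)
Definition embeds (D : markedComplex) :=
  exists f : forall k, {linear C k -> D k | grp_incl a (Z := Z) \; *:%R},
    (forall x, ch_aug D (f 0%N x) = linf_const mu (ch_aug C x)) /\
    (forall k, (k <= n)%N -> forall x,
       f k (ch_bd C k x) = ch_bd D k (f k.+1 x)).

Definition medim : \bar R :=
  ereal_inf [set t | exists D : markedComplex,
    embeds D /\ t = (mdim (mc_mark D n))%:E].

Definition mevol : \bar R :=
  ereal_inf [set t | exists D : markedComplex,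
    embeds D /\ t = (lognorm (mc_mark D n.+1) (mc_mark D n) (ch_bd D n))%:E].

End Embedding.
End Marked.

(* Main.v *)
Require Import Defs.
From HB Require Import structures.
From mathcomp Require Import all_boot all_order all_algebra finfield finmap.
From mathcomp Require Import zify lra.
From mathcomp Require Import all_classical all_reals all_analysis measurable_realfun.
Set Implicit Arguments.
Unset Strict Implicit.
Unset Printing Implicit Defensive.
Import Order.TTheory GRing.Theory Num.Theory.
Local Open Scope classical_set_scope.
Local Open Scope ring_scope.

(** A finite measurable colouring c of X records, through the pattern
    g |-> c (g^-1 x) of a point x, all coefficients and marking sets of an embedded
    complex over alpha. By weak containment there is a colouring of Y whose
    patterns on a given finite subset of G occur in X with positive measure, outside
    a set E of small measure. The same expressions in the colouring define over
    beta matrices satisfying outside E all equations of an embedded complex.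

    Removing from the marking sets the points with a translate in E, for finitely
    many translations, makes the equations hold exactly; on the removed part, a
    finitely generated projective resolution of Z over Z[G] is glued in, so that
    the chain map from C survives. This changes the dimension by a multiple of
    nu(E). The norm of a homomorphism on a marked submodule is the essential
    supremum of the row sums of its matrix, a local function of the pattern, so
    that it does not grow either, while the new part contributes at most a
    constant multiple of nu(E) to the lognorm. *)

(** * Matrix resolutions *)

(** The obstacle is that over beta the relations hold only off E, whereas a marked complex must
    satisfy them exactly. Shrinking the marking sets restores the relations but destroys the chain
    map from C, which has to lift the constant function 1 on all of Y. The remedy splits a row v of
    the resolution as v = v inn + v out along a good set: the inner part is sent to the transported
    complex by the transported chain map T, the outer part stays in the resolution. Taking, on the
    retained part, the differential of the resolution followed by this same splitting yields a
    complex and a chain map together. The cost is controlled because all translations lie in a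
    finite set K and the ranks of the resolution are finite up to degree n + 1, which is where
    FP_(n+1) enters; C may have infinite rank and is reached only through comparison maps. K, these
    ranks and the norm bounds of the glued part are fixed before E, so their contribution tends to 0
    with nu(E). Finite colourings suffice because bounded subsets of Z are finite. *)

Section LinearCombinations.
Variables (S : pzRingType) (m : nat) (M : lmodType S).

Definition lincomb (e : 'I_m -> M) (v : 'rV[S]_m) : M := \sum_i v 0 i *: e i.

Fact lincomb_is_linear e : linear (lincomb e).
Proof.
move=> a u v; rewrite /lincomb scaler_sumr -big_split /=.
by apply: eq_bigr => i _; rewrite !mxE scalerDl scalerA.
Qed.
HB.instance Definition _ e :=
  GRing.isLinear.Build S 'rV[S]_m M *:%R (lincomb e) (lincomb_is_linear e).

Lemma lincomb_delta e i : lincomb e (delta_mx 0 i) = e i.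
Proof.
rewrite /lincomb (bigD1 i) //= big1 ?addr0; first by rewrite mxE !eqxx scale1r.
by move=> j ji; rewrite mxE eqxx (negPf ji) scale0r.
Qed.

Lemma linear_rowE (f : {linear 'rV[S]_m -> M}) v :
  f v = lincomb (fun i => f (delta_mx 0 i)) v.
Proof.
rewrite {1}(row_sum_delta v) linear_sum; apply: eq_bigr => i _.
by rewrite linearZ.
Qed.

Lemma linear_row_ext (f g : {linear 'rV[S]_m -> M}) :
  (forall i, f (delta_mx 0 i) = g (delta_mx 0 i)) -> f =1 g.
Proof.
by move=> h v; rewrite linear_rowE (linear_rowE g); apply: eq_bigr => i _; rewrite h.
Qed.

End LinearCombinations.

Section RightMultiplication.
Variables (S : pzRingType) (m p : nat) (A : 'M[S]_(m, p)).

(** Modules are left modules over a noncommutative ring, so linear maps act on rows by right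
    multiplication and matrix products read in the order of application. *)
Definition rmulmx (v : 'rV[S]_m) : 'rV[S]_p := v *m A.

Fact rmulmx_is_linear : linear rmulmx.
Proof. by move=> a u v; rewrite /rmulmx mulmxDl scalemxAl. Qed.
HB.instance Definition _ :=
  GRing.isLinear.Build S 'rV[S]_m 'rV[S]_p *:%R rmulmx rmulmx_is_linear.

End RightMultiplication.

Lemma linear_mulmx (S : pzRingType) (m p : nat)
    (f : {linear 'rV[S]_m -> 'rV[S]_p}) :
  f =1 rmulmx (\matrix_(i, j) f (delta_mx 0 i) 0 j).
Proof.
apply: linear_row_ext => i; apply/rowP => j.
by rewrite /= /rmulmx -rowE !mxE.
Qed.

Lemma lincomb_mulmx (S : pzRingType) (m p : nat) (M : lmodType S)
    (e : 'I_p -> M) (A : 'M[S]_(m, p)) (v : 'rV[S]_m) :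
  lincomb e (v *m A) = lincomb (fun i => lincomb e (row i A)) v.
Proof.
rewrite -[lincomb e (v *m A)]/((lincomb e \o rmulmx A) v) linear_rowE.
by apply: eq_bigr => i _; rewrite /= /rmulmx -rowE.
Qed.

Section FreeLift.
Variables (S : pzRingType) (C A B : lmodType S).

(** Uniqueness makes the coordinates of an element of C linear in it, so any choice of preimages for
    the basis extends to a linear lift. The map [h] need only reach the image of [g], since the
    lifts below go through cycles. *)
Lemma free_lift (g : {linear C -> B}) (h : {linear A -> B}) : is_free C ->
  (forall x, exists y, h y = g x) ->
  exists f : {linear C -> A}, forall x, h (f x) = g x.
Proof.
move=> [J [e eP]] hg.
have [y yP] : exists y : J -> A, forall j, h (y j) = g (e j).
  by have [y yP] := choice (fun j => hg (e j)); exists y.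
have [c cP] : exists c : C -> {fsfun J -> S with 0},
    forall x, x = \sum_(j <- finsupp (c x)) c x j *: e j /\
      forall c', x = \sum_(j <- finsupp c') c' j *: e j -> c x = c'.
  by have [c cP] := choice eP; exists c => x; have [] := cP x.
pose ev (N : lmodType S) (z : J -> N) (u : {fsfun J -> S with 0}) :=
  \sum_(j <- finsupp u) u j *: z j.
have evw (N : lmodType S) (z : J -> N) (u : {fsfun J -> S with 0}) (F : {fset J}) : (finsupp u `<=` F)%fset ->
    ev N z u = \sum_(j <- F) u j *: z j.
  move=> uF; apply: big_fset_incl => // j _ ju.
  by rewrite fsfun_dflt // scale0r.
have evL (N : lmodType S) (z : J -> N) a (u v w : {fsfun J -> S with 0}) :
    (forall j, w j = a * u j + v j) -> ev N z w = a *: ev N z u + ev N z v.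
  move=> wE; pose F := (finsupp u `|` finsupp v `|` finsupp w)%fset.
  have uF : (finsupp u `<=` F)%fset.
    by apply/fsubsetP => j; rewrite !in_fsetU => ->.
  have vF : (finsupp v `<=` F)%fset.
    by apply/fsubsetP => j; rewrite !in_fsetU => ->; rewrite orbT.
  have wF : (finsupp w `<=` F)%fset.
    by apply/fsubsetP => j; rewrite !in_fsetU => ->; rewrite orbT.
  rewrite (evw _ _ _ _ uF) (evw _ _ _ _ vF) (evw _ _ _ _ wF).
  rewrite scaler_sumr -big_split /=.
  by apply: eq_bigr => j _; rewrite wE scalerDl scalerA.
have cL a x x' j : c (a *: x + x') j = a * c x j + c x' j.
  pose w : {fsfun J -> S with 0} :=
    [fsfun j in (finsupp (c x) `|` finsupp (c x'))%fset => a * c x j + c x' j].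
  have wE i : w i = a * c x i + c x' i.
    rewrite fsfunE in_fsetU; case: ifPn => //; rewrite negb_or => /andP[h1 h2].
    by rewrite !fsfun_dflt // mulr0 addr0.
  rewrite -wE; congr (fun_of_fsfun _ j); apply: (cP _).2.
  rewrite -[RHS]/(ev _ e w) (evL _ _ _ _ _ _ wE).
  by congr (_ *: _ + _); [exact: (cP x).1|exact: (cP x').1].
pose f x := ev A y (c x).
have fL : linear f by move=> a x x'; apply: evL; exact: cL.
pose F : {linear C -> A} := HB.pack f (GRing.isLinear.Build S C A *:%R f fL).
exists F => x; rewrite [in RHS](cP x).1 /= /f /ev !linear_sum /=.
by apply: eq_bigr => j _; rewrite !linearZ /= yP.
Qed.

End FreeLift.

(** Chain maps are built degree by degree and their type changes with the degree. [Q] is the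
    invariant that makes the next step possible, [P] the relation between consecutive maps that is
    retained. *)
Lemma dependent_choice (T : nat -> Type) (Q : forall k, T k -> Prop)
    (P : forall k, T k -> T k.+1 -> Prop) (x0 : T 0%N) : Q 0%N x0 ->
  (forall k x, Q k x -> exists y, Q k.+1 y /\ P k x y) ->
  exists f : forall k, T k, f 0%N = x0 /\ forall k, P k (f k) (f k.+1).
Proof.
move=> Q0 step.
pose nxt k (x : {x : T k | Q k x}) : {y : T k.+1 | Q k.+1 y /\ P k (sval x) y} :=
  cid (step k (sval x) (svalP x)).
pose F := fix F k : {x : T k | Q k x} :=
  match k with
  | 0%N => exist _ x0 Q0
  | k.+1 => exist _ (sval (nxt k (F k))) (svalP (nxt k (F k))).1
  end.
exists (fun k => sval (F k)); split=> // k.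
exact: (svalP (nxt k (F k))).2.
Qed.

(** F is a vector space over its prime field and [tau] picks integer representatives of coordinates.
    Spanning and independence are phrased with integers in order to lift elements of F[G] to
    Z[G]. *)
Lemma finField_int_basis (F : finFieldType) :
  exists (p q : nat) (b : 'I_q -> F) (tau : 'I_q -> F -> int),
    [/\ (0 < p)%N, p%:R = 0 :> F,
      forall f, f = \sum_i b i * (tau i f)%:~R &
      forall z : 'I_q -> int, \sum_i b i * (z i)%:~R = 0 ->
        forall i, (p%:Z %| z i)%Z].
Proof.
have [p pr_p pF] := finPcharP F.
pose L : vectType 'F_p := pPrimeCharType pF.
pose X := vbasis (@fullv _ L).
exists p, (\dim (@fullv _ L)), (fun i => X`_i : F).
exists (fun i f => Posz (coord X i (f : L))); split.
- exact: prime_gt0.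
- exact: pcharf0 pF.
- move=> f; rewrite [LHS](coord_vbasis (memvf (f : L))).
  by apply: eq_bigr => i _; rewrite mulrC.
- move=> z z0 i.
  have /freeP/(_ (fun i => (z i)%:~R)) Xz : free X.
    exact: basis_free (vbasisP _).
  rewrite (@dvdz_pcharf 'F_p p) ?pchar_Fp //; apply/eqP/Xz.
  rewrite -[RHS]z0; apply: eq_bigr => j _.
  by rewrite scaler_int mulrzr.
Qed.

(** * Functoriality of crossed products in the coefficients *)

Section CrossedMap.
Variables (G : groupType) (A B : pzRingType).
Variables (aA : ringAction G A) (aB : ringAction G B).
Variable phi : {rmorphism A -> B}.
Hypothesis phi_equivariant : forall g l, phi (aA g l) = aB g (phi l).

(** The equivariance proof is an argument so that, outside the section, the term carries what its
    ring morphism structure depends on. The uses are reduction to a finite field, inclusion of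
    constants and realization of symbols. *)
Definition crossed_map (_ : forall g l, phi (aA g l) = aB g (phi l))
  (x : crossed aA) : crossed aB := cp_ext (fun g l => cp_mono aB (phi l) g) x.

Local Notation psi := (crossed_map phi_equivariant).

Let phiD g l m : cp_mono aB (phi (l + m)) g = cp_mono aB (phi l) g + cp_mono aB (phi m) g.
Proof. by rewrite rmorphD cp_monoD. Qed.

Lemma crossed_map_mono l g : psi (cp_mono aA l g) = cp_mono aB (phi l) g.
Proof. exact: (cp_ext_mono _ phiD). Qed.

Lemma crossed_map_coef x g : cp_coef (psi x) g = phi (cp_coef x g).
Proof.
elim/cp_ind: x => [|l h x IHx].
  by rewrite /crossed_map (cp_ext0 _ phiD) !cp_coef0 rmorph0.
rewrite /crossed_map (cp_extD phiD) -!/(psi _) crossed_map_mono !cp_coefD rmorphD IHx.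
by rewrite !cp_monoE; case: ifP; rewrite ?rmorph0.
Qed.

Fact crossed_map_is_additive : zmod_morphism psi.
Proof.
move=> x y; apply: (addIr (psi y)).
by rewrite /crossed_map -(cp_extD phiD) !subrK.
Qed.

Fact crossed_map_is_multiplicative : monoid_morphism psi.
Proof.
split; first by rewrite [LHS]crossed_map_mono rmorph1.
have psi0 : psi 0 = 0 by exact: (cp_ext0 _ phiD).
have psiD u v : psi (u + v) = psi u + psi v by exact: (cp_extD phiD).
move=> x y; elim/cp_ind: x => [|l g x IHx]; first by rewrite mul0r psi0 mul0r.
rewrite mulrDl !psiD IHx mulrDl {IHx}; congr (_ + _).
elim/cp_ind: y => [|m h y IHy]; first by rewrite mulr0 psi0 mulr0.
rewrite mulrDr !psiD IHy mulrDr {IHy}; congr (_ + _).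
by rewrite cp_monoM !crossed_map_mono cp_monoM /= rmorphM phi_equivariant.
Qed.

HB.instance Definition _ :=
  GRing.isZmodMorphism.Build (crossed aA) (crossed aB) psi crossed_map_is_additive.
HB.instance Definition _ :=
  GRing.isMonoidMorphism.Build (crossed aA) (crossed aB) psi
    crossed_map_is_multiplicative.

Lemma crossed_map_scale (x : crossed aA) (l : coefmod aA) :
  phi (x *: l) = (psi x : crossed aB) *: (phi l : coefmod aB).
Proof.
elim/cp_ind: x => [|m g x IHx]; first by rewrite scale0r !rmorph0 scale0r.
rewrite scalerDl [LHS]rmorphD IHx rmorphD scalerDl; congr (_ + _).
transitivity (phi (m * aA g l)); first by congr (phi _); exact: coef_scale_mono.
rewrite rmorphM phi_equivariant -(coef_scale_mono (ac := aB)).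
by congr coef_scale; rewrite -crossed_map_mono.
Qed.

End CrossedMap.

(* The modules of the resolution are the images of the idempotents [e k] for
   k <= n; in degree n + 1 a free module covering the cycles is enough. *)
Record mx_resolution (G : groupType) (Z : pzRingType) (n : nat) (r : nat -> nat)
    (d : forall k, 'M[groupRing G Z]_(r k.+1, r k))
    (e : forall k, 'M[groupRing G Z]_(r k))
    (ep : 'I_(r 0) -> trivmod G Z) : Prop := MxResolution {
  mxr_idem : forall k, (k <= n)%N -> e k *m e k = e k;
  mxr_dd : forall k, (k < n)%N -> d k.+1 *m d k = 0;
  mxr_de : forall k, (k <= n)%N -> d k *m e k = d k;
  mxr_ed : forall k, (k < n)%N -> e k.+1 *m d k = d k;
  mxr_epd : forall v, lincomb ep (v *m d 0) = 0;
  mxr_epe : forall v, lincomb ep (v *m e 0) = lincomb ep v;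
  mxr_ep_surj : exists v, lincomb ep v = (1 : Z);
  mxr_exact0 : forall v, v *m e 0 = v -> lincomb ep v = 0 ->
    exists y, v = y *m d 0;
  mxr_exact : forall k, (k < n)%N -> forall v : 'rV_(r k.+1), v *m e k.+1 = v ->
    v *m d k = 0 -> exists y, v = y *m d k.+1 }.

(** By projectivity a surjection [p] from a free module onto [P k] has a section [s]. Then p
    followed by s is an idempotent with image isomorphic to [P k], and the differential on rows is
    p, the boundary, then s. *)
Lemma type_FP_mx_resolution (G : groupType) (n : nat) : type_FP G n.+1 ->
  exists r d e ep, @mx_resolution G int n r d e ep.
Proof.
move=> [P [[P0 PS] projP fgP]].
pose S := groupRing G int.
have H k : exists t : {m : nat &
    ({linear 'rV[S]_m -> P k} * {linear P k -> 'rV[S]_m})%type},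
    (k <= n.+1)%N -> forall x, (projT2 t).1 ((projT2 t).2 x) = x.
  have [kn|kn] := leqP k n.+1; last first.
    (* Above degree n + 1 no finite generation is available; rank 0 fills these degrees. *)
    exists (existT _ 0%N (lincomb (fun=> 0) : {linear _ -> _},
      \0 : {linear _ -> _})).
    by [].
  have [m [g gP]] := fgP k kn.
  have [|s sP] := projP k 'rV[S]_m (P k) (lincomb g) idfun.
    move=> y; have [c cP] := gP y; exists (\row_i c i).
    by rewrite /= /lincomb cP; apply: eq_bigr => i _; rewrite mxE.
  by exists (existT _ m (lincomb g : {linear _ -> _}, s)).
pose t k := sval (cid (H k)).
pose r k := projT1 (t k).
pose p k : {linear 'rV[S]_(r k) -> P k} := (projT2 (t k)).1.
pose s k : {linear P k -> 'rV[S]_(r k)} := (projT2 (t k)).2.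
have ps k : (k <= n.+1)%N -> cancel (s k) (p k) := svalP (cid (H k)).
pose d k : 'M[S]_(r k.+1, r k) :=
  \matrix_(i, j) (s k \o ch_bd P k \o p k.+1) (delta_mx 0 i) 0 j.
pose e k : 'M[S]_(r k) := \matrix_(i, j) (s k \o p k) (delta_mx 0 i) 0 j.
have dE k v : v *m d k = s k (ch_bd P k (p k.+1 v)).
  by rewrite -[LHS]/(rmulmx _ v) -(linear_mulmx (s k \o ch_bd P k \o p k.+1)).
have eE k v : v *m e k = s k (p k v).
  by rewrite -[LHS]/(rmulmx _ v) -(linear_mulmx (s k \o p k)).
pose ep i := (ch_aug P \o p 0%N) (delta_mx 0 i).
have epE v : lincomb ep v = ch_aug P (p 0%N v).
  by rewrite -(linear_rowE (ch_aug P \o p 0%N)).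
have mxP m1 m2 (X Y : 'M[S]_(m1, m2)) : (forall v : 'rV_m1, v *m X = v *m Y) -> X = Y.
  by move=> h; apply/row_matrixP => i; rewrite !rowE h.
exists r, d, e, ep; split.
- by move=> k kn; apply: mxP => v; rewrite mulmxA !eE ps // (leq_trans kn).
- move=> k kn; apply: mxP => v.
  by rewrite mulmxA !dE ps ?ch_bdbd ?linear0 ?mulmx0 // ltnW.
- by move=> k kn; apply: mxP => v; rewrite mulmxA !dE eE ps // (leq_trans kn).
- move=> k kn; apply: mxP => v.
  by rewrite mulmxA !dE eE ps // ltnW.
- by move=> v; rewrite epE dE ps // ch_augbd.
- by move=> v; rewrite !epE eE ps.
- have [x xP] := ch_aug_surj P (1 : int).
  by exists (s 0%N x); rewrite epE ps.
- move=> v ve; rewrite epE => /P0[y yP]; exists (s 1%N y).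
  by rewrite dE ps // yP -eE.
- move=> k kn v ve; rewrite dE => h.
  have /PS[y yP] : ch_bd P k (p k.+1 v) = 0.
    have kn1 : (k <= n.+1)%N by rewrite ltnW // ltnW.
    by rewrite -[LHS](ps k kn1) h linear0.
  exists (s k.+2 y).
  by rewrite dE ps // yP -eE.
Qed.

(** * Comparison maps in both directions *)

Section ComparisonMaps.
Variables (G : groupType) (Z : pzRingType) (n : nat).
Variable C : augComplex (trivmod G Z).
Local Notation S := (groupRing G Z).
Variables (r : nat -> nat) (d : forall k, 'M[S]_(r k.+1, r k)).
Variables (e : forall k, 'M[S]_(r k)) (ep : 'I_(r 0) -> trivmod G Z).
Hypothesis resd : mx_resolution n d e ep.

(** Row modules are free, so basis vectors can be sent to arbitrary preimages in C. The map is
    defined on all rows, including those outside the images of the idempotents. *)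
Lemma from_mx_resolution : resolution C ->
  exists psi : forall k, {linear 'rV[S]_(r k) -> C k},
    (forall v, ch_aug C (psi 0%N v) = lincomb ep v) /\
    forall k, (k <= n)%N -> forall v,
      psi k (v *m d k) = ch_bd C k (psi k.+1 v).
Proof.
move=> [C0 CS].
pose cyc k : C k -> Prop :=
  match k return C k -> Prop with
  | 0%N => fun x => ch_aug C x = 0
  | k.+1 => fun x => ch_bd C k x = 0
  end.
have cycP k x : cyc k x -> exists y, ch_bd C k y = x.
  by case: k x => [|k] x; [exact: C0|exact: CS].
have lift k (f : {linear 'rV[S]_(r k) -> C k}) :
    (forall v, cyc k (f (v *m d k))) ->
    exists f' : {linear 'rV[S]_(r k.+1) -> C k.+1},
      forall v, f (v *m d k) = ch_bd C k (f' v).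
  move=> fc; have [y yP] := choice (fun i => cycP k _ (fc (delta_mx 0 i))).
  exists (lincomb y : {linear _ -> _}).
  apply: (@linear_row_ext _ _ _ (f \o rmulmx (d k)) (ch_bd C k \o lincomb y)) => i.
  by rewrite /= lincomb_delta yP.
have [y yP] := choice (fun i => ch_aug_surj C (ep i)).
pose Q k (f : {linear 'rV[S]_(r k) -> C k}) :=
  (k <= n)%N -> forall v, cyc k (f (v *m d k)).
pose P k (f : {linear 'rV[S]_(r k) -> C k}) (f' : {linear 'rV[S]_(r k.+1) -> C k.+1}) :=
  (k <= n)%N -> forall v, f (v *m d k) = ch_bd C k (f' v).
have aug0 v : ch_aug C (lincomb y v) = lincomb ep v.
  apply: (@linear_row_ext _ _ _ (ch_aug C \o lincomb y) (lincomb ep)) => i.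
  by rewrite /= !lincomb_delta yP.
have [||psi [psi0 psiP]] := @dependent_choice _ Q P (lincomb y).
- by move=> _ v /=; rewrite aug0 (mxr_epd resd).
- move=> k f Qf; have [kn|kn] := leqP k n; last first.
    exists (lincomb (fun=> 0) : {linear _ -> _}); split=> h.
      by have := ltn_trans kn h; rewrite ltnn.
    by rewrite leqNgt kn in h.
  have [f' f'P] := lift k f (Qf kn); exists f'; split => // k1n v /=.
  by rewrite -f'P -mulmxA (mxr_dd resd) // mulmx0 linear0.
exists psi; split; first by rewrite psi0.
exact: psiP.
Qed.

(** Exactness of the rows is available only on the images of the idempotents, so up to degree n each
    lift is multiplied by [e]. In degree n + 1 any lift through [d n] will do. *)
Lemma to_mx_resolution : (forall k, is_free (C k)) ->
  exists phi : forall k, {linear C k -> 'rV[S]_(r k)},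
    (forall x, lincomb ep (phi 0%N x) = ch_aug C x) /\
    forall k, (k <= n)%N -> forall x,
      phi k (ch_bd C k x) = phi k.+1 x *m d k.
Proof.
move=> freeC.
pose T k := {linear C k -> 'rV[S]_(r k)}.
pose Q k (f : T k) := (k <= n)%N -> forall x, exists y, f (ch_bd C k x) = y *m d k.
pose P k (f : T k) (f' : T k.+1) :=
  (k <= n)%N -> forall x, f (ch_bd C k x) = f' x *m d k.
have [v1 v1P] := mxr_ep_surj resd.
have epZ z : lincomb ep (cp_mono (triv_action G Z) z 1%g *: v1) = z.
  rewrite linearZ /= v1P -[LHS]/(coef_scale _ _) coef_scale_mono.
  by rewrite ract1 mulr1.
have [|f0 f0P] := free_lift (g := ch_aug C) (h := lincomb ep) (freeC 0%N).
  by move=> x; exists (cp_mono (triv_action G Z) (ch_aug C x) 1%g *: v1); exact: epZ.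
pose f0e : T 0%N := rmulmx (e 0) \o f0.
have f0eP x : lincomb ep (f0e x) = ch_aug C x.
  by rewrite /f0e /= /rmulmx (mxr_epe resd) f0P.
have [||phi [phi0 phiP]] := @dependent_choice _ Q P f0e.
- move=> _ x; apply: (mxr_exact0 resd).
    by rewrite /f0e /= /rmulmx -mulmxA (mxr_idem resd).
  by rewrite f0eP ch_augbd.
- move=> k f Qf; have [kn|kn] := leqP k n; last first.
    exists (\0 : {linear _ -> _}); split=> h.
      by have := ltn_trans kn h; rewrite ltnn.
    by rewrite leqNgt kn in h.
  have [|f' f'P] := free_lift (g := f \o ch_bd C k) (h := rmulmx (d k)) (freeC k.+1).
    by move=> x; have [y yP] := Qf kn x; exists y; rewrite /= yP.
  have [k1n|k1n] := ltnP k n; last first.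
    exists f'; split=> h; first by have := leq_trans h k1n; rewrite ltnn.
    by move=> x; rewrite -[RHS]/(rmulmx (d k) (f' x)) f'P.
  exists (rmulmx (e k.+1) \o f' : {linear _ -> _}).
  have ed : e k.+1 *m d k = d k by exact: mxr_ed resd k k1n.
  split=> _ x.
    apply: (mxr_exact resd) => //=.
      by rewrite /rmulmx -mulmxA (mxr_idem resd).
    rewrite /rmulmx -mulmxA ed -[LHS]/(rmulmx (d k) _) f'P.
    by rewrite /= ch_bdbd linear0.
  by rewrite /= /rmulmx -mulmxA ed -[RHS]/(rmulmx (d k) _) f'P.
exists phi; split; last exact: phiP.
by move=> x; rewrite phi0 f0eP.
Qed.

End ComparisonMaps.

Section FiniteFieldBaseChange.
Variables (G : groupType) (F : finFieldType).
Local Notation actZ := (triv_action G int).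
Local Notation actF := (triv_action G F).

Let intF : {rmorphism int -> F} := intmul 1.
Let intF_equivariant g l : intF (actZ g l) = actF g (intF l).
Proof. by []. Qed.

Definition groupRing_int_to_field : {rmorphism groupRing G int -> groupRing G F} :=
  crossed_map intF_equivariant.
Local Notation rho := groupRing_int_to_field.

Let rho_coef x g : cp_coef (rho x) g = (cp_coef x g)%:~R.
Proof. exact: crossed_map_coef. Qed.

Let cmulE c (x : groupRing G F) g :
  cp_coef (cp_mono actF c 1%g * x) g = c * cp_coef x g.
Proof.
elim/cp_ind: x => [|l h x IHx]; first by rewrite mulr0 !cp_coef0 mulr0.
rewrite mulrDr !cp_coefD IHx mulrDr; congr (_ + _).
rewrite cp_monoM ract1 mul1g !cp_monoE.
by case: ifP; rewrite ?mulr0.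
Qed.

(* A basis of F over its prime field F_p writes elements of F[G] as combinations
   of reductions of elements of Z[G]; a relation makes every term divisible by
   p, and the quotients can be lifted since the Z[G]-complex is torsion-free. *)
Lemma mx_resolution_finField (n : nat) (r : nat -> nat) d e ep :
  @mx_resolution G int n r d e ep ->
  @mx_resolution G F n r (fun k => map_mx rho (d k)) (fun k => map_mx rho (e k))
    (fun i => ((ep i : int)%:~R : F)).
Proof.
move=> res.
have [p [q [b [tau [p0 pF bE b0]]]]] := finField_int_basis F.
pose ep' : 'I_(r 0) -> trivmod G F := fun i => (ep i : int)%:~R.
rewrite -[X in mx_resolution _ _ _ X]/ep'.
have epM (v : 'rV_(r 0)) : 
    lincomb ep' (map_mx rho v) = (lincomb ep v : int)%:~R :> F.
  rewrite /lincomb (rmorph_sum intF); apply: eq_bigr => i _.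
  by rewrite mxE [RHS](crossed_map_scale intF_equivariant).
have rhoM m1 m2 m3 (A : 'M[groupRing G int]_(m1, m2)) (B : 'M[groupRing G int]_(m2, m3)) :
  map_mx rho (A *m B) = map_mx rho A *m map_mx rho B by exact: map_mxM.
pose bb i := cp_mono actF (b i) 1%g.
pose lift i (x : groupRing G F) : groupRing G int :=
  ([fsfun g in cp_supp x => tau i (cp_coef x g)] : {fsfun G -> int with 0}).
have liftE m (x : 'rV[groupRing G F]_m) :
    x = \sum_i bb i *: map_mx rho (map_mx (lift i) x).
  apply/rowP => j; rewrite summxE; apply: cpP => g; rewrite cp_coef_sum.
  have liftc i : cp_coef (lift i (x 0 j)) g =
      if g \in cp_supp (x 0 j) then tau i (cp_coef (x 0 j) g) else 0.
    by rewrite /cp_coef fsfunE.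
  have [gx|gx] := boolP (g \in cp_supp (x 0 j)).
    rewrite [LHS]bE; apply: eq_bigr => i _.
    by rewrite !mxE cmulE rho_coef liftc gx.
  rewrite cp_coef_out // big1 // => i _.
  by rewrite !mxE cmulE rho_coef liftc (negPf gx) mulr0.
have divp m (y : 'I_q -> 'rV[groupRing G int]_m) :
    \sum_i bb i *: map_mx rho (y i) = 0 -> forall i, exists w, y i = w *+ p.
  move=> y0 i.
  pose w : 'rV[groupRing G int]_m := \row_j
    ([fsfun g in cp_supp (y i 0 j) => divz (cp_coef (y i 0 j) g) p] :
      {fsfun G -> int with 0}).
  exists w; apply/rowP => j; rewrite -scaler_nat mxE; apply: cpP => g.
  have -> : p%:R * w 0 j = w 0 j *+ p by rewrite mulr_natl.
  have -> : w 0 j *+ p = \sum_(t < p) w 0 j by rewrite sumr_const card_ord.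
  rewrite cp_coef_sum sumr_const card_ord mxE.
  rewrite [in RHS]/cp_coef fsfunE; case: ifPn => [_|gy]; last first.
    by rewrite cp_coef_out // mul0rn.
  have pz : (p%:Z %| cp_coef (y i 0%R j) g)%Z.
    apply: (b0 (fun i => cp_coef (y i 0 j) g)).
    have := congr1 (fun v : 'rV[groupRing G F]_m => cp_coef (v 0 j) g) y0.
    rewrite summxE cp_coef_sum mxE cp_coef0 => y0j; rewrite -[RHS]y0j.
    by apply: eq_bigr => t _; rewrite !mxE cmulE rho_coef.
  by rewrite -mulr_natr natz divzK.
have torsion m (w : 'rV[groupRing G int]_m) : w *+ p = 0 -> w = 0.
  move=> w0; apply/rowP => j; rewrite mxE; apply: cpP => g; rewrite cp_coef0.
  have := congr1 (fun v : 'rV[groupRing G int]_m => cp_coef (v 0 j) g) w0.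
  rewrite mxE cp_coef0.
  have -> : (w *+ p) 0 j = \sum_(t < p) w 0 j.
    by rewrite sumr_const card_ord -scaler_nat mxE mulr_natl.
  rewrite cp_coef_sum sumr_const card_ord => /eqP.
  by rewrite mulrn_eq0 -[_ == 0%N]negbK -lt0n p0 => /eqP.
have rhop m (w : 'rV[groupRing G int]_m) : map_mx rho (w *+ p) = 0.
  apply/rowP => j; rewrite !mxE; apply: cpP => g; rewrite rho_coef cp_coef0.
  have -> : (w *+ p) 0 j = \sum_(t < p) w 0 j.
    by rewrite sumr_const card_ord -scaler_nat mxE mulr_natl.
  by rewrite cp_coef_sum sumr_const card_ord rmorphMn /= -mulr_natr pF mulr0.
have sumM m1 m2 (y : 'I_q -> 'rV[groupRing G int]_m1) (A : 'M[groupRing G int]_(m1, m2)) :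
    (\sum_i bb i *: map_mx rho (y i)) *m map_mx rho A =
    \sum_i bb i *: map_mx rho (y i *m A).
  rewrite mulmx_suml; apply: eq_bigr => i _.
  by rewrite -scalemxAl rhoM.
have eps_bb i (v : 'rV[groupRing G int]_(r 0)) :
    lincomb ep' (bb i *: map_mx rho v) = b i * (lincomb ep v : int)%:~R :> F.
  rewrite linearZ /= epM; exact: (coef_scale_mono (ac := actF)).
split.
- by move=> k kn; rewrite -rhoM (mxr_idem res).
- by move=> k kn; rewrite -rhoM (mxr_dd res) // map_mx0.
- by move=> k kn; rewrite -rhoM (mxr_de res).
- by move=> k kn; rewrite -rhoM (mxr_ed res).
- move=> v; rewrite (liftE _ v) sumM linear_sum big1 // => i _.
  by rewrite /= eps_bb (mxr_epd res) mulr0.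
- move=> v; rewrite (liftE _ v) sumM !linear_sum; apply: eq_bigr => i _.
  by rewrite /= !eps_bb (mxr_epe res).
- by have [v vE] := mxr_ep_surj res; exists (map_mx rho v); rewrite epM vE.
- move=> v ve v0.
  pose x i := map_mx (lift i) v *m e 0.
  have vx : v = \sum_i bb i *: map_mx rho (x i) by rewrite -sumM -liftE.
  have xe i : x i *m e 0 = x i by rewrite -mulmxA (mxr_idem res).
  have pz : forall i, (p%:Z %| lincomb ep (x i))%Z.
    apply: b0; rewrite -[RHS]v0 vx linear_sum; apply: eq_bigr => i _.
    by rewrite /= eps_bb.
  have [u uE] := mxr_ep_surj res.
  have [y yP] : exists y, forall i, exists w, x i = y i *m d 0 + w *+ p.
    suff H i : exists y w, x i = y *m d 0 + w *+ p.
      by have [y yP] := choice H; exists y.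
    have /dvdzP[z zE] := pz i.
    (* The row [t] has augmentation [z], the quotient by p of that of [x i]. Hence [x i - t *+ p]
       has augmentation 0, and it has the same reduction as [x i]. *)
    pose t := cp_mono actZ z 1%g *: u *m e 0.
    have tE : lincomb ep t = z.
      rewrite (mxr_epe res) linearZ /= uE -[LHS]/(coef_scale _ _) coef_scale_mono.
      by rewrite ract1 mulr1.
    have [||y yE] := mxr_exact0 res (v := x i - t *+ p).
    + by rewrite mulmxBl xe; congr (_ - _);
        rewrite -[t *+ p]scaler_nat -scalemxAl -mulmxA (mxr_idem res).
    + rewrite linearB linearMn /= tE zE.
      by rewrite -[z *+ p]mulr_natr natz subrr.
    by exists y, t; rewrite -yE subrK.
  exists (\sum_i bb i *: map_mx rho (y i)); rewrite sumM [LHS]vx.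
  apply: eq_bigr => i _; have [w ->] := yP i.
  by rewrite map_mxD rhop addr0.
- move=> k kn v ve v0.
  pose x i := map_mx (lift i) v *m e k.+1.
  have vx : v = \sum_i bb i *: map_mx rho (x i) by rewrite -sumM -liftE.
  have xe i : x i *m e k.+1 = x i by rewrite -mulmxA (mxr_idem res).
  have dx : forall i, exists w, x i *m d k = w *+ p.
    by apply: divp; rewrite -sumM -vx.
  have [y yP] : exists y, forall i, exists w, x i = y i *m d k.+1 + w *+ p.
    suff H i : exists y w, x i = y *m d k.+1 + w *+ p.
      by have [y yP] := choice H; exists y.
    have [w wE] := dx i.
    (* The row [w] is fixed by [e k] and is a cycle, because p w is and rows over Z[G] have no
       p-torsion. So it is a boundary by exactness one degree lower, and subtracting p times the
       projection of [t] from [x i] leaves a cycle with the same reduction. *)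
    have [t tE] : exists t, w = t *m d k.
      have we : w *m e k = w.
        apply/eqP; rewrite -subr_eq0; apply/eqP/torsion.
        rewrite mulrnBl -wE -[w *m e k *+ p]scaler_nat scalemxAl scaler_nat -wE.
        by rewrite -mulmxA (mxr_de res) ?subrr // ltnW.
      case: k kn v ve v0 x vx xe dx w wE we => [|k] kn v ve v0 x vx xe dx w wE we.
        apply: (mxr_exact0 res) => //.
        have : (lincomb ep w : int) *+ p = 0.
          by rewrite -[LHS](linearMn (lincomb ep)) /= -wE (mxr_epd res).
        by move/eqP; rewrite mulrn_eq0 -[_ == 0%N]negbK -lt0n p0 => /eqP.
      apply: (mxr_exact res) => //; first exact: ltnW.
      apply: torsion; rewrite -scaler_nat scalemxAl scaler_nat -wE -mulmxA.
      by rewrite (mxr_dd res) ?mulmx0 // ltnW.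
    pose t' := t *m e k.+1.
    have [||y yE] := mxr_exact res kn (v := x i - t' *+ p).
    + by rewrite mulmxBl xe; congr (_ - _);
        rewrite -[t' *+ p]scaler_nat -scalemxAl -mulmxA (mxr_idem res).
    + rewrite mulmxBl -[t' *+ p]scaler_nat -scalemxAl.
      rewrite /t' -[t *m _ *m _]mulmxA (mxr_ed res) // -tE.
      by rewrite scaler_nat wE subrr.
    by exists y, t'; rewrite -yE subrK.
  exists (\sum_i bb i *: map_mx rho (y i)); rewrite sumM [LHS]vx.
  apply: eq_bigr => i _; have [w ->] := yP i.
  by rewrite map_mxD rhop addr0.
Qed.

End FiniteFieldBaseChange.

(** * Weak containment and colourings *)

Section Probability.
Variables (R : realType) (d : measure_display) (X : measurableType d).
Variable mu : probability X R.
Local Notation pr A := (fine (mu A)).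

Lemma pr_ge0 (A : set X) : 0 <= pr A.
Proof. exact/fine_ge0/measure_ge0. Qed.

Lemma pr_setT : pr [set: X] = 1.
Proof. by rewrite probability_setT. Qed.

Lemma pr_set0 : pr (set0 : set X) = 0.
Proof. by rewrite measure0. Qed.

Lemma pr_le (A B : set X) : measurable A -> measurable B -> A `<=` B -> pr A <= pr B.
Proof.
move=> mA mB AB; apply: fine_le; rewrite ?fin_num_measure //.
by apply: le_measure; rewrite ?inE.
Qed.

Lemma pr_setU (A B : set X) : measurable A -> measurable B ->
  pr (A `|` B) = pr A + pr B - pr (A `&` B).
Proof.
move=> mA mB; rewrite measureUfinl //; last first.
  by rewrite -ge0_fin_numE ?measure_ge0 // fin_num_measure.
have mI : measurable (A `&` B) by exact: measurableI.
by rewrite fineB ?fineD ?fin_numD ?fin_num_measure.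
Qed.

Lemma pr_setC (A : set X) : measurable A -> pr (~` A) = 1 - pr A.
Proof. by move=> mA; rewrite probability_setC // fineB ?fin_num_measure. Qed.

Lemma pr_setU_le (A B : set X) : measurable A -> measurable B ->
  pr (A `|` B) <= pr A + pr B.
Proof. by move=> mA mB; rewrite pr_setU // lerBlDr lerDl pr_ge0. Qed.

Lemma pr_bigU_le (I : Type) (s : seq I) (P : pred I) (A : I -> set X) :
  (forall i, measurable (A i)) ->
  pr (\big[setU/set0]_(i <- s | P i) A i) <= \sum_(i <- s | P i) pr (A i).
Proof.
move=> mA; elim: s => [|i s IH]; first by rewrite !big_nil pr_set0.
rewrite !big_cons; case: ifP => // _.
apply: le_trans (pr_setU_le _ _) _ => //; first exact: bigsetU_measurable.
by rewrite lerD2l.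
Qed.

(** Adding a set to a union of s others loses at most s overlaps of measure [e], and s^2 + s is at
    most (s + 1)^2. *)
Lemma pr_bigU_ge (I : eqType) (s : seq I) (A : I -> set X) (e : R) : 0 <= e ->
  uniq s -> (forall i, measurable (A i)) ->
  {in s &, forall i j, i != j -> pr (A i `&` A j) <= e} ->
  \sum_(i <- s) pr (A i) <=
    pr (\big[setU/set0]_(i <- s) A i) + (size s ^ 2)%:R * e.
Proof.
move=> e0 us mA; elim: s us => [|i s IH] /= us AA.
  by rewrite !big_nil pr_set0 mul0r addr0.
have /andP[iNs us'] := us; rewrite !big_cons.
have mU : measurable (\big[setU/set0]_(j <- s) A j) by exact: bigsetU_measurable.
rewrite pr_setU //.
have {}IH : \sum_(j <- s) pr (A j) <= pr (\big[setU/set0]_(j <- s) A j) + (size s ^ 2)%:R * e.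
  by apply: IH => // j k js ks; apply: AA; rewrite in_cons ?js ?ks orbT.
have H : pr (A i `&` \big[setU/set0]_(j <- s) A j) <= (size s)%:R * e.
  have -> : A i `&` \big[setU/set0]_(j <- s) A j = \big[setU/set0]_(j <- s) (A i `&` A j).
    by apply: (big_morph (fun B => A i `&` B) (fun B C => setIUr (A i) B C) (setI0 _)).
  apply: le_trans (pr_bigU_le _ _ _) _; first by move=> j; exact: measurableI.
  rewrite mulr_natl big_seq.
  apply: le_trans (_ : \sum_(j <- s | j \in s) e <= _).
    apply: ler_sum => j js; apply: AA; rewrite ?in_cons ?eqxx ?js ?orbT //.
    by apply: contraNneq iNs => ->.
  by rewrite -big_seq big_const_seq count_predT iter_addr_0.
have : ((size s).+1 ^ 2)%:R * e = (size s ^ 2)%:R * e + (size s)%:R * e + (size s).+1%:R * e.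
  by rewrite -!mulrDl -!natrD; congr (_%:R * _); lia.
have : 0 <= (size s).+1%:R * e by rewrite mulr_ge0.
move: H IH => /=; lra.
Qed.

Lemma ae_witness (P : X -> Prop) (A : set X) : measurable A -> pr A != 0 ->
  {ae mu, forall x, P x} -> exists2 x, A x & P x.
Proof.
move=> mA A0 [N [mN N0 PN]]; apply: contrapT => nAP; case/eqP: A0.
apply/eqP; rewrite eq_le pr_ge0 andbT.
apply: le_trans (_ : pr N <= _); last by rewrite N0.
apply: pr_le => // x Ax; apply: PN => Px; apply: nAP; by exists x.
Qed.

End Probability.

Section FiniteValued.
Variables (d : measure_display) (X : measurableType d).

Definition fin_measurable (T : Type) (v : X -> T) :=
  forall t, measurable (v @^-1` [set t]).

Lemma fin_measurable_preimage (T : finType) (v : X -> T) (D : set T) :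
  fin_measurable v -> measurable (v @^-1` D).
Proof.
move=> mv; have -> : v @^-1` D = \bigcup_(t in D) (v @^-1` [set t]).
  by apply/seteqP; split=> [x Dx|x [t Dt /= ->]] //; exists (v x).
by apply: fin_bigcup_measurable => // t _; exact: mv.
Qed.

Lemma fin_measurable_comp (T : finType) (U : Type) (v : X -> T) (h : T -> U) :
  fin_measurable v -> fin_measurable (h \o v).
Proof. by move=> mv u; exact: (fin_measurable_preimage (h @^-1` [set u]) mv). Qed.

Lemma fin_measurable_ffun (T : finType) (U : Type) (v : X -> {ffun T -> U}) :
  (forall t, fin_measurable (fun x => v x t)) -> fin_measurable v.
Proof.
move=> mv f.
have -> : v @^-1` [set f] = \bigcap_(t in [set: T]) ((fun x => v x t) @^-1` [set f t]).
  apply/seteqP; split=> [x /= <- //|x /= h].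
  by apply/ffunP => t; exact: h.
by apply: fin_bigcap_measurable => // t _; exact: mv.
Qed.

End FiniteValued.

Lemma pact_imageE (R : realType) (G : groupType) (d : measure_display)
    (X : measurableType d) (mu : probability X R) (a : pmpAction G mu) g (A : set X) :
  a g @` A = a g^-1%g @^-1` A.
Proof.
apply/seteqP; split=> [x [y Ay <-]|x Ax] /=.
  by rewrite -pactM mulVg pact1.
by exists (a g^-1%g x) => //; rewrite -pactM mulgV pact1.
Qed.

Section Patterns.
Variables (R : realType) (G : groupType) (d : measure_display).
Variables (X : measurableType d) (mu : probability X R) (a : pmpAction G mu).

(** The inverse makes the pattern of g^-1 x the left translate h |-> p (g h) of the pattern p of x,
    in accordance with (g . f)(x) = f (g^-1 x). *)
Definition pattern (I : Type) (c : X -> I) (x : X) : G -> I :=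
  fun g => c (a g^-1%g x).

End Patterns.

Definition local_on (G : groupType) (I : Type) (U : Type) (F : {fset G})
    (f : (G -> I) -> U) :=
  forall p q, (forall g, g \in F -> p g = q g) -> f p = f q.

Section Transfer.
Variables (R : realType) (G : groupType) (d d' : measure_display).
Variables (X : measurableType d) (Y : measurableType d').
Variables (mu : probability X R) (nu : probability Y R).
Variables (a : pmpAction G mu) (b : pmpAction G nu).
Hypothesis ab : weakly_contained a b.
Variables (I : finType) (c : X -> I).
Hypothesis mc : fin_measurable c.
Variables (F : {fset G}) (eps : R).
Hypothesis eps0 : 0 < eps.
Local Notation prX A := (fine (mu A)).
Local Notation prY A := (fine (nu A)).

(* Weak containment is applied to the sets of points of X with a given pattern
   on F, so that pairwise intersections control whole patterns. *)
Lemma transfer_colouring : exists (c' : Y -> I) (E : set Y),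
  [/\ fin_measurable c', measurable E, prY E < eps,
      forall P : (G -> I) -> Prop, local_on F P ->
        {ae mu, forall x, P (pattern a c x)} ->
        forall y, ~ E y -> P (pattern b c' y)
    & forall J : set I, prY (c' @^-1` J) <= prX (c @^-1` J) + eps].
Proof.
have [x0 _] : exists x : X, True by apply: (@prob_witness _ _ _ mu); apply: aeW.
pose F1 : {fset G} := (1%g |` F)%fset.
have F1one : 1%g \in F1 by rewrite in_fset1U eqxx.
pose one : F1 := [` F1one]%fset.
pose Phi := {ffun F1 -> I}.
pose pat (x : X) : Phi := [ffun g : F1 => pattern a c x (val g)].
have mpat : fin_measurable pat.
  apply: fin_measurable_ffun => g i; rewrite (_ : _ @^-1` _ =
    a (val g)^-1%g @^-1` (c @^-1` [set i])); first exact: pact_meas_preimage.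
  by apply/seteqP; split => x /=; rewrite ffunE.
pose A phi := pat @^-1` [set phi].
have mA phi : measurable (A phi) by exact: mpat.
pose n := #|{: Phi}|; pose f := #|{: F1}|.
(* Room for all errors, counted in multiples of [del]: f (n + n^2) for [E4], f n^2 for [E3], and n +
   n + n^2 for the colour classes. The successor makes the bound on the exceptional set strict. *)
pose K := (f * (n + n ^ 2) + f * n ^ 2 + n + n + n ^ 2).+1.
pose del := eps / K%:R.
have del0 : 0 < del by rewrite divr_gt0 // ltr0n.
have [B' mB' WB'] := @ab n (fun i => A (enum_val i)) F1 del (fun i => mA _) del0.
pose B phi := B' (enum_rank phi).
have mB phi : measurable (B phi) by exact: mB'.
have WB g phi psi : g \in F1 ->
    `| prX ((a g @` A phi) `&` A psi) - prY ((b g @` B phi) `&` B psi)| < del.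
  by move=> gF; have := WB' g (enum_rank phi) (enum_rank psi) gF; rewrite !enum_rankK.
have img1X (D : set X) : a 1%g @` D = D.
  by rewrite pact_imageE invg1; apply/seteqP; split => x /=; rewrite pact1.
have img1Y (D : set Y) : b 1%g @` D = D.
  by rewrite pact_imageE invg1; apply/seteqP; split => x /=; rewrite pact1.
have BA phi : `|prX (A phi) - prY (B phi)| < del.
  by have := WB 1%g phi phi F1one; rewrite img1X img1Y !setIid.
have BB phi psi : phi != psi -> prY (B phi `&` B psi) <= del.
  move=> neq; have := WB 1%g phi psi F1one; rewrite img1X img1Y.
  rewrite (_ : A phi `&` A psi = set0) ?pr_set0; last first.
    by apply/seteqP; split=> // x [/= xphi xpsi]; case/eqP: neq; rewrite -xphi -xpsi.
  by rewrite sub0r normrN ger0_norm ?pr_ge0 // => /ltW.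
pose pos phi := prX (A phi) != 0.
pose s := [seq phi <- enum Phi | pos phi].
have szs : (size s <= n)%N by rewrite size_filter /n cardE count_size.
(* The points in no [B phi] with [phi] of positive measure. They are few: the corresponding [A phi]
   fill X up to measure 0, and the [B phi] have nearly the same measures and are nearly disjoint. *)
pose E2 := ~` \big[setU/set0]_(phi <- s) B phi.
have mU2 : measurable (\big[setU/set0]_(phi <- s) B phi) by exact: bigsetU_measurable.
have mE2 : measurable E2 by exact: measurableC.
have size_le k : (size s ^ k)%:R * del <= (n ^ k)%:R * del.
  by rewrite ler_pM2r // ler_nat; case: k => // k; rewrite leq_exp2r.
have prE2 : prY E2 <= (n + n ^ 2)%:R * del.
  have h1 : 1 <= \sum_(phi <- s) prX (A phi).
    rewrite big_filter big_enum_cond /=.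
    rewrite (_ : \sum_(phi | _) _ = \sum_phi prX (A phi)).
      apply: le_trans (pr_bigU_le _ _ _ mA).
      rewrite (_ : \big[_/_]_(_ <- _ | _) _ = setT) ?pr_setT //.
      apply/seteqP; split=> // x _.
      by rewrite (bigD1 (pat x)) //=; left.
    rewrite [RHS](bigID pos) /= [X in _ = _ + X]big1 ?addr0 //.
    by move=> phi; rewrite negbK => /eqP.
  have h2 : \sum_(phi <- s) prX (A phi) <= \sum_(phi <- s) prY (B phi) + n%:R * del.
    have : \sum_(phi <- s) prX (A phi) <= \sum_(phi <- s) (prY (B phi) + del).
      by apply: ler_sum => phi _; have := BA phi; rewrite ltr_norml; lra.
    rewrite big_split /= big_const_seq count_predT iter_addr_0 -mulr_natl.
    have := size_le 1%N; rewrite !expn1; lra.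
  have h3 := pr_bigU_ge (ltW del0) (filter_uniq pos (enum_uniq Phi)) mB
    (fun phi psi _ _ => @BB phi psi).
  have h4 := size_le 2%N.
  rewrite pr_setC // natrD mulrDl; move: h1 h2 h3 h4; rewrite -/s; lra.
(* Contradictory memberships: y lies in [B phi] and g^-1 y in [B psi], but the colour [psi] gives to
   g^-1 y differs from the one predicted by [phi]. The corresponding intersections in X are
   empty. *)
pose E3 := \big[setU/set0]_(t : F1 * (Phi * Phi) | t.2.2 one != t.2.1 t.1)
  ((b (val t.1) @` B t.2.2) `&` B t.2.1).
have mimg g (D : set Y) : measurable D -> measurable (b g @` D).
  by move=> mD; rewrite pact_imageE; exact: pact_meas_preimage.
have mE3 : measurable E3.
  by apply: bigsetU_measurable => t _; apply: measurableI => //; exact: mimg.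
pose E4 := \big[setU/set0]_(g : F1) (b (val g) @` E2).
have mE4 : measurable E4 by apply: bigsetU_measurable => g _; exact: mimg.
have prE3 : prY E3 <= (f * n ^ 2)%:R * del.
  apply: le_trans (pr_bigU_le _ _ _ _) _ => [t|].
    by apply: measurableI => //; exact: mimg.
  apply: (@le_trans _ _ (\sum_(t : F1 * (Phi * Phi)) del)); last first.
    by rewrite sumr_const !card_prod -/f -/n mulr_natl mulnn.
  rewrite big_mkcond /=; apply: ler_sum => -[g [phi psi]] _ /=.
  case: ifPn => [neq|_]; last exact: ltW.
  have := WB (val g) psi phi (valP g).
  rewrite (_ : _ `&` A phi = set0) ?pr_set0; last first.
    apply/seteqP; split=> // x []; rewrite pact_imageE /= => h1 h2.
    case/eqP: neq; rewrite -h1 -h2 !ffunE /pattern /= invg1 pact1 //.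
  by rewrite sub0r normrN ger0_norm ?pr_ge0 // => /ltW.
have prE4 : prY E4 <= f%:R * ((n + n ^ 2)%:R * del).
  apply: le_trans (pr_bigU_le _ _ _ _) _ => [g|]; first exact: mimg.
  rewrite mulr_natl -[f]/#|{: F1}| -sumr_const; apply: ler_sum => g _.
  by rewrite pact_imageE pact_preserving.
(* The new colour of a point is the value at 1 of some positive pattern whose set contains it, with
   a colour of X as default. It depends only on the finite vector of memberships, hence is
   measurable. *)
pose sel (v : {ffun Phi -> bool}) : I :=
  if [pick phi | pos phi && v phi] is Some phi then phi one else c x0.
pose v (y : Y) : {ffun Phi -> bool} := [ffun phi => `[< B phi y >]].
have mv : fin_measurable v.
  apply: fin_measurable_ffun => phi bb.
  rewrite (_ : _ @^-1` _ = if bb then B phi else ~` B phi).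
    by case: bb => //; exact: measurableC.
  case: bb; apply/seteqP; split=> y /=; rewrite ffunE.
  - by move/asboolP.
  - by move=> ?; apply/asboolP.
  - by move/asboolPn.
  - by move=> ?; apply/asboolPn.
pose c' := sel \o v.
have inU y : (\big[setU/set0]_(phi <- s) B phi) y -> exists2 phi, pos phi & B phi y.
  rewrite /s; elim: (enum Phi) => [|phi t IH] /=; first by rewrite big_nil.
  case: ifPn => [pphi|_] //; rewrite big_cons => -[By|]; last exact: IH.
  by exists phi.
have selP y : ~ E2 y -> exists phi, [/\ pos phi, B phi y & c' y = phi one].
  rewrite /E2 => /contrapT/inU[phi pphi Bphi].
  rewrite /c' /= /sel; case: pickP => [psi /andP[ppsi]|/(_ phi)].
    by rewrite ffunE => /asboolP Bpsi; exists psi.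
  by rewrite pphi ffunE /= => /asboolPn.
have inE4 y (g : F1) : ~ E4 y -> ~ E2 (b (val g)^-1%g y).
  apply: contra_not => Ey; rewrite /E4 (bigD1 g) //; left.
  by rewrite pact_imageE.
have prEbound m : (m <= K)%N -> m%:R * del <= eps.
  move=> mK; rewrite /del mulrA ler_pdivrMr ?ltr0n // mulrC ler_pM2l //.
  by rewrite ler_nat.
have prEbound' m : (m < K)%N -> m%:R * del < eps.
  move=> mK; rewrite /del mulrA ltr_pdivrMr ?ltr0n // mulrC ltr_pM2l //.
  by rewrite ltr_nat.
exists c', (E3 `|` E4); split.
- exact: fin_measurable_comp.
- exact: measurableU.
- apply: (le_lt_trans (pr_setU_le _ _ _)) => //.
  apply: (le_lt_trans (lerD prE3 prE4)).
  rewrite mulrA -natrM -mulrDl -natrD; apply: prEbound'.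
  by rewrite /K; lia.
(* Off [E4] every translate involved is coloured by a positive pattern, and off [E3] these patterns
   agree with the one [phi] selected at y. So y has on F the pattern of a point x where P holds. *)
- move=> P locP aeP y /not_orP[nE3 nE4].
  have nE2 : ~ E2 y.
    by have := inE4 y one nE4; rewrite /= invg1 pact1.
  have [phi [pphi Bphi c'phi]] := selP y nE2.
  have [x Ax Px] := ae_witness (mA phi) pphi aeP.
  rewrite -(locP (pattern a c x)) // => g gF.
  have gF1 : g \in F1 by rewrite in_fset1U gF orbT.
  pose g1 : F1 := [` gF1]%fset.
  have -> : pattern a c x g = phi g1 by rewrite -Ax ffunE.
  have [psi [ppsi Bpsi c'psi]] := selP _ (inE4 y g1 nE4).
  rewrite /pattern [c' _]c'psi; apply/eqP; rewrite eq_sym; apply: contra_notT nE3 => neq.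
  rewrite /E3 (bigD1 (g1, (phi, psi))) //; left; split => //.
  by rewrite pact_imageE.
(* The class of J is covered by [E2] and the [B phi] with phi(1) in J; at most n comparisons of
   measures and the bound on [E2] give the error. *)
- move=> J.
  pose t := [seq phi : Phi <- enum Phi | `[< J (phi one) >]].
  have mcJ : measurable (c @^-1` J) by exact: fin_measurable_preimage.
  have szt : (size t <= n)%N by rewrite size_filter /n cardE count_size.
  have h1 : \sum_(phi <- t) prX (A phi) <= prX (c @^-1` J).
    have := @pr_bigU_ge _ _ _ mu _ t A 0 (lexx _) (filter_uniq _ (enum_uniq Phi)) mA.
    rewrite mulr0 addr0 => h; apply: le_trans (h _) _.
      move=> phi psi _ _ neq; rewrite (_ : A phi `&` A psi = set0) ?pr_set0 //.
      by apply/seteqP; split=> // x [/= xphi xpsi]; case/eqP: neq; rewrite -xphi -xpsi.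
    apply: pr_le => //; first exact: bigsetU_measurable.
    rewrite /t; elim: (enum Phi) => [|phi l IH] /=; first by rewrite big_nil.
    case: ifPn => [/asboolP Jphi|_] //; rewrite big_cons => x [/= Ax|]; last exact: IH.
    by move: Jphi; rewrite -Ax ffunE /pattern /= invg1 pact1.
  have h2 : \sum_(phi <- t) prY (B phi) <= \sum_(phi <- t) prX (A phi) + n%:R * del.
    have : \sum_(phi <- t) prY (B phi) <= \sum_(phi <- t) (prX (A phi) + del).
      by apply: ler_sum => phi _; have := BA phi; rewrite ltr_norml; lra.
    rewrite big_split /= big_const_seq count_predT iter_addr_0 -mulr_natl.
    have : (size t)%:R * del <= n%:R * del by rewrite ler_pM2r // ler_nat.
    lra.
  have h3 : prY (c' @^-1` J) <= \sum_(phi <- t) prY (B phi) + prY E2.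
    have mt : measurable (\big[setU/set0]_(phi <- t) B phi) by exact: bigsetU_measurable.
    apply: le_trans (_ : prY (\big[setU/set0]_(phi <- t) B phi `|` E2) <= _).
      apply: pr_le; [|exact: measurableU|].
        apply: fin_measurable_preimage; exact: fin_measurable_comp.
      move=> y Jy; have [|/selP[phi [pphi Bphi c'phi]]] := pselect (E2 y); first by right.
      left; have : phi \in t.
        by rewrite mem_filter mem_enum andbT; apply/asboolP; rewrite -c'phi.
      elim: (t) => // psi l IH; rewrite in_cons big_cons => /orP[/eqP <-|/IH]; first by left.
      by right.
    by apply: le_trans (pr_setU_le _ _ _) _ => //; rewrite lerD2r; exact: pr_bigU_le.
  have : n%:R * del + (n + n ^ 2)%:R * del <= eps.
    by rewrite -mulrDl -natrD; apply: prEbound; rewrite /K; lia.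
  move: h1 h2 h3 prE2; lra.
Qed.

End Transfer.

(** * Expressions in a colouring *)

(* A local function of p : G -> I stands for the element x |-> f (g |-> c (g^-1 x))
   of Linf, for any colouring c by I; elements of [symRing] accordingly stand for
   elements of the crossed product of any action with such a colouring. *)
Section LocalFunctions.
Variables (G : groupType) (I : Type) (Z : pzRingType).

Definition is_local (f : (G -> I) -> Z) : bool :=
  `[< exists F : {fset G}, local_on F f >].

Lemma local_on_sub (U : Type) (F F' : {fset G}) (f : (G -> I) -> U) :
  (F `<=` F')%fset -> local_on F f -> local_on F' f.
Proof. by move=> /fsubsetP FF' lf p q pq; apply: lf => g /FF'; exact: pq. Qed.

Fact is_local_op2 (op : Z -> Z -> Z) f f' : is_local f -> is_local f' ->
  is_local (fun p => op (f p) (f' p)).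
Proof.
move=> /asboolP[F lF] /asboolP[F' lF']; apply/asboolP; exists (F `|` F')%fset.
by move=> p q pq; congr op; [apply: lF|apply: lF'] => g gF; apply: pq;
  rewrite in_fsetU gF ?orbT.
Qed.

Fact is_local_subring : subring_closed (is_local : {pred (G -> I) -> Z}).
Proof.
split; first by apply/asboolP; exists fset0.
- by move=> f f' lf lf'; exact: (is_local_op2 (fun a b => a - b)).
- by move=> f f' lf lf'; exact: is_local_op2.
Qed.

HB.instance Definition _ := GRing.isSubringClosed.Build ((G -> I) -> Z)
  is_local is_local_subring.

Record locfun := Locfun {
  loc_val :> (G -> I) -> Z;
  loc_valP : loc_val \in is_local }.

HB.instance Definition _ := [isSub for loc_val].
HB.instance Definition _ := [Choice of locfun by <:].
HB.instance Definition _ :=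
  GRing.SubChoice_isSubPzRing.Build ((G -> I) -> Z) is_local locfun
    (subringClosedP _).

Fact loc_shift_subproof g (f : locfun) :
  (fun p : G -> I => f (fun h => p (g * h)%g)) \in is_local.
Proof.
have /asboolP[F lF] := loc_valP f; apply/asboolP.
exists [fset (g * h)%g | h in F]%fset => p q pq; apply: lF => h hF.
by apply: pq; apply/imfsetP; exists h.
Qed.

Definition loc_shift g (f : locfun) : locfun := Locfun (loc_shift_subproof g f).

Lemma locfunP (f f' : locfun) : (forall p, f p = f' p) -> f = f'.
Proof. by move=> h; apply/val_inj/funext. Qed.

Fact loc_shift_is_additive g : zmod_morphism (loc_shift g).
Proof. by move=> f f'; exact: locfunP. Qed.
Fact loc_shift_is_multiplicative g : monoid_morphism (loc_shift g).
Proof. by split=> [|f f']; exact: locfunP. Qed.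
HB.instance Definition _ g :=
  GRing.isZmodMorphism.Build locfun locfun (loc_shift g) (loc_shift_is_additive g).
HB.instance Definition _ g :=
  GRing.isMonoidMorphism.Build locfun locfun (loc_shift g)
    (loc_shift_is_multiplicative g).

Fact loc_shift1 f : loc_shift 1%g f = f.
Proof.
by apply: locfunP => p /=; congr (loc_val f _); apply/funext => h; rewrite mul1g.
Qed.
Fact loc_shiftM g h f : loc_shift (g * h)%g f = loc_shift g (loc_shift h f).
Proof.
by apply: locfunP => p /=; congr (loc_val f _); apply/funext => k; rewrite mulgA.
Qed.

Definition loc_action : ringAction G locfun :=
  @RingAction G locfun (fun g => loc_shift g) loc_shift1 loc_shiftM.

Definition symRing : pzRingType := crossed loc_action.
Definition symMod : lmodType symRing := coefmod loc_action.

Fact loc_one_subproof (h : I -> Z) : (fun p : G -> I => h (p 1%g)) \in is_local.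
Proof.
apply/asboolP; exists [fset 1%g]%fset => p q pq.
by rewrite pq // in_fset1.
Qed.
Definition loc_one (h : I -> Z) : locfun := Locfun (loc_one_subproof h).

Fact loc_const_is_additive : zmod_morphism (fun z => loc_one (fun=> z)).
Proof. by move=> z z'; exact: locfunP. Qed.
Fact loc_const_is_multiplicative : monoid_morphism (fun z => loc_one (fun=> z)).
Proof. by split=> [|z z']; exact: locfunP. Qed.

Definition loc_const (z : Z) : locfun := loc_one (fun=> z).
HB.instance Definition _ :=
  GRing.isZmodMorphism.Build Z locfun loc_const loc_const_is_additive.
HB.instance Definition _ :=
  GRing.isMonoidMorphism.Build Z locfun loc_const loc_const_is_multiplicative.

Fact loc_const_equivariant g z : loc_const (triv_action G Z g z) = loc_action g (loc_const z).
Proof. exact: locfunP. Qed.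

Definition sym_incl : {rmorphism groupRing G Z -> symRing} :=
  crossed_map loc_const_equivariant.

Definition sym_local_on (F : {fset G}) (u : symRing) :=
  forall g, local_on F (cp_coef u g).

Lemma seq_local (T : eqType) (P : {fset G} -> T -> Prop) (s : seq T) :
  (forall F F' x, (F `<=` F')%fset -> P F x -> P F' x) ->
  (forall x, exists F, P F x) -> exists F, forall x, x \in s -> P F x.
Proof.
move=> PF Pex; elim: s => [|x s [F FP]]; first by exists fset0.
have [F' F'P] := Pex x; exists (F `|` F')%fset => y.
rewrite in_cons => /orP[/eqP ->|ys].
  by apply: PF F'P; exact: fsubsetUr.
by apply: PF (FP _ ys); exact: fsubsetUl.
Qed.

Lemma sym_local (u : symRing) : exists F, sym_local_on F u.
Proof.
have [||F FP] := @seq_local _ (fun F g => local_on F (cp_coef u g)) (cp_supp u).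
- by move=> F F' g FF'; exact: local_on_sub.
- by move=> g; exact/asboolP/(loc_valP (cp_coef u g)).
exists F => g; have [gu|gu] := boolP (g \in cp_supp u); first exact: FP.
by rewrite cp_coef_out.
Qed.

End LocalFunctions.

Section Realization.
Variables (R : realType) (G : groupType) (d : measure_display).
Variables (X : measurableType d) (mu : probability X R) (a : pmpAction G mu).
Variables (Z : normedRing R) (I : finType) (c : X -> I).
Hypothesis mc : fin_measurable c.
Local Notation Loc := (locfun G I Z).
Local Notation S := (crossedLinf a Z).

(** A local function factors through the patterns on a finite set F, of which there are finitely
    many; hence it is measurable and bounded. *)
Lemma realize_subproof (f : Loc) :
  (fun x => f (pattern a c x)) \in @ess_bounded_measurable _ _ _ mu Z.
Proof.
have /asboolP[F lF] := loc_valP f.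
pose v (x : X) : {ffun F -> I} := [ffun g : F => pattern a c x (val g)].
have mv : fin_measurable v.
  apply: fin_measurable_ffun => g i.
  rewrite (_ : _ @^-1` _ = a (val g)^-1%g @^-1` (c @^-1` [set i])).
    exact: pact_meas_preimage.
  by apply/seteqP; split => x /=; rewrite ffunE.
have vf x y : v x = v y -> f (pattern a c x) = f (pattern a c y).
  move=> vxy; apply: lF => g gF.
  by have := congr1 (fun w : {ffun F -> I} => w [` gF]%fset) vxy; rewrite !ffunE.
apply/asboolP; split.
  move=> B; pose D := [set w | exists2 x, v x = w & B (f (pattern a c x))].
  rewrite (_ : _ @^-1` B = v @^-1` D); first exact: fin_measurable_preimage.
  apply/seteqP; split=> [x Bx|x [y vy By]] /=; first by exists x.
  by rewrite (vf x y).
have [x0 _] : exists x : X, True by apply: (@prob_witness _ _ _ mu); apply: aeW.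
pose rep w := xget x0 [set x | v x = w].
have repP x : v (rep (v x)) = v x.
  by rewrite /rep; case: xgetP => [y -> //|/(_ x)]; case.
exists (\sum_(w : {ffun F -> I}) nr_norm (f (pattern a c (rep w)))); apply: aeW => x.
rewrite (vf x (rep (v x))) ?repP // (bigD1 (v x)) //= lerDl.
by apply: sumr_ge0 => w _; exact: nr_norm_ge0.
Qed.

Definition realize_fun (f : Loc) : bddfun mu Z := Bddfun (realize_subproof f).
Definition realize_loc (f : Loc) : Linf mu Z := linf_class (realize_fun f).

Fact realize_loc_is_additive : zmod_morphism realize_loc.
Proof.
by move=> f g; rewrite /realize_loc -linf_classB; apply/linf_classP; apply: aeW.
Qed.
Fact realize_loc_is_multiplicative : monoid_morphism realize_loc.
Proof.
split; first by rewrite -linf_class1; apply/linf_classP; apply: aeW.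
by move=> f g; rewrite /realize_loc -linf_classM; apply/linf_classP; apply: aeW.
Qed.
HB.instance Definition _ :=
  GRing.isZmodMorphism.Build Loc (Linf mu Z) realize_loc realize_loc_is_additive.
HB.instance Definition _ :=
  GRing.isMonoidMorphism.Build Loc (Linf mu Z) realize_loc
    realize_loc_is_multiplicative.

Fact realize_equivariant g f :
  realize_loc (loc_action G I Z g f) = linf_action a Z g (realize_loc f).
Proof.
rewrite /= linf_act_class; apply/linf_classP; apply: aeW => x /=.
by congr (loc_val f _); apply/funext => h; rewrite /pattern invgM pactM.
Qed.

Definition realize : {rmorphism symRing G I Z -> S} :=
  crossed_map realize_equivariant.

Lemma realize_coef u g : cp_coef (realize u) g = realize_loc (cp_coef u g).
Proof. exact: crossed_map_coef. Qed.

Lemma realize_mono l g :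
  realize (cp_mono (loc_action G I Z) l g) = cp_mono (linf_action a Z) (realize_loc l) g.
Proof. exact: crossed_map_mono. Qed.

Lemma realize_scale (u : symRing G I Z) (l : symMod G I Z) :
  realize_loc (u *: l) = (realize u *: (realize_loc l : linfMod a Z) : linfMod a Z).
Proof. exact: crossed_map_scale. Qed.

Lemma realize_one h (f : bddfun mu Z) : {ae mu, forall x, f x = h (c x)} ->
  realize_loc (loc_one G h) = linf_class f.
Proof.
move=> fh; apply/linf_classP; apply: filterS fh => x -> /=.
by rewrite /pattern invg1 pact1.
Qed.

Lemma realize_const z : realize_loc (loc_const G I z) = linf_const mu z.
Proof. by apply/linf_classP; apply: aeW. Qed.

Lemma grp_incl_mono z h :
  grp_incl a (cp_mono (triv_action G Z) z h) = cp_mono (linf_action a Z) (linf_const mu z) h.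
Proof.
have inclD k (l m : Z) : cp_mono (linf_action a Z) (linf_const mu (l + m)) k =
    cp_mono _ (linf_const mu l) k + cp_mono _ (linf_const mu m) k.
  by rewrite rmorphD cp_monoD.
exact: (cp_ext_mono _ inclD).
Qed.

Lemma grp_incl_coef (x : groupRing G Z) g :
  cp_coef (grp_incl a x) g = linf_const mu (cp_coef x g).
Proof.
elim/cp_ind: x => [|z h x IHx]; first by rewrite rmorph0 !cp_coef0 rmorph0.
rewrite rmorphD !cp_coefD IHx rmorphD; congr (_ + _).
transitivity (cp_coef (cp_mono (linf_action a Z) (linf_const mu z) h) g).
  by congr cp_coef; exact: grp_incl_mono.
by rewrite !cp_monoE; case: ifP; rewrite ?rmorph0.
Qed.

Lemma realize_sym_incl (x : groupRing G Z) :
  realize (sym_incl G I Z x) = grp_incl a x.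
Proof.
apply: cpP => g; rewrite realize_coef grp_incl_coef [cp_coef (sym_incl _ _ _ _) _]crossed_map_coef.
exact: realize_const.
Qed.

End Realization.

(** * Indicator functions as idempotents of the crossed product *)

Section Indicators.
Variables (R : realType) (G : groupType) (d : measure_display).
Variables (X : measurableType d) (mu : probability X R) (a : pmpAction G mu).
Variables (Z : normedRing R).
Local Notation S := (crossedLinf a Z).

Lemma linf_indicE (A : set X) (mA : measurable A) :
  linf_indic mu Z A = linf_class (Bddfun (ebm_indic mu Z mA)).
Proof. by rewrite /linf_indic; congr linf_class; apply: val_inj; rewrite /= insubdK //; exact: ebm_indic. Qed.

Lemma linf_indicP (A : set X) : measurable A ->
  {ae mu, forall x, linf_repr (linf_indic mu Z A) x = \1_A x}.
Proof.
move=> mA.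
by apply/(@linf_classP _ _ _ _ _ _ (Bddfun (ebm_indic mu Z mA))); rewrite linf_reprK linf_indicE.
Qed.

Definition chi (A : set X) : S := cp_mono (linf_action a Z) (linf_indic mu Z A) 1%g.

Lemma linf_indicI A B : measurable A -> measurable B ->
  linf_indic mu Z (A `&` B) = linf_indic mu Z A * linf_indic mu Z B.
Proof.
move=> mA mB; rewrite (linf_indicE (measurableI _ _ mA mB)) (linf_indicE mA) (linf_indicE mB).
rewrite -linf_classM; apply/linf_classP; apply: aeW => x /=.
by rewrite -[RHS]/(\1_A x * \1_B x) !indicE in_setI; do 2!case: (_ \in _); rewrite ?mulr0 ?mulr1.
Qed.

Lemma linf_indicT : linf_indic mu Z setT = 1.
Proof.
rewrite (linf_indicE measurableT) -linf_class1; apply/linf_classP; apply: aeW => x.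
by rewrite /= indicE in_setT.
Qed.

Lemma linf_indicC A : measurable A ->
  linf_indic mu Z (~` A) = 1 - linf_indic mu Z A.
Proof.
move=> mA; rewrite (linf_indicE (measurableC mA)) (linf_indicE mA) -linf_class1 -linf_classB.
apply/linf_classP; apply: aeW => x.
rewrite -[RHS]/(1 - \1_A x) /= !indicE in_setC.
by case: (_ \in _); rewrite ?subrr ?subr0.
Qed.

Lemma linf_indic0 : linf_indic mu Z set0 = 0.
Proof. by rewrite -setCT linf_indicC // linf_indicT subrr. Qed.

Lemma linf_act_indic g A : measurable A ->
  linf_act a g (linf_indic mu Z A) = linf_indic mu Z (a g^-1%g @^-1` A).
Proof.
move=> mA; rewrite (linf_indicE mA) linf_act_class.
rewrite (linf_indicE (pact_meas_preimage a g^-1%g mA)).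
by apply/linf_classP; apply: aeW.
Qed.

Lemma chi_mul A B : measurable A -> measurable B -> chi A * chi B = chi (A `&` B).
Proof.
by move=> mA mB; rewrite /chi cp_monoM ract1 mulg1 linf_indicI.
Qed.

Lemma chiT : chi setT = 1.
Proof. by rewrite /chi linf_indicT. Qed.

Lemma chi0 : chi set0 = 0.
Proof. by rewrite /chi linf_indic0 cp_mono0. Qed.

Lemma chi_idem A : measurable A -> chi A * chi A = chi A.
Proof. by move=> mA; rewrite chi_mul // setIid. Qed.

Lemma chiC A : measurable A -> chi (~` A) = 1 - chi A.
Proof.
move=> mA; apply: (addIr (chi A)); rewrite subrK -chiT /chi -cp_monoD.
by rewrite linf_indicC // subrK linf_indicT.
Qed.

Lemma chi_mul_coef A (r : S) g :
  cp_coef (chi A * r) g = linf_indic mu Z A * cp_coef r g.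
Proof.
elim/cp_ind: r => [|l h r IH]; first by rewrite mulr0 !cp_coef0 mulr0.
rewrite mulrDr !cp_coefD IH mulrDr; congr (_ + _).
by rewrite /chi cp_monoM ract1 mul1g !cp_monoE; case: ifP; rewrite ?mulr0.
Qed.

(** An indicator on the right has to pass g, so it restricts the coefficient of g to the translate g
    A; on the left it restricts every coefficient to A itself. *)
Lemma mul_chi_coef A (r : S) g : measurable A ->
  cp_coef (r * chi A) g = cp_coef r g * linf_indic mu Z (a g^-1%g @^-1` A).
Proof.
move=> mA; elim/cp_ind: r => [|l h r IH]; first by rewrite mul0r !cp_coef0 mul0r.
rewrite mulrDl !cp_coefD IH mulrDl; congr (_ + _).
rewrite /chi cp_monoM mulg1 !cp_monoE; case: eqP => [->|_]; last by rewrite mul0r.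
by congr (_ * _); exact: linf_act_indic.
Qed.

Lemma chi_scale A (l : linfMod a Z) : chi A *: l = (linf_indic mu Z A * l : Linf mu Z).
Proof.
rewrite -[LHS]/(coef_scale _ _) coef_scale_mono.
by rewrite ract1.
Qed.

Lemma cyc_chi A x : measurable A -> cyc A x <-> x * chi A = x.
Proof.
move=> mA; split=> [[r ->]|<-]; last by exists x.
by rewrite -/(chi A) -mulrA chi_idem.
Qed.

Lemma indic_mul0 A (f : bddfun mu Z) : measurable A -> (forall x, A x -> f x = 0) ->
  linf_indic mu Z A * linf_class f = 0.
Proof.
move=> mA f0; have <- : linf_class (0 : bddfun mu Z) = 0 by apply: (addrI (linf_class 0)); rewrite -linf_classD !addr0.
rewrite (linf_indicE mA) -linf_classM; apply/linf_classP; apply: aeW => x.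
rewrite -[LHS]/(\1_A x * f x) -[RHS]/(0 : Z) indicE.
by case: (boolP (x \in A)) => [/set_mem/f0 ->|_]; rewrite ?mulr0 ?mul0r.
Qed.

(** The coefficient of g in the product is supported on A intersected with g B, which is empty for g
    in K. *)
Lemma chi_sep A B (r : S) (K : {fset G}) : measurable A -> measurable B ->
  (cp_supp r `<=` K)%fset ->
  (forall g x, g \in K -> A x -> ~ B (a g^-1%g x)) ->
  chi A * r * chi B = 0.
Proof.
move=> mA mB /fsubsetP rK AB; apply: cpP => g; rewrite mul_chi_coef // chi_mul_coef cp_coef0.
have [gr|gr] := boolP (g \in cp_supp r); last by rewrite cp_coef_out // mulr0 mul0r.
rewrite mulrAC -linf_indicI //; last exact: pact_meas_preimage.
rewrite (_ : _ `&` _ = set0) ?linf_indic0 ?mul0r //.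
by apply/seteqP; split=> // x [Ax]; apply: AB => //; exact: rK.
Qed.

End Indicators.

(** Under this condition an essentially bounded function has finitely many values off a null set, so
    a finite colouring can record it. *)
Definition finite_balls (R : realType) (Z : normedRing R) :=
  forall r : R, exists V : seq Z, forall z, nr_norm z <= r -> z \in V.

Section LiftColouring.
Variables (R : realType) (G : groupType) (d : measure_display).
Variables (X : measurableType d) (mu : probability X R) (a : pmpAction G mu).
Variables (Z : normedRing R).
Hypothesis ballZ : finite_balls Z.
Local Notation S := (crossedLinf a Z).
Local Notation Linf := (Linf mu Z).

Lemma linf_finite_range (s : seq Linf) : exists V : seq Z, forall l, l \in s ->
  {ae mu, forall x, linf_repr l x \in V}.
Proof.
elim: s => [|l s [V VP]]; first by exists [::].
have /asboolP[_ [r rP]] := bdd_valP (linf_repr l).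
have [W WP] := ballZ r; exists (W ++ V) => l'.
rewrite in_cons => /orP[/eqP ->|/VP VPl].
  by apply: filterS rP => x xr; rewrite mem_cat WP.
by apply: filterS VPl => x xV; rewrite mem_cat xV orbT.
Qed.

(** The colour of x lists the values at x of all given coefficients and the memberships of x in all
    given sets. Coefficients are recovered as classes in [Linf], the sets exactly. *)
Lemma lift_colouring (L : seq S) (LV : seq Linf) (LA : seq (set X)) :
  (forall A, A \in LA -> measurable A) ->
  exists (I : finType) (c : X -> I) (mc : fin_measurable c)
    (u : S -> symRing G I Z) (w : Linf -> locfun G I Z) (b : set X -> pred I),
    [/\ forall s, s \in L -> realize a Z mc (u s) = s,
        forall l, l \in LV -> realize_loc a mc (w l) = l &
        forall A, A \in LA -> A = c @^-1` [set i | b A i] ].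
Proof.
move=> mLA.
pose LL := LV ++ flatten [seq [seq cp_coef s g | g <- cp_supp s] | s <- L].
have [V VP] := linf_finite_range LL.
(* A value outside V, which occurs only on a null set, gets the index [size V]; hence the
   successor. *)
pose I := ({ffun 'I_(size LL) -> 'I_(size V).+1} * {ffun 'I_(size LA) -> bool})%type.
pose c (x : X) : I :=
  ([ffun t : 'I_(size LL) => inord (index (linf_repr (LL`_t) x) V)],
   [ffun t : 'I_(size LA) => `[< nth set0 LA t x >]]).
have mc : fin_measurable c.
  move=> [f1 f2].
  have -> : c @^-1` [set (f1, f2)] = ((fst \o c) @^-1` [set f1]) `&` ((snd \o c) @^-1` [set f2]).
    by apply/seteqP; split=> x; rewrite /c /=; [case=> -> ->|case=> -> ->].
  apply: measurableI; apply: fin_measurable_ffun => t k.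
    have /asboolP[mr _] := bdd_valP (linf_repr LL`_t).
    rewrite (_ : _ @^-1` _ = linf_repr LL`_t @^-1` [set z | inord (index z V) = k]).
      exact: mr.
    by apply/seteqP; split => x; rewrite /= ffunE.
  have mA : measurable (nth set0 LA t) by apply: mLA; rewrite mem_nth.
  rewrite (_ : _ @^-1` _ = if k then nth set0 LA t else ~` nth set0 LA t).
    by case: k => //; exact: measurableC.
  case: k; apply/seteqP; split=> x /=; rewrite ffunE.
  - by move/asboolP.
  - by move=> ?; apply/asboolP.
  - by move/asboolPn.
  - by move=> ?; apply/asboolPn.
pose w (l : Linf) : locfun G I Z := loc_one G (fun i : I =>
  if insub (index l LL) is Some t then V`_(i.1 t) else 0).
have wP l : l \in LL -> realize_loc a mc (w l) = l.
  move=> lL; rewrite -[RHS]linf_reprK; apply: realize_one.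
  have lt : (index l LL < size LL)%N by rewrite index_mem.
  apply: filterS (VP l lL) => x xV; rewrite insubT /= ffunE nth_index //.
  by rewrite inordK ?nth_index // ltnS index_size.
pose u (s : S) : symRing G I Z :=
  \sum_(g <- cp_supp s) cp_mono (loc_action G I Z) (w (cp_coef s g)) g.
pose b (A : set X) (i : I) :=
  if insub (index A LA) is Some t then i.2 t else false.
exists I, c, mc, u, w, b; split.
- move=> s sL; rewrite rmorph_sum /= [RHS]cp_sumE; apply: eq_big_seq => g gs.
  rewrite realize_mono wP // mem_cat; apply/orP; right.
  by apply/flattenP; exists [seq cp_coef s g | g <- cp_supp s]; apply: map_f.
- by move=> l lL; apply: wP; rewrite mem_cat lL.
- move=> A AL; have lt : (index A LA < size LA)%N by rewrite index_mem.
  apply/seteqP; split=> x /=; rewrite /b insubT /= ffunE nth_index //.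
    by move=> Ax; apply/asboolP.
  by move/asboolP.
Qed.

End LiftColouring.

Section RealizationTransfer.
Variables (R : realType) (G : groupType) (d d' : measure_display).
Variables (X : measurableType d) (Y : measurableType d').
Variables (mu : probability X R) (nu : probability Y R).
Variables (a : pmpAction G mu) (b : pmpAction G nu).
Variables (Z : normedRing R) (I : finType) (c : X -> I) (c' : Y -> I).
Hypotheses (mc : fin_measurable c) (mc' : fin_measurable c').
Variables (F : {fset G}) (E : set Y).
Hypothesis mE : measurable E.
Hypothesis cc' : forall P : (G -> I) -> Prop, local_on F P ->
  {ae mu, forall x, P (pattern a c x)} -> forall y, ~ E y -> P (pattern b c' y).

(** Vanishing of a local function is a local property of patterns: true at almost all points of X,
    it holds at all points of Y off E, and the indicator restricts to these. *)
Lemma realize_loc_transfer (f : locfun G I Z) : local_on F f ->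
  realize_loc a mc f = 0 ->
  linf_indic nu Z (~` E) * realize_loc b mc' f = 0.
Proof.
move=> lf f0; apply: indic_mul0; first exact: measurableC.
apply: (cc' (P := fun p => loc_val f p = 0)).
  by move=> p q pq; rewrite (lf p q).
have /linf_classP : realize_loc a mc f = linf_class 0.
  by rewrite f0; apply: (addrI (linf_class 0)); rewrite -linf_classD !addr0.
by apply: filterS => x.
Qed.

Lemma realize_transfer (u : symRing G I Z) : sym_local_on F u ->
  realize a Z mc u = 0 -> chi b Z (~` E) * realize b Z mc' u = 0.
Proof.
move=> lu u0; apply: cpP => g; rewrite chi_mul_coef cp_coef0 realize_coef.
apply: realize_loc_transfer; first exact: lu.
by rewrite -realize_coef u0 cp_coef0.
Qed.

End RealizationTransfer.

Section SymbolIndicator.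
Variables (R : realType) (G : groupType) (d : measure_display).
Variables (X : measurableType d) (mu : probability X R) (a : pmpAction G mu).
Variables (Z : normedRing R) (I : finType) (c : X -> I).
Hypothesis mc : fin_measurable c.

Definition sym_chi (h : pred I) : symRing G I Z :=
  cp_mono (loc_action G I Z) (loc_one G (fun i => (h i)%:R)) 1%g.

Lemma realize_sym_chi (h : pred I) :
  realize a Z mc (sym_chi h) = chi a Z (c @^-1` [set i | h i]).
Proof.
have mh : measurable (c @^-1` [set i | h i]) by exact: fin_measurable_preimage.
rewrite realize_mono /chi (linf_indicE mu Z mh); congr cp_mono; apply: realize_one.
apply: aeW => x /=; rewrite indicE; congr (_%:R); congr nat_of_bool.
by apply/idP/idP; [move/set_mem|move/mem_set].
Qed.

End SymbolIndicator.

(** * Strict complexes *)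

Section FixedRows.
Variables (S : pzRingType) (m : nat) (e : 'M[S]_m).

Definition fixed_row : pred 'rV[S]_m := fun v => v *m e == v.

Fact fixed_row_submod : submod_closed (fixed_row : {pred 'rV[S]_m}).
Proof.
split; first by rewrite unfold_in mul0mx.
move=> s u v /eqP ue /eqP ve; apply/eqP.
by rewrite mulmxDl ve -scalemxAl ue.
Qed.

HB.instance Definition _ := GRing.isSubmodClosed.Build S 'rV[S]_m
  fixed_row fixed_row_submod.

(** For the diagonal idempotent with entries [chi (A i)] this is the marked module with sets [A i],
    so that shrinking marking sets becomes multiplication by a smaller idempotent. *)
Record fixmx := Fixmx { fix_val :> 'rV[S]_m; fix_valP : fix_val \in fixed_row }.

HB.instance Definition _ := [isSub for fix_val].
HB.instance Definition _ := [Choice of fixmx by <:].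
HB.instance Definition _ :=
  GRing.SubChoice_isSubLmodule.Build S 'rV[S]_m fixed_row fixmx
    fixed_row_submod.

Lemma fixmxE (v : fixmx) : v *m e = v.
Proof. exact/eqP/(fix_valP v). Qed.

End FixedRows.

Section FixedRowsMaps.
Variables (S : pzRingType) (m p : nat) (e : 'M[S]_m) (e' : 'M[S]_p).

Section Into.
Variables (V : lmodType S) (f : {linear V -> 'rV[S]_p}).
Hypothesis fe : forall x, f x *m e' = f x.

Fact into_fixmx_subproof x : f x \in fixed_row e'.
Proof. exact/eqP. Qed.
Definition into_fixmx x : fixmx e' := Fixmx (into_fixmx_subproof x).

Fact into_fixmx_is_linear : linear into_fixmx.
Proof. by move=> s u v; apply: val_inj; rewrite /= linearP. Qed.
HB.instance Definition _ :=
  GRing.isLinear.Build S V (fixmx e') *:%R into_fixmx into_fixmx_is_linear.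
End Into.

Definition from_fixmx (v : fixmx e) : 'rV[S]_m := v.
Fact from_fixmx_is_linear : linear from_fixmx.
Proof. by []. Qed.
HB.instance Definition _ :=
  GRing.isLinear.Build S (fixmx e) 'rV[S]_m *:%R from_fixmx from_fixmx_is_linear.

Variable A : 'M[S]_(m, p).
Hypothesis eA : e *m A *m e' = e *m A.

Lemma fixmx_mul_subproof (v : fixmx e) : (rmulmx A \o from_fixmx) v *m e' = (rmulmx A \o from_fixmx) v.
Proof. by rewrite /= /rmulmx /from_fixmx -(fixmxE v) -!mulmxA !(mulmxA e) eA. Qed.

Definition fixmx_mul : {linear fixmx e -> fixmx e'} := into_fixmx fixmx_mul_subproof.

End FixedRowsMaps.

Section MatrixComplex.
Variables (R : realType) (G : groupType) (d : measure_display).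
Variables (X : measurableType d) (mu : probability X R) (a : pmpAction G mu).
Variable Z : normedRing R.
Local Notation S := (crossedLinf a Z).
Variables (N : nat -> nat) (A : forall k, 'I_(N k) -> set X).
Hypothesis mA : forall k i, measurable (@A k i).

Definition chi_mx (q : nat) (B : 'I_q -> set X) : 'M[S]_q :=
  diag_mx (\row_i chi a Z (B i)).

Lemma chi_mxP (q : nat) (B : 'I_q -> set X) (v : 'rV[S]_q) :
  (forall i, measurable (B i)) ->
  v *m chi_mx B = v <-> forall i, cyc (B i) (v 0 i).
Proof.
move=> mB; rewrite /chi_mx mul_mx_diag; split=> [vB i|vB].
  apply/cyc_chi => //; have := congr1 (fun w : 'rV[S]_q => w 0 i) vB.
  by rewrite !mxE.
by apply/rowP => i; rewrite !mxE; exact/cyc_chi.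
Qed.

Local Notation E k := (chi_mx (@A k)).
Variable M : forall k, 'M[S]_(N k.+1, N k).
Variable H : 'I_(N 0) -> linfMod a Z.
Hypothesis EM : forall k, E k.+1 *m M k *m E k = E k.+1 *m M k.
Hypothesis EMM : forall k, E k.+2 *m M k.+1 *m M k = 0.
Hypothesis EMH : forall v, lincomb H (v *m E 1%N *m M 0) = 0.
Variable v1 : 'rV[S]_(N 0).
Hypothesis v1E : v1 *m E 0%N = v1.
Hypothesis Hv1 : lincomb H v1 = (1 : Linf mu Z).

Definition mxc_mod k : lmodType S := fixmx (E k).
Definition mxc_bd k : {linear mxc_mod k.+1 -> mxc_mod k} := fixmx_mul (EM k).
Definition mxc_aug : {linear mxc_mod 0 -> linfMod a Z} :=
  lincomb H \o (@from_fixmx _ _ (E 0)).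

Fact mxc_bdbd k x : mxc_bd k (mxc_bd k.+1 x) = 0.
Proof.
apply: val_inj => /=; rewrite /rmulmx /from_fixmx /= /from_fixmx -(fixmxE x).
by rewrite -mulmxA -mulmxA (mulmxA (chi_mx _)) EMM mulmx0.
Qed.
Fact mxc_augbd x : mxc_aug (mxc_bd 0 x) = 0.
Proof. by rewrite /= /from_fixmx /= /rmulmx /from_fixmx -(fixmxE x) EMH. Qed.
Fact mxc_aug_surj v : exists x, mxc_aug x = v.
Proof.
have fv1 : v1 \in fixed_row (E 0%N) by exact/eqP.
(* [Linf] is generated by 1 over the crossed product, so a preimage of 1 gives surjectivity. *)
exists (cp_mono (linf_action a Z) v 1%g *: (Fixmx fv1 : mxc_mod 0)).
rewrite linearZ /= /from_fixmx /= Hv1.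
have := coef_scale_mono (ac := linf_action a Z) v 1%g 1.
by rewrite ract1 mulr1.
Qed.

Definition mxc_cplx : augComplex (linfMod a Z) :=
  @AugComplex S (linfMod a Z) mxc_mod mxc_bd mxc_aug mxc_bdbd mxc_augbd mxc_aug_surj.

Definition mxc_coord k (v : mxc_mod k) : {ffun 'I_(N k) -> S^o} :=
  [ffun i => (v : fixmx (E k)) 0 i].

Fact mxc_coord_is_linear k : linear (@mxc_coord k).
Proof. by move=> s u v; apply/ffunP => i; rewrite !ffunE !mxE. Qed.
HB.instance Definition _ k :=
  GRing.isLinear.Build S (mxc_mod k) {ffun 'I_(N k) -> S^o} *:%R
    (@mxc_coord k) (@mxc_coord_is_linear k).

Fact mxc_coord_inj k : injective (@mxc_coord k).
Proof.
move=> u v uv; apply/val_inj/rowP => i.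
by have := congr1 (fun w : {ffun _ -> _} => w i) uv; rewrite !ffunE.
Qed.
Fact mxc_coord_image k (w : {ffun 'I_(N k) -> S^o}) :
  (exists z, mxc_coord z = w) <-> (forall i, @cyc _ _ _ _ _ a Z (@A k i) (w i)).
Proof.
split=> [[z <-] i|wA].
  by rewrite ffunE; apply: (chi_mxP z (@mA k)).1 => //; exact: fixmxE.
have fw : (\row_i w i : 'rV[S]_(N k)) \in fixed_row (E k).
  by apply/eqP/chi_mxP => // i; rewrite mxE.
by exists (Fixmx fw); apply/ffunP => i; rewrite ffunE mxE.
Qed.

Definition mxc_mark k : marking (mxc_mod k) :=
  @Marking _ _ _ _ _ _ _ _ 'I_(N k) (@A k) (@mA k) (@mxc_coord k)
    (@mxc_coord_inj k) (@mxc_coord_image k).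

Definition mx_complex : markedComplex a Z :=
  @MarkedComplex _ _ _ _ _ _ _ mxc_cplx mxc_mark.

End MatrixComplex.

Section StrictAlgebra.
Variables (S : pzRingType) (n : nat) (m r : nat -> nat).
Variables (M : forall k, 'M[S]_(m k.+1, m k)) (T : forall k, 'M[S]_(r k, m k)).
Variables (D : forall k, 'M[S]_(r k.+1, r k)).
Variables (inn out : forall k, 'M[S]_(r k)) (cut : forall k, 'M[S]_(m k)).
Hypothesis inn_out : forall k, inn k + out k = 1%:M.
Hypothesis out_idem : forall k, out k *m out k = out k.
Hypothesis cutM : forall k, (k <= n)%N -> cut k.+1 *m M k *m cut k = cut k.+1 *m M k.
Hypothesis innT : forall k, (k <= n.+1)%N -> inn k *m T k *m cut k = inn k *m T k.
Hypothesis inn_D_out : forall k, (k <= n)%N -> inn k.+1 *m D k *m out k = 0.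
Hypothesis cutMM : forall k, (k < n)%N -> cut k.+2 *m M k.+1 *m M k = 0.
Hypothesis innTM : forall k, (k <= n)%N ->
  inn k.+1 *m (T k.+1 *m M k - D k *m T k) = 0.
Hypothesis DD : forall k, (k < n)%N -> D k.+1 *m D k = 0.

(** On the free summand the differential is [D] followed by [block_map]: the inner part of a
    boundary moves into the given complex through [T], the outer part stays. Since inner boundaries
    stay inner by [inn_D_out], the identity [block_mapP] reduces to [T] commuting with the
    differentials on inner rows. *)
Definition block_bd k : 'M[S]_(m k.+1 + r k.+1, m k + r k) :=
  block_mx (M k) 0 (D k *m inn k *m T k) (D k *m out k).
Definition block_map k : 'M[S]_(r k, m k + r k) := row_mx (inn k *m T k) (out k).
Definition block_cut k : 'M[S]_(m k + r k) := block_mx (cut k) 0 0 (out k).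

Lemma out_D_out k : (k <= n)%N -> out k.+1 *m D k *m out k = D k *m out k.
Proof.
move=> kn; have outE : out k.+1 = 1%:M - inn k.+1 by rewrite -(inn_out k.+1) addrC addKr.
by rewrite outE !mulmxBl mul1mx inn_D_out // subr0.
Qed.

Lemma inn_D_inn k : (k <= n)%N -> inn k.+1 *m D k *m inn k = inn k.+1 *m D k.
Proof.
move=> kn; have innE : inn k = 1%:M - out k by rewrite -(inn_out k) addrK.
by rewrite innE mulmxBr mulmx1 inn_D_out // subr0.
Qed.

Lemma innTM' k : (k <= n)%N ->
  inn k.+1 *m T k.+1 *m M k = inn k.+1 *m D k *m inn k *m T k.
Proof.
move=> kn; rewrite inn_D_inn //; apply/eqP; rewrite -subr_eq0 -!mulmxA -mulmxBr.
exact/eqP/innTM.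
Qed.

Lemma innTM_D k : (k <= n)%N ->
  inn k.+1 *m T k.+1 *m M k + out k.+1 *m (D k *m inn k *m T k) = D k *m inn k *m T k.
Proof.
by move=> kn; rewrite innTM' // !mulmxA -!mulmxDl inn_out mul1mx.
Qed.

Lemma block_mapP k : (k <= n)%N ->
  block_map k.+1 *m block_bd k = D k *m block_map k.
Proof.
move=> kn; rewrite /block_map /block_bd mul_row_block mulmx0 add0r mul_mx_row.
by rewrite innTM_D // !mulmxA out_D_out.
Qed.

Lemma block_bd_cut k : (k <= n)%N ->
  block_cut k.+1 *m block_bd k *m block_cut k = block_cut k.+1 *m block_bd k.
Proof.
move=> kn; rewrite /block_cut /block_bd.
rewrite !mulmx_block !(mulmx0, mul0mx, addr0, add0r); congr block_mx.
- exact: cutM.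
- by rewrite -!mulmxA (mulmxA (inn k)) innT // ltnW.
- by rewrite -!mulmxA out_idem.
Qed.

Lemma block_bd_bd k : (k < n)%N ->
  block_cut k.+2 *m block_bd k.+1 *m block_bd k = 0.
Proof.
move=> kn; rewrite /block_cut /block_bd.
rewrite !mulmx_block !(mulmx0, mul0mx, addr0, add0r) -[RHS]block_mx0; congr block_mx.
- exact: cutMM.
(* Lower left block: [innTM_D] contracts the two paths through degree k + 1 to [D inn T], preceded
   by another [D]. *)
- rewrite -!mulmxA -mulmxDr; apply: (etrans _ (mulmx0 _ _)); congr (_ *m _).
  rewrite -mulmxDr (mulmxA (inn _)) [X in _ *m (_ + _ *m X)]mulmxA innTM_D ?(ltnW kn) //.
  by rewrite !mulmxA DD // !mul0mx.
- rewrite -!mulmxA (mulmxA (out k.+1)) out_D_out ?(ltnW kn) //.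
  by rewrite (mulmxA (D _)) DD // mul0mx mulmx0.
Qed.

Lemma block_map_cut k : (k <= n.+1)%N -> block_map k *m block_cut k = block_map k.
Proof.
move=> kn; rewrite /block_map /block_cut mul_row_block !(mulmx0, addr0, add0r).
by rewrite innT // out_idem.
Qed.

Section Augmentation.
Variables (V : lmodType S).
Variables (f : {linear 'rV[S]_(m 0) -> V}) (g : {linear 'rV[S]_(r 0) -> V}).
Hypothesis fM : forall v, f (v *m cut 1 *m M 0) = 0.
Hypothesis fT : forall v, f (v *m inn 0 *m T 0) = g (v *m inn 0).
Hypothesis gD : forall v, g (v *m D 0) = 0.

Lemma block_aug_bd v : f (lsubmx (v *m block_cut 1 *m block_bd 0)) +
  g (rsubmx (v *m block_cut 1 *m block_bd 0)) = 0.
Proof.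
rewrite -(hsubmxK v) /block_cut /block_bd !mul_row_block.
rewrite !(mulmx0, addr0, add0r) row_mxKl row_mxKr linearD fM add0r !mulmxA.
by rewrite fT -linearD -mulmxDr inn_out mulmx1 gD.
Qed.

Lemma block_aug_map v :
  f (lsubmx (v *m block_map 0)) + g (rsubmx (v *m block_map 0)) = g v.
Proof.
rewrite /block_map mul_mx_row row_mxKl row_mxKr mulmxA fT -linearD.
by rewrite -mulmxDr inn_out mulmx1.
Qed.

End Augmentation.

End StrictAlgebra.

Section Strictification.
Variables (R : realType) (G : groupType) (dsp : measure_display).
Variables (X : measurableType dsp) (mu : probability X R) (a : pmpAction G mu).
Variable Z : normedRing R.
Local Notation S := (crossedLinf a Z).
Variables (n : nat) (m r : nat -> nat).
Variables (B : forall k, 'I_(m k) -> set X) (U : nat -> set X).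
Hypothesis mB : forall k i, measurable (@B k i).
Hypothesis mU : forall k, measurable (U k).
Variables (M : forall k, 'M[S]_(m k.+1, m k)) (T : forall k, 'M[S]_(r k, m k)).
Variables (d : forall k, 'M[groupRing G Z]_(r k.+1, r k)).
Variables (eta : 'I_(m 0) -> linfMod a Z) (ep : 'I_(r 0) -> trivmod G Z).

Definition bd_mx k : 'M[S]_(r k.+1, r k) := map_mx (grp_incl a (Z := Z)) (d k).
(** The index is shifted against [cut_mx]: [T k] involves translations, and it is rows supported on
    [U k.+1] that it sends to rows supported on [U k]. *)
Definition in_mx k : 'M[S]_(r k) := (chi a Z (U k.+1))%:M.
Definition out_mx k : 'M[S]_(r k) := (chi a Z (~` U k.+1))%:M.
Definition cut_mx k : 'M[S]_(m k) := chi_mx a Z (fun i => @B k i `&` U k).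
Definition ep_linf (i : 'I_(r 0)) : linfMod a Z := linf_const mu (ep i).

Hypothesis cutM : forall k, (k <= n)%N ->
  cut_mx k.+1 *m M k *m cut_mx k = cut_mx k.+1 *m M k.
Hypothesis inT : forall k, (k <= n.+1)%N -> in_mx k *m T k *m cut_mx k = in_mx k *m T k.
Hypothesis in_bd_out : forall k, (k <= n)%N -> in_mx k.+1 *m bd_mx k *m out_mx k = 0.
Hypothesis cutMM : forall k, (k < n)%N -> cut_mx k.+2 *m M k.+1 *m M k = 0.
Hypothesis inTM : forall k, (k <= n)%N ->
  in_mx k.+1 *m (T k.+1 *m M k - bd_mx k *m T k) = 0.
Hypothesis bdbd : forall k, (k < n)%N -> d k.+1 *m d k = 0.
Hypothesis cutMeta : forall v, lincomb eta (v *m cut_mx 1 *m M 0) = 0.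
Hypothesis inTeta : forall v,
  lincomb eta (v *m in_mx 0 *m T 0) = lincomb ep_linf (v *m in_mx 0).
Hypothesis epbd : forall v, lincomb ep (v *m d 0) = 0.
Hypothesis ep_surj : exists v, lincomb ep v = (1 : Z).

(* Where the transported equations fail, the free summand restricted to the
   complement of U takes over from the given one. *)
Definition strict_set k (i : 'I_(m k + r k)) : set X :=
  if (k <= n.+1)%N then
    match fintype.split i with inl j => @B k j `&` U k | inr _ => ~` U k.+1 end
  else set0.

Definition strict_bd k : 'M[S]_(m k.+1 + r k.+1, m k + r k) :=
  if (k <= n)%N then block_bd M T bd_mx in_mx out_mx k else 0.

Definition strict_aug (i : 'I_(m 0 + r 0)) : linfMod a Z :=
  match fintype.split i with inl j => eta j | inr j => ep_linf j end.

Definition strict_map k : 'M[S]_(r k, m k + r k) := block_map T in_mx out_mx k.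

Fact strict_set_measurable k (i : 'I_(m k + r k)) : measurable (@strict_set k i).
Proof.
rewrite /strict_set; case: ifP => // _; case: fintype.split => [j|_].
  exact: measurableI.
exact: measurableC.
Qed.

Lemma strict_setE k : (k <= n.+1)%N ->
  chi_mx a Z (@strict_set k) = block_cut out_mx cut_mx k.
Proof.
move=> kn; rewrite /block_cut /cut_mx /out_mx -diag_const_mx -diag_mx_row; congr diag_mx.
apply/rowP => i; rewrite !mxE /strict_set kn.
by case: fintype.split => j; rewrite !mxE.
Qed.

Lemma in_out k : in_mx k + out_mx k = 1%:M.
Proof. by rewrite /in_mx /out_mx chiC // -raddfD /= addrC subrK. Qed.

Lemma out_idem k : out_mx k *m out_mx k = out_mx k.
Proof. by rewrite -scalar_mxM chi_idem //; exact: measurableC. Qed.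

Lemma bd_mx_bd k : (k < n)%N -> bd_mx k.+1 *m bd_mx k = 0.
Proof. by move=> kn; rewrite -map_mxM bdbd // map_mx0. Qed.

Lemma strict_mapP k : (k <= n)%N ->
  strict_map k.+1 *m strict_bd k = bd_mx k *m strict_map k.
Proof. by move=> kn; rewrite /strict_bd kn; exact: (block_mapP in_out in_bd_out inTM). Qed.

Fact strict_bd_cut k : chi_mx a Z (@strict_set k.+1) *m strict_bd k *m chi_mx a Z (@strict_set k)
  = chi_mx a Z (@strict_set k.+1) *m strict_bd k.
Proof.
have [kn|kn] := leqP k n; last by rewrite /strict_bd leqNgt kn /= mulmx0 mul0mx.
rewrite !strict_setE // 1?ltnW // /strict_bd kn.
exact: (block_bd_cut bd_mx out_idem cutM inT).
Qed.

Fact strict_bd_bd k :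
  chi_mx a Z (@strict_set k.+2) *m strict_bd k.+1 *m strict_bd k = 0.
Proof.
have [kn|kn] := ltnP k n; last by rewrite /strict_bd (ltnNge k) kn /= mulmx0 mul0mx.
rewrite strict_setE // /strict_bd kn (ltnW kn).
exact: (block_bd_bd in_out in_bd_out cutMM inTM bd_mx_bd).
Qed.

Lemma strict_augE (v : 'rV[S]_(m 0 + r 0)) :
  lincomb strict_aug v = lincomb eta (lsubmx v) + lincomb ep_linf (rsubmx v).
Proof.
rewrite /lincomb big_split_ord /=; congr (_ + _); apply: eq_bigr => i _.
  by rewrite mxE /strict_aug (unsplitK (inl i)).
by rewrite mxE /strict_aug (unsplitK (inr i)).
Qed.

Lemma ep_linf_incl (v : 'rV[groupRing G Z]_(r 0)) :
  lincomb ep_linf (map_mx (grp_incl a (Z := Z)) v) = linf_const mu (lincomb ep v).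
Proof.
rewrite /lincomb [RHS](rmorph_sum (linf_const mu (Z := Z))); apply: eq_bigr => i _.
rewrite mxE; elim/cp_ind: (v 0 i) => [|l g x IH]; first by rewrite rmorph0 !scale0r rmorph0.
rewrite rmorphD !scalerDl IH [RHS]rmorphD; congr (_ + _).
transitivity ((cp_mono (linf_action a Z) (linf_const mu l) g : S) *: ep_linf i).
  by congr (_ *: _); exact: grp_incl_mono.
transitivity (linf_const mu l * linf_act a g (linf_const mu (ep i))).
  exact: (coef_scale_mono (ac := linf_action a Z)).
rewrite linf_act_const -rmorphM; congr (linf_const mu _); apply/esym.
exact: (coef_scale_mono (ac := triv_action G Z)).
Qed.

Lemma ep_linf_bd (v : 'rV[S]_(r 1)) : lincomb ep_linf (v *m bd_mx 0) = 0.
Proof.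
rewrite lincomb_mulmx /lincomb big1 // => i _.
have -> : row i (bd_mx 0) = map_mx (grp_incl a (Z := Z)) (delta_mx 0 i *m d 0).
  by rewrite -rowE; apply/rowP => j; rewrite !mxE.
by rewrite -/(lincomb ep_linf _) ep_linf_incl epbd rmorph0 scaler0.
Qed.

Fact strict_aug_bd v :
  lincomb strict_aug (v *m chi_mx a Z (@strict_set 1) *m strict_bd 0) = 0.
Proof.
rewrite strict_setE // strict_augE.
exact: (block_aug_bd in_out cutMeta inTeta ep_linf_bd).
Qed.

Lemma strict_aug_map (v : 'rV[S]_(r 0)) :
  lincomb strict_aug (v *m strict_map 0) = lincomb ep_linf v.
Proof.
by rewrite strict_augE; exact: (block_aug_map in_out inTeta).
Qed.

Lemma strict_map_fixed k : (k <= n.+1)%N ->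
  strict_map k *m chi_mx a Z (@strict_set k) = strict_map k.
Proof.
by move=> kn; rewrite strict_setE //; exact: (block_map_cut out_idem inT).
Qed.

Lemma strict_aug_unit : exists v : 'rV[S]_(m 0 + r 0),
  v *m chi_mx a Z (@strict_set 0) = v /\ lincomb strict_aug v = (1 : Linf mu Z).
Proof.
have [v vE] := ep_surj.
exists (map_mx (grp_incl a (Z := Z)) v *m strict_map 0).
rewrite -mulmxA strict_map_fixed //; split=> //.
by rewrite strict_aug_map ep_linf_incl vE rmorph1.
Qed.

Definition strict_complex : markedComplex a Z :=
  let v := cid strict_aug_unit in
  mx_complex strict_set_measurable strict_bd_cut strict_bd_bd strict_aug_bd
    (svalP v).1 (svalP v).2.

Lemma strict_embeds (C : augComplex (trivmod G Z))
    (phi : forall k, {linear C k -> 'rV[groupRing G Z]_(r k)}) :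
  (forall x, lincomb ep (phi 0%N x) = ch_aug C x) ->
  (forall k, (k <= n)%N -> forall x, phi k (ch_bd C k x) = phi k.+1 x *m d k) ->
  embeds C n strict_complex.
Proof.
move=> phi0 phiS.
pose f k (x : C k) : 'rV[S]_(m k + r k) := if (k <= n.+1)%N then
  map_mx (grp_incl a (Z := Z)) (phi k x) *m strict_map k else 0.
have fT k x : (k <= n.+1)%N ->
  f k x = map_mx (grp_incl a (Z := Z)) (phi k x) *m strict_map k by rewrite /f => ->.
have fF k x : ~~ (k <= n.+1)%N -> f k x = 0 by rewrite /f => /negPf ->.
have fE k x : f k x \in fixed_row (chi_mx a Z (@strict_set k)).
  apply/eqP; have [kn|kn] := boolP (k <= n.+1)%N; last by rewrite fF // mul0mx.
  by rewrite fT // -mulmxA strict_map_fixed.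
pose F k (x : C k) : strict_complex k := Fixmx (fE k x).
have FL k : linear_for (grp_incl a (Z := Z) \; *:%R) (F k).
  move=> s x y; apply: val_inj.
  rewrite -[LHS]/(f k (s *: x + y)) -[RHS]/(grp_incl a s *: f k x + f k y).
  have [kn|kn] := boolP (k <= n.+1)%N; last by rewrite !fF // scaler0 addr0.
  rewrite !fT // (linearP (phi k)) map_mxD mulmxDl; congr (_ + _).
  rewrite scalemxAl; congr (_ *m _); apply/rowP => i.
  rewrite ![in LHS]mxE ![in RHS]mxE.
  exact: (rmorphM (grp_incl a (Z := Z))).
pose FF k : {linear C k -> strict_complex k | grp_incl a (Z := Z) \; *:%R} :=
  HB.pack (F k) (GRing.isLinear.Build _ _ _ _ (F k) (FL k)).
exists FF; split=> [x|k kn x].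
  rewrite /= /from_fixmx /= /f /= strict_aug_map ep_linf_incl.
  by rewrite phi0.
apply: val_inj.
rewrite -[LHS]/(f k (ch_bd C k x)) -[RHS]/(f k.+1 x *m strict_bd k).
rewrite !fT // ?(leqW kn) //.
by rewrite -mulmxA strict_mapP // mulmxA -map_mxM phiS.
Qed.

End Strictification.

(** * Norms *)

Section EssentiallyBounded.
Variables (R : realType) (d : measure_display) (X : measurableType d).
Variable mu : probability X R.

Definition ess_bounded (f : X -> R) :=
  measurable_fun setT f /\ exists c : R, {ae mu, forall x, `|f x| <= c}.

Lemma ess_bounded_integrable f : ess_bounded f -> mu.-integrable setT (EFin \o f).
Proof.
move=> [mf [c fc]]; apply/integrableP; split; first exact/measurable_EFinP.
apply: (@le_lt_trans _ _ (\int[mu]_x (Num.max c 0)%:E)%E).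
  apply: ae_ge0_le_integral => //.
  - by do 2!apply: measurableT_comp => //.
  - by move=> x _; rewrite lee_fin le_max lexx orbT.
  - apply: filterS fc => x fxc _ /=; rewrite lee_fin le_max fxc //.
rewrite integral_cst //= probability_setT mule1; exact: ltry.
Qed.

Lemma ess_boundedD f g : ess_bounded f -> ess_bounded g ->
  ess_bounded (fun x => f x + g x).
Proof.
move=> [mf [c fc]] [mg [c' gc']]; split; first exact: measurable_funD.
exists (c + c'); apply: filterS2 fc gc' => x h h'.
by rewrite (le_trans (ler_normD _ _)) // lerD.
Qed.

Lemma ess_boundedZ k f : ess_bounded f -> ess_bounded (fun x => k * f x).
Proof.
move=> [mf [c fc]]; split; first exact: measurable_funM.
exists (`|k| * c); apply: filterS fc => x h.
by rewrite normrM ler_wpM2l.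
Qed.

Lemma ess_bounded_cst k : ess_bounded (cst k).
Proof. by split=> //; exists `|k|; apply: aeW. Qed.

Lemma ess_bounded_sum (T : Type) (s : seq T) (f : T -> X -> R) :
  (forall t, ess_bounded (f t)) -> ess_bounded (fun x => \sum_(t <- s) f t x).
Proof.
move=> bf; elim: s => [|t s IH].
  rewrite (_ : (fun x => _) = cst 0); first exact: ess_bounded_cst.
  by apply/funext => x; rewrite big_nil.
rewrite (_ : (fun x => _) = (fun x => f t x + \sum_(t <- s) f t x)).
  exact: ess_boundedD.
by apply/funext => x; rewrite big_cons.
Qed.

Lemma Rintegral_sum (T : Type) (s : seq T) (f : T -> X -> R) :
  (forall t, ess_bounded (f t)) ->
  \int[mu]_x (\sum_(t <- s) f t x) = \sum_(t <- s) \int[mu]_x f t x.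
Proof.
move=> bf; elim: s => [|t s IH].
  rewrite big_nil -[RHS](mul0r (fine (mu setT))) -Rintegral_cst //.
  by congr Rintegral; apply/funext => x; rewrite big_nil.
rewrite big_cons -IH -RintegralD //; try exact: ess_bounded_integrable.
  by congr Rintegral; apply/funext => x; rewrite big_cons.
exact/ess_bounded_integrable/ess_bounded_sum.
Qed.

Lemma ae_le_Rintegral f g : ess_bounded f -> ess_bounded g ->
  (forall x, 0 <= f x) -> (forall x, 0 <= g x) ->
  {ae mu, forall x, f x <= g x} -> \int[mu]_x f x <= \int[mu]_x g x.
Proof.
move=> bf bg f0 g0 fg; have [mf _] := bf; have [mg _] := bg.
apply: fine_le.
- exact/integrable_fin_num/ess_bounded_integrable.
- exact/integrable_fin_num/ess_bounded_integrable.
apply: ae_ge0_le_integral => //.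
- by move=> x _; rewrite lee_fin.
- exact/measurable_EFinP.
- by move=> x _; rewrite lee_fin.
- exact/measurable_EFinP.
- by apply: filterS fg => x h _; rewrite lee_fin.
Qed.

Lemma Rintegral_indic (A : set X) : measurable A -> \int[mu]_x \1_A x = fine (mu A).
Proof. by move=> mA; rewrite /Rintegral integral_indic // setIT. Qed.

Lemma ess_bounded_indic (A : set X) : measurable A -> ess_bounded (\1_A : X -> R).
Proof.
move=> mA; split; first exact: measurable_indic.
by exists 1; apply: aeW => x; rewrite indicE; case: (_ \in _); rewrite ?normr1 ?normr0.
Qed.

(** Where h exceeds c on A it exceeds c + 1/(k + 1) for some k, and the integral inequality on that
    set [W k] forces measure 0. *)
Lemma ae_le_of_integral (h : X -> R) (A : set X) (c : R) : ess_bounded h ->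
  measurable A -> (forall x, 0 <= h x) -> 0 <= c ->
  (forall W, measurable W -> W `<=` A -> \int[mu]_x (\1_W x * h x) <= c * fine (mu W)) ->
  {ae mu, forall x, A x -> h x <= c}.
Proof.
move=> bh mA h0 c0 hW; have [mh [C hC]] := bh.
pose W k := A `&` [set x | c + k.+1%:R^-1 <= h x].
have mW k : measurable (W k).
  apply: measurableI => //.
  have -> : [set x | c + k.+1%:R^-1 <= h x] = setT `&` h @^-1` `[c + k.+1%:R^-1, +oo[.
    by rewrite setTI; apply/seteqP; split => x /=; rewrite in_itv /= andbT.
  by apply: mh => //; exact: measurable_itv.
have W0 k : mu.-negligible (W k).
  apply/negligibleP; first exact: mW.
  have bW := ess_bounded_indic (mW k).
  have bWh : ess_bounded (fun x => \1_(W k) x * h x).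
    split; first by apply: measurable_funM => //; exact: measurable_indic.
    exists C; apply: filterS hC => x hx; rewrite normrM indicE.
    by case: (_ \in _); rewrite ?normr1 ?mul1r // normr0 mul0r (le_trans _ hx).
  have : (c + k.+1%:R^-1) * fine (mu (W k)) <= c * fine (mu (W k)).
    apply: le_trans (hW _ (mW k) _); last by move=> x [].
    rewrite -Rintegral_indic // -RintegralZl //; last exact: ess_bounded_integrable.
    apply: ae_le_Rintegral => //; first exact: ess_boundedZ.
    - by move=> x; rewrite mulr_ge0 ?addr_ge0 // indicE ler0n.
    - by move=> x; rewrite mulr_ge0 // indicE ler0n.
    apply: aeW => x; rewrite mulrC indicE.
    by case: (boolP (x \in W k)) => [/set_mem[_ /= ck]|_]; rewrite ?mul0r ?mul1r.
  rewrite mulrDl gerDl => Wle.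
  have := pr_ge0 mu (W k); rewrite le_eqVlt => /orP[/eqP W0|W0]; last first.
    by move: Wle; rewrite leNgt mulr_gt0.
  by rewrite -[LHS]fineK ?fin_num_measure // -W0.
have [N [mN N0 WN]] := negligible_bigcup W0.
exists N; split => // x /= /not_implyP[Ax /negP]; rewrite -ltNge => cx.
apply: WN; have [k kP] := ltr_add_invr cx.
by exists k => //; split => //=; exact: ltW.
Qed.

End EssentiallyBounded.

Lemma ae_seq (R : realType) (d : measure_display) (X : measurableType d)
    (mu : probability X R) (T : eqType) (s : seq T) (P : T -> X -> Prop) :
  (forall t, {ae mu, forall x, P t x}) ->
  {ae mu, forall x, forall t, t \in s -> P t x}.
Proof.
move=> aeP; elim: s => [|t s IH]; first exact: aeW.
by apply: filterS2 (aeP t) IH => x Pt Ps u; rewrite in_cons => /orP[/eqP ->|/Ps].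
Qed.

Section LinfNorm.
Variables (R : realType) (d : measure_display) (X : measurableType d).
Variables (mu : probability X R) (Z : normedRing R).
Local Notation Linf := (Linf mu Z).

Definition linf_abs (l : Linf) (x : X) : R := nr_norm (linf_repr l x).

Lemma linf_abs_ge0 l x : 0 <= linf_abs l x.
Proof. exact: nr_norm_ge0. Qed.

Lemma ess_bounded_abs l : ess_bounded mu (linf_abs l).
Proof.
have /asboolP[mf [c fc]] := bdd_valP (linf_repr l); split.
  by move=> _ B mB; rewrite setTI; exact: (mf (@nr_norm R Z @^-1` B)).
by exists c; apply: filterS fc => x h; rewrite ger0_norm ?linf_abs_ge0.
Qed.

Lemma nr_norm0 : nr_norm (0 : Z) = 0.
Proof. by apply/nr_norm_eq0. Qed.

Lemma linf_repr_ae (l : Linf) (f : bddfun mu Z) : l = linf_class f ->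
  {ae mu, forall x, linf_repr l x = f x}.
Proof. by move=> lf; apply/linf_classP; rewrite linf_reprK. Qed.

Lemma linf_reprD (l m : Linf) :
  {ae mu, forall x, linf_repr (l + m) x = linf_repr l x + linf_repr m x}.
Proof.
by apply: (linf_repr_ae (f := linf_repr l + linf_repr m)); rewrite linf_classD !linf_reprK.
Qed.

Lemma linf_reprM (l m : Linf) :
  {ae mu, forall x, linf_repr (l * m) x = linf_repr l x * linf_repr m x}.
Proof.
by apply: (linf_repr_ae (f := linf_repr l * linf_repr m)); rewrite linf_classM !linf_reprK.
Qed.

Lemma linf_reprM_eq (k l m : Linf) : k = l * m ->
  {ae mu, forall x, linf_repr k x = linf_repr l x * linf_repr m x}.
Proof. by move=> ->; exact: linf_reprM. Qed.

Lemma linf_repr0 : {ae mu, forall x, linf_repr (0 : Linf) x = 0}.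
Proof.
apply: (linf_repr_ae (f := 0)).
by apply: (addrI (linf_class 0)); rewrite -linf_classD !addr0.
Qed.

Lemma linf_norm1_ge0 (l : Linf) : 0 <= linf_norm1 l.
Proof. by apply: Rintegral_ge0 => x _; exact: nr_norm_ge0. Qed.

Lemma linf_norm1_sum_le (T1 T2 : Type) (s1 : seq T1) (s2 : seq T2)
    (l : T1 -> Linf) (m : T2 -> Linf) (c : T2 -> R) :
  (forall t, 0 <= c t) ->
  {ae mu, forall x, \sum_(t <- s1) linf_abs (l t) x <=
                    \sum_(t <- s2) c t * linf_abs (m t) x} ->
  \sum_(t <- s1) linf_norm1 (l t) <= \sum_(t <- s2) c t * linf_norm1 (m t).
Proof.
move=> c0 lm.
have bl t := ess_bounded_abs (l t).
have bm t := ess_boundedZ (c t) (ess_bounded_abs (m t)).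
rewrite -(Rintegral_sum s1 bl).
rewrite (eq_bigr (fun t => \int[mu]_x (c t * linf_abs (m t) x))); last first.
  by move=> t _; rewrite RintegralZl //; exact/ess_bounded_integrable/ess_bounded_abs.
rewrite -(Rintegral_sum s2 bm); apply: ae_le_Rintegral => //.
- exact: ess_bounded_sum.
- exact: ess_bounded_sum.
- by move=> x; apply: sumr_ge0 => t _; exact: linf_abs_ge0.
- by move=> x; apply: sumr_ge0 => t _; rewrite mulr_ge0 ?linf_abs_ge0.
Qed.

Lemma linf_norm1D_le (l m : Linf) : linf_norm1 (l + m) <= linf_norm1 l + linf_norm1 m.
Proof.
have := @linf_norm1_sum_le unit bool [:: tt] [:: true; false] (fun=> l + m)
  (fun t => if t then l else m) (fun=> 1) (fun=> ler01).
rewrite !big_cons !big_nil !addr0 !mul1r; apply.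
apply: filterS (linf_reprD l m) => x lmx.
by rewrite !big_cons !big_nil !addr0 !mul1r /linf_abs lmx nr_normD.
Qed.

Lemma linf_norm1_0 : linf_norm1 (0 : Linf) = 0.
Proof.
apply/eqP; rewrite eq_le linf_norm1_ge0 andbT.
have := @linf_norm1_sum_le unit unit [:: tt] [::] (fun=> 0) (fun=> 0) (fun=> 1) (fun=> ler01).
rewrite !big_cons !big_nil !addr0; apply.
by apply: filterS linf_repr0 => x x0; rewrite !big_cons !big_nil addr0 /linf_abs x0 nr_norm0.
Qed.

End LinfNorm.

Section CrossedNorm.
Variables (R : realType) (G : groupType) (d : measure_display).
Variables (X : measurableType d) (mu : probability X R) (a : pmpAction G mu).
Variable Z : normedRing R.
Local Notation S := (crossedLinf a Z).
Local Notation act := (linf_action a Z).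

Lemma linf_repr_act g (l : Linf mu Z) :
  {ae mu, forall x, linf_repr (linf_act a g l) x = linf_repr l (a g^-1%g x)}.
Proof.
have := @linf_repr_ae _ _ _ _ _ (linf_act a g l) (Defs.shift a g (linf_repr l)) erefl.
by apply: filterS => x.
Qed.

Lemma cp_norm1_sup (K : {fset G}) (x : S) : (cp_supp x `<=` K)%fset ->
  cp_norm1 x = \sum_(g <- K) linf_norm1 (cp_coef x g).
Proof.
move=> xK; apply: big_fset_incl => // g _ gx.
by rewrite cp_coef_out // linf_norm1_0.
Qed.

Lemma cp_norm1_ge0 (x : S) : 0 <= cp_norm1 x.
Proof. by apply: sumr_ge0 => g _; exact: linf_norm1_ge0. Qed.

Lemma cp_norm1_0 : cp_norm1 (0 : S) = 0.
Proof. by rewrite /cp_norm1 big1 // => g _; rewrite cp_coef0 linf_norm1_0. Qed.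

Lemma cp_norm1D_le (x y : S) : cp_norm1 (x + y) <= cp_norm1 x + cp_norm1 y.
Proof.
pose K := (cp_supp x `|` cp_supp y `|` cp_supp (x + y)%R)%fset.
rewrite (@cp_norm1_sup K (x + y)) ?(@cp_norm1_sup K x) ?(@cp_norm1_sup K y).
- rewrite -big_split; apply: ler_sum => g _.
  by rewrite cp_coefD linf_norm1D_le.
- by apply/fsubsetP => g; rewrite !in_fsetU => ->; rewrite orbT.
- by apply/fsubsetP => g; rewrite !in_fsetU => ->.
- by apply/fsubsetP => g; rewrite !in_fsetU => ->; rewrite orbT.
Qed.

Lemma cp_norm1_sum_le (T : Type) (s : seq T) (f : T -> S) :
  cp_norm1 (\sum_(t <- s) f t) <= \sum_(t <- s) cp_norm1 (f t).
Proof.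
elim: s => [|t s IH]; first by rewrite !big_nil cp_norm1_0.
by rewrite !big_cons (le_trans (cp_norm1D_le _ _)) // lerD2l.
Qed.

Lemma mono_mul_coef l g (r : S) h :
  cp_coef (cp_mono act l g * r) h = l * linf_act a g (cp_coef r (g^-1 * h)%g).
Proof.
elim/cp_ind: r => [|m k r IH]; first by rewrite mulr0 !cp_coef0 [linf_act _ _ _](rmorph0 (linf_act a (Z := Z) g)) mulr0.
rewrite mulrDr !cp_coefD IH [in RHS](rmorphD (linf_act a (Z := Z) g)) mulrDr; congr (_ + _).
rewrite cp_monoM !cp_monoE.
have -> : (g^-1 * h == k)%g = (h == g * k)%g.
  by apply/eqP/eqP => [<-|->]; rewrite ?mulVKg ?mulKg.
by case: eqP => // _; rewrite (rmorph0 (linf_act a (Z := Z) g)) mulr0.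
Qed.

Lemma cp_norm1_mono_mul l g (r : S) (K : {fset G}) : (cp_supp r `<=` K)%fset ->
  cp_norm1 (cp_mono act l g * r) =
  \sum_(h <- K) linf_norm1 (l * linf_act a g (cp_coef r h)).
Proof.
move=> rK; rewrite (@cp_norm1_sup [fset (g * h)%g | h in K]%fset).
  rewrite big_imfset /=; last by move=> h k _ _ /mulgI.
  by apply: eq_bigr => h _; rewrite mono_mul_coef mulKg.
apply/fsubsetP => h hr; apply/imfsetP; exists (g^-1 * h)%g; last by rewrite mulVKg.
apply: (fsubsetP rK); apply: contraTT hr => hr.
rewrite memNfinsupp -/(cp_coef _ _) mono_mul_coef cp_coef_out //.
by rewrite [linf_act _ _ _](rmorph0 (linf_act a (Z := Z) g)) mulr0.
Qed.

Section MatrixBound.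
Variables (m q : nat) (N : 'M[S]_(m, q)) (A : 'I_m -> set X) (K : {fset G}).
Variable c : R.
Hypothesis mA : forall i, measurable (A i).
Hypothesis NK : forall i j, (cp_supp (N i j) `<=` K)%fset.
Hypothesis c0 : 0 <= c.
Hypothesis Nc : forall i, {ae mu, forall x, A i x ->
  \sum_j \sum_(g <- K) linf_abs (cp_coef (N i j) g) x <= c}.

(** At x the sum is at most |l(x)| times the row sum of N at g^-1 x. The hypothesis makes l vanish
    unless g^-1 x lies in [A i], where the row sum is at most c. *)
Let mono_bound i l g : l * linf_act a g (linf_indic mu Z (A i)) = l ->
  \sum_j cp_norm1 (cp_mono act l g * N i j) <= c * linf_norm1 l.
Proof.
move=> lA.
pose F (t : 'I_q * G) := l * linf_act a g (cp_coef (N i t.1) t.2).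
pose s : seq ('I_q * G) := [seq (j, h) | j <- index_enum 'I_q, h <- K].
rewrite (eq_bigr (fun j => \sum_(h <- K) linf_norm1 (F (j, h)))); last first.
  by move=> j _; exact: cp_norm1_mono_mul.
rewrite -(big_allpairs (F := fun t => linf_norm1 (F t))) -/s.
have := @linf_norm1_sum_le _ _ _ mu Z _ unit s [:: tt] F (fun=> l) (fun=> c) (fun=> c0).
rewrite !big_cons !big_nil !addr0; apply.
have aF := ae_seq s (fun t => linf_reprM l (linf_act a g (cp_coef (N i t.1) t.2))).
have aact := ae_seq s (fun t => linf_repr_act g (cp_coef (N i t.1) t.2)).
have aN := pact_ae a g^-1%g (Nc i).
have al : {ae mu, forall x, ~ A i (a g^-1%g x) -> linf_repr l x = 0}.
  have h1 := linf_reprM_eq (esym lA).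
  have h2 := pact_ae a g^-1%g (linf_indicP mu Z (mA i)).
  apply: filterS (filterI h1 (filterI (linf_repr_act g (linf_indic mu Z (A i))) h2)).
  move=> x /= [-> [-> ->]] nA; rewrite indicE.
  by case: (boolP (_ \in _)) => [/set_mem//|_]; rewrite mulr0.
apply: filterS (filterI (filterI aF aact) (filterI aN al)) => x /= [[Fx actx] [Nx lx]].
rewrite !big_cons !big_nil addr0 /linf_abs.
have [Ax|/lx l0] := pselect (A i (a g^-1%g x)); last first.
  rewrite l0 nr_norm0 mulr0 big_seq big1 // => t ts.
  by rewrite Fx // l0 mul0r nr_norm0.
apply: (@le_trans _ _ (\sum_(t <- s) nr_norm (linf_repr l x) *
    linf_abs (cp_coef (N i t.1) t.2) (a g^-1%g x))).
  rewrite big_seq [leRHS]big_seq; apply: ler_sum => t ts.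
  by rewrite Fx // actx // (le_trans (nr_normM _ _)).
rewrite -mulr_sumr mulrC ler_wpM2r ?nr_norm_ge0 //.
apply: le_trans (Nx Ax); rewrite /s big_allpairs.
exact: lexx.
Qed.

Lemma mx_norm_bound (z : 'rV[S]_m) :
  (forall i, z 0 i * chi a Z (A i) = z 0 i) ->
  \sum_j cp_norm1 ((z *m N) 0 j) <= c * \sum_i cp_norm1 (z 0 i).
Proof.
move=> zA.
have zE i j : z 0 i * N i j = \sum_(g <- cp_supp (z 0 i)) cp_mono act (cp_coef (z 0 i) g) g * N i j.
  by rewrite {1}(cp_sumE (z 0 i)) mulr_suml.
apply: (@le_trans _ _ (\sum_j \sum_i \sum_(g <- cp_supp (z 0 i))
    cp_norm1 (cp_mono act (cp_coef (z 0 i) g) g * N i j))).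
  apply: ler_sum => j _; rewrite mxE.
  apply: le_trans (cp_norm1_sum_le _ _) _; apply: ler_sum => i _.
  by rewrite zE; exact: cp_norm1_sum_le.
rewrite exchange_big /= mulr_sumr; apply: ler_sum => i _.
rewrite exchange_big /= mulr_sumr; apply: ler_sum => g _.
apply: mono_bound.
by rewrite linf_act_indic // -mul_chi_coef // zA.
Qed.

End MatrixBound.

End CrossedNorm.

(** * Operator norms as essential suprema of row sums *)

Section Generators.
Variables (R : realType) (G : groupType) (d : measure_display).
Variables (X : measurableType d) (mu : probability X R) (a : pmpAction G mu).
Variable Z : normedRing R.
Local Notation S := (crossedLinf a Z).

Section OneModule.
Variables (M : lmodType S) (mM : marking M).
Local Notation A := (@mk_set _ _ _ _ _ _ _ _ mM).

Lemma mk_gen_ex i : exists z, mk_coord mM z =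
  [ffun j => (if j == i then chi a Z (A i) else 0) : S^o].
Proof.
apply: (mk_coord_image (m := mM) _).2 => j; rewrite ffunE; case: eqP => [->|_].
  by exists 1; rewrite mul1r.
by exists 0; rewrite mul0r.
Qed.
Definition mk_gen i : M := sval (cid (mk_gen_ex i)).

Lemma mk_genE i j : mk_coord mM (mk_gen i) j = if j == i then chi a Z (A i) else 0.
Proof. by rewrite (svalP (cid (mk_gen_ex i))) ffunE. Qed.

Lemma mk_coord_chi z i : mk_coord mM z i * chi a Z (A i) = mk_coord mM z i.
Proof.
have h := (mk_coord_image (m := mM) _).1 (ex_intro _ z erefl).
by apply/cyc_chi; [exact: mk_measurable|exact: h].
Qed.

Lemma mk_decomp z : z = \sum_i mk_coord mM z i *: mk_gen i.
Proof.
apply: (@mk_coord_inj _ _ _ _ _ _ _ _ mM).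
rewrite linear_sum; apply/ffunP => j; rewrite sum_ffunE (bigD1 j) //= big1 ?addr0.
  rewrite linearZ ffunE mk_genE eqxx; exact/esym/mk_coord_chi.
move=> i ij; rewrite linearZ ffunE mk_genE eq_sym (negPf ij).
exact: mulr0.
Qed.

Lemma linear_mk_decomp (N : lmodType S) (f : {linear M -> N}) z :
  f z = \sum_i mk_coord mM z i *: f (mk_gen i).
Proof. by rewrite {1}(mk_decomp z) linear_sum; apply: eq_bigr => i _; rewrite linearZ. Qed.

End OneModule.

Section TwoModules.
Variables (M N : lmodType S) (mM : marking M) (mN : marking N).
Variable f : {linear M -> N}.

Lemma mk_coord_linear z j :
  mk_coord mN (f z) j = \sum_i mk_coord mM z i * mk_coord mN (f (mk_gen i)) j.
Proof.
rewrite (linear_mk_decomp mM f) linear_sum sum_ffunE; apply: eq_bigr => i _.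
by rewrite linearZ ffunE.
Qed.

Definition mk_bounded (A : mk_idx mM -> set X) (c : R) :=
  0 <= c /\ forall z, summand A z -> mnorm mN (f z) <= c * mnorm mM z.

Lemma mnorm_ge0 (m : marking M) z : 0 <= mnorm m z.
Proof. by apply: sumr_ge0 => i _; exact: cp_norm1_ge0. Qed.

Lemma opnorm_le A c : mk_bounded A c -> opnorm mN f A <= c.
Proof. by move=> bc; apply: ge_inf => //; exists 0 => x []. Qed.

Lemma opnorm_ge0 (A : mk_idx mM -> set X) : 0 <= opnorm mN f A.
Proof.
have [[c bc]|nb] := pselect (exists c, mk_bounded A c).
  by apply: lb_le_inf => [|x []//]; exists c.
rewrite /opnorm (_ : [set c | _] = set0) ?inf0 //.
by apply/seteqP; split=> // c bc; apply: nb; exists c.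
Qed.

(** The infimum is attained because the inequality for a fixed z is closed in the constant; the 1
    added to the norm of z covers the case of norm 0. *)
Lemma opnorm_bounded A c : mk_bounded A c -> mk_bounded A (opnorm mN f A).
Proof.
move=> bc; split; first exact: opnorm_ge0.
move=> z Az; apply/ler_addgt0Pr => e e0.
have z0 : 0 <= mnorm mM z := mnorm_ge0 mM z.
have e'0 : 0 < e / (mnorm mM z + 1) by rewrite divr_gt0 // ltr_wpDl.
have [|c' [c'0 bc'] c'lt] := inf_adherent (E := [set c | mk_bounded A c]) e'0.
  by split; [exists c|exists 0 => x []].
apply: le_trans (bc' z Az) _.
apply: (@le_trans _ _ ((opnorm mN f A + e / (mnorm mM z + 1)) * mnorm mM z)).
  by rewrite ler_wpM2r // ltW.
rewrite mulrDl lerD2l mulrAC ler_pdivrMr ?ltr_wpDl // ler_wpM2l //; first exact: ltW.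
by rewrite lerDl.
Qed.

End TwoModules.

End Generators.

Lemma sum_enum_val (V : nmodType) (T : finType) (F : T -> V) :
  \sum_i F i = \sum_(i < #|T|) F (enum_val i).
Proof. by rewrite -(big_enum_val F); apply: eq_bigl. Qed.

Section OperatorNorm.
Variables (R : realType) (G : groupType) (d : measure_display).
Variables (X : measurableType d) (mu : probability X R) (a : pmpAction G mu).
Variable Z : normedRing R.
Hypothesis nr1 : nr_norm (1 : Z) = 1.
Local Notation S := (crossedLinf a Z).
Variables (M N : lmodType S) (mM : marking M) (mN : marking N).
Variable f : {linear M -> N}.

Lemma linf_abs_indicM (W : set X) (l : Linf mu Z) : measurable W ->
  {ae mu, forall x, linf_abs (linf_indic mu Z W * l) x = \1_W x * linf_abs l x}.
Proof.
move=> mW; apply: filterS (filterI (linf_reprM (linf_indic mu Z W) l) (linf_indicP mu Z mW)).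
move=> x /= [lx ix]; rewrite /linf_abs lx ix !indicE.
by case: (_ \in _); rewrite ?mul1r // !mul0r nr_norm0.
Qed.

Lemma linf_norm1_indicM (W : set X) (l : Linf mu Z) : measurable W ->
  linf_norm1 (linf_indic mu Z W * l) = \int[mu]_x (\1_W x * linf_abs l x).
Proof.
move=> mW; have bW := ess_bounded_indic mu mW; have bl := ess_bounded_abs l.
have bWl : ess_bounded mu (fun x => \1_W x * linf_abs l x).
  split; first by apply: measurable_funM; [exact: measurable_indic|have [] := bl].
  have [c cP] := bl.2; exists c; apply: filterS cP => x h.
  rewrite normrM indicE; case: (_ \in _); rewrite ?normr1 ?mul1r //.
  by rewrite normr0 mul0r (le_trans _ h).
have g0 x : 0 <= \1_W x * linf_abs l x by rewrite mulr_ge0 ?linf_abs_ge0 // indicE ler0n.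
apply/eqP; rewrite eq_le; apply/andP; split; apply: ae_le_Rintegral => //.
- exact: ess_bounded_abs.
- by move=> x; exact: linf_abs_ge0.
- by apply: filterS (linf_abs_indicM l mW) => x; rewrite /linf_abs => ->.
- exact: ess_bounded_abs.
- by move=> x; exact: linf_abs_ge0.
- by apply: filterS (linf_abs_indicM l mW) => x; rewrite /linf_abs => ->.
Qed.

Lemma cp_norm1_chi (W : set X) : measurable W -> cp_norm1 (chi a Z W) = fine (mu W).
Proof.
move=> mW; rewrite (@cp_norm1_sup _ _ _ _ _ _ _ [fset 1%g]%fset); last first.
  apply/fsubsetP => h; apply: contraTT => hg.
  rewrite memNfinsupp -/(cp_coef _ _) cp_monoE; move: hg.
  by rewrite in_fset1 => /negPf ->.
rewrite big_seq_fset1 cp_monoE eqxx -Rintegral_indic // -(mulr1 (linf_indic mu Z W)).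
rewrite linf_norm1_indicM //; apply/eqP; rewrite eq_le.
have b1 : ess_bounded mu (fun x => \1_W x * linf_abs (1 : Linf mu Z) x).
  split; first by apply: measurable_funM; [exact: measurable_indic|have [] := ess_bounded_abs (1 : Linf mu Z)].
  have [_ [c cP]] := ess_bounded_abs (1 : Linf mu Z); exists c; apply: filterS cP => x h.
  rewrite normrM indicE; case: (_ \in _); rewrite ?normr1 ?mul1r //.
  by rewrite normr0 mul0r (le_trans _ h).
have g0 x : 0 <= \1_W x * linf_abs (1 : Linf mu Z) x by rewrite mulr_ge0 ?linf_abs_ge0 // indicE ler0n.
have i0 x : 0 <= \1_W x :> R by rewrite indicE ler0n.
have ae1 : {ae mu, forall x, linf_abs (1 : Linf mu Z) x = 1}.
  have := @linf_repr_ae _ _ _ mu Z 1 1 (esym (linf_class1 _ _)).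
  by apply: filterS => x; rewrite /linf_abs => ->.
by apply/andP; split; apply: ae_le_Rintegral => //; try exact: ess_bounded_indic;
  apply: filterS ae1 => x ->; rewrite mulr1.
Qed.

Lemma cp_norm1_ge (K : {fset G}) (x : S) :
  \sum_(g <- K) linf_norm1 (cp_coef x g) <= cp_norm1 x.
Proof.
rewrite (@cp_norm1_sup _ _ _ _ _ _ _ (cp_supp x `|` K)%fset) ?fsubsetUl //.
rewrite [leRHS](big_fsetID _ (mem K)) /= [X in X + _](_ : _ = \sum_(g <- K) linf_norm1 (cp_coef x g)).
  by rewrite lerDl; apply: sumr_ge0 => g _; exact: linf_norm1_ge0.
apply: eq_fbigl => g; rewrite !inE /=.
by case: (g \in K); rewrite ?orbT ?andbF.
Qed.

(** Converse of [mx_norm_bound]. Testing on [chi W] times the i-th generator, of norm mu(W), bounds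
    the integral of the row sum over every W in [A i] by c mu(W). *)
Lemma opnorm_ae (A : mk_idx mM -> set X) (c : R) (K : {fset G}) i :
  mk_bounded mN f A c -> measurable (A i) -> A i `<=` mk_set i ->
  {ae mu, forall x, A i x ->
    \sum_j \sum_(g <- K) linf_abs (cp_coef (mk_coord mN (f (mk_gen i)) j : S) g) x <= c}.
Proof.
move=> [c0 fc] mA Asub.
pose r j : S := mk_coord mN (f (mk_gen i)) j.
apply: ae_le_of_integral => //.
- apply: ess_bounded_sum => j; apply: ess_bounded_sum => g; exact: ess_bounded_abs.
- by move=> x; apply: sumr_ge0 => j _; apply: sumr_ge0 => g _; exact: linf_abs_ge0.
move=> W mW WA.
have mi := mk_measurable i.
pose z := chi a Z W *: mk_gen i.
have zE j : mk_coord mM z j = if j == i then chi a Z W else 0.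
  rewrite linearZ ffunE mk_genE; case: eqP => _; last exact: mulr0.
  rewrite -[_ *: _]/(chi a Z W * chi a Z (mk_set i)) chi_mul //; congr chi.
  by apply: setIidl => x /WA/Asub.
have Az : summand A z.
  move=> j; rewrite zE; case: eqP => [->|_]; last by exists 0; rewrite mul0r.
  by apply/cyc_chi => //; rewrite chi_mul //; congr chi; exact: setIidl.
have nz : mnorm mM z = fine (mu W).
  rewrite /mnorm (bigD1 i) //= big1 ?addr0; first by rewrite zE eqxx cp_norm1_chi.
  by move=> j ji; rewrite zE (negPf ji) cp_norm1_0.
rewrite -nz; apply: le_trans (fc z Az).
have fz j : mk_coord mN (f z) j = chi a Z W * r j.
  by rewrite /z !linearZ ffunE.
rewrite (_ : \int[mu]_x _ = \sum_j \sum_(g <- K) linf_norm1 (linf_indic mu Z W * cp_coef (r j) g)).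
  apply: ler_sum => j _; rewrite fz; apply: le_trans (cp_norm1_ge K _).
  by apply: ler_sum => g _; rewrite chi_mul_coef.
under [RHS]eq_bigr => j _ do under eq_bigr => g _ do rewrite linf_norm1_indicM //.
have b j g : ess_bounded mu (fun x => \1_W x * linf_abs (cp_coef (r j) g) x).
  have bl := ess_bounded_abs (cp_coef (r j) g).
  split; first by apply: measurable_funM; [exact: measurable_indic|have [] := bl].
  have [cc cP] := bl.2; exists cc; apply: filterS cP => x h.
  rewrite normrM indicE; case: (_ \in _); rewrite ?normr1 ?mul1r //.
  by rewrite normr0 mul0r (le_trans _ h).
rewrite (eq_bigr (fun j => \int[mu]_x \sum_(g <- K) (\1_W x * linf_abs (cp_coef (r j) g) x))); last first.
  by move=> j _; rewrite -(Rintegral_sum K (b j)).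
rewrite -(Rintegral_sum (index_enum _)); last by move=> j; exact: ess_bounded_sum.
congr Rintegral; apply/funext => x; rewrite mulr_sumr; apply: eq_bigr => j _.
by rewrite mulr_sumr.
Qed.

Lemma mk_bounded_ex (A : mk_idx mM -> set X) : exists c, mk_bounded mN f A c.
Proof.
pose Nx : 'M[S]_(#|mk_idx mM|, #|mk_idx mN|) :=
  \matrix_(i, j) mk_coord mN (f (mk_gen (enum_val i))) (enum_val j).
have [K KP] : exists K : {fset G}, forall i j, (cp_supp (Nx i j) `<=` K)%fset.
  exists (\bigcup_(ij <- enum [set: 'I_#|mk_idx mM| * 'I_#|mk_idx mN|]%SET) cp_supp (Nx ij.1 ij.2))%fset.
  move=> i j; apply/fsubsetP => g gN; apply/bigfcupP; exists (i, j) => //.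
  by rewrite mem_enum inE.
have H i : exists c : R, 0 <= c /\ {ae mu, forall x, setT x ->
    \sum_j \sum_(g <- K) linf_abs (cp_coef (Nx i j) g) x <= c}.
  have [_ [c cP]] : ess_bounded mu (fun x => \sum_j \sum_(g <- K) linf_abs (cp_coef (Nx i j) g) x).
    by apply: ess_bounded_sum => j; apply: ess_bounded_sum => g; exact: ess_bounded_abs.
  exists `|c|; split=> //; apply: filterS cP => x h _.
  by rewrite (le_trans (ler_norm _)) // (le_trans h) // ler_norm.
have [c cP] := choice H.
exists (\sum_i c i); split; first by apply: sumr_ge0 => i _; have [] := cP i.
move=> z _; rewrite /mnorm.
pose v : 'rV[S]_#|mk_idx mM| := \row_i mk_coord mM z (enum_val i).
have vN j : (v *m Nx) 0 j = mk_coord mN (f z) (enum_val j).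
  rewrite mxE (mk_coord_linear mM) [RHS]sum_enum_val; apply: eq_bigr => i _.
  by rewrite !mxE.
rewrite [leLHS]sum_enum_val [X in _ * X]sum_enum_val.
rewrite (eq_bigr (fun j => cp_norm1 ((v *m Nx) 0 j))); last by move=> j _; rewrite vN.
rewrite [X in _ * X](eq_bigr (fun i => cp_norm1 (v 0 i))); last by move=> i _; rewrite mxE.
apply: (@mx_norm_bound _ _ _ _ _ _ _ _ _ Nx (fun=> setT) K) => //.
- by apply: sumr_ge0 => i _; have [] := cP i.
- move=> i; have [_ ci] := cP i; apply: filterS ci => x h Tx.
  apply: le_trans (h Tx) _; rewrite (bigD1 i) //= lerDl.
  by apply: sumr_ge0 => j _; have [] := cP j.
- by move=> i; rewrite chiT mulr1.
Qed.

End OperatorNorm.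

(** * Logarithmic norms and carriers *)

Section LogNorm.
Variables (R : realType) (G : groupType) (d : measure_display).
Variables (X : measurableType d) (mu : probability X R) (a : pmpAction G mu).
Variable Z : normedRing R.
Local Notation S := (crossedLinf a Z).

Lemma log_plus_ge0 (t : R) : 0 <= log_plus t.
Proof. by rewrite /log_plus le_max lexx orbT. Qed.

Lemma log_plus_le (s t : R) : 0 <= s -> s <= t -> log_plus s <= log_plus t.
Proof.
rewrite le_eqVlt => /orP[/eqP <- _|s0 st].
  by rewrite {1}/log_plus ln0 // maxxx log_plus_ge0.
rewrite /log_plus ge_max le_max ler_ln ?posrE ?(lt_le_trans s0 st) // st /=.
by rewrite le_max lexx orbT.
Qed.

Lemma fam_dim_ge0 (I : finType) (B : I -> set X) : 0 <= fam_dim mu B.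
Proof. by apply: sumr_ge0 => i _; exact: pr_ge0. Qed.

Variables (M N : lmodType S) (mM : marking M) (mN : marking N).
Variable f : {linear M -> N}.
Implicit Types (A : mk_idx mM -> set X) (B : mk_idx mN -> set X).

Definition carries A B :=
  subfamily B /\ forall z, summand A z -> summand B (f z).

Lemma rk_ge0 A : 0 <= rk mN f A.
Proof.
have [[B AB]|nAB] := pselect (exists B, carries A B).
  apply: lb_le_inf => [|_ [B' _ <-]]; last exact: fam_dim_ge0.
  by exists (fam_dim mu B); exists B.
rewrite /rk (_ : [set fam_dim mu B | B in _] = set0) ?inf0 //.
by apply/seteqP; split=> // x [B AB] _; apply: nAB; exists B.
Qed.

Lemma rk_le A B : carries A B -> rk mN f A <= fam_dim mu B.
Proof.
move=> AB; apply: ge_inf; last by exists B.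
by exists 0 => _ [B' _ <-]; exact: fam_dim_ge0.
Qed.

Lemma carries_full A : carries A (fun i => mk_set i).
Proof.
split=> [i|z _]; first by split; [exact: mk_measurable|].
have h := (mk_coord_image (m := mN) _).1 (ex_intro _ (f z) erefl).
by move=> i; exact: h.
Qed.

Lemma rk_approx A (e : R) : 0 < e -> exists2 B, carries A B &
  fam_dim mu B <= rk mN f A + e.
Proof.
move=> e0; have := @inf_adherent _ [set fam_dim mu B | B in carries A] e e0.
case=> [|_ [B AB <-] /ltW Be]; last by exists B.
split; first by exists (fam_dim mu (fun i : mk_idx mN => mk_set i)); exists (fun i => mk_set i) => //; exact: carries_full.
by exists 0 => _ [B _ <-]; exact: fam_dim_ge0.
Qed.

Lemma lognorm'_ge0 A : 0 <= lognorm' mN f A.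
Proof.
by rewrite /lognorm' le_min !mulr_ge0 ?fam_dim_ge0 ?log_plus_ge0 ?rk_ge0.
Qed.

Lemma lognorm_le (p : nat) (A : 'I_p -> mk_idx mM -> set X) :
  marked_decomposition A -> lognorm mM mN f <= \sum_(k < p) lognorm' mN f (A k).
Proof.
move=> dA; apply: ge_inf; last by exists p, A.
exists 0 => _ [q [A' [_ ->]]]; apply: sumr_ge0 => k _; exact: lognorm'_ge0.
Qed.

(** The rank is an infimum. It is replaced by the dimension of explicit carriers [B k], since sets
    can be recorded in a colouring and transported. *)
Lemma lognorm_approx (e : R) : 0 < e ->
  exists (p : nat) (A : 'I_p -> mk_idx mM -> set X) (B : 'I_p -> mk_idx mN -> set X),
    [/\ marked_decomposition A, forall k, carries (A k) (B k) &
      \sum_(k < p) Num.min (fam_dim mu (A k) * log_plus (opnorm mN f (A k)))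
                           (fam_dim mu (B k) * log_plus (opnorm mN f (A k)))
      <= lognorm mM mN f + e].
Proof.
move=> e0; have e20 : 0 < e / 2 by rewrite divr_gt0.
have := @inf_adherent _ [set s | exists (p : nat) (A : 'I_p -> mk_idx mM -> set X),
    marked_decomposition A /\ s = \sum_(k < p) lognorm' mN f (A k)] _ e20.
case=> [|_ [p [A [dA ->]]] Ae].
  split; last first.
    by exists 0 => _ [q [A' [_ ->]]]; apply: sumr_ge0 => k _; exact: lognorm'_ge0.
  pose A (k : 'I_1) (i : mk_idx mM) := mk_set i.
  exists (\sum_(k < 1) lognorm' mN f (A k)); exists 1%N, A; split=> //; split.
    by move=> k i; exact: mk_measurable.
  move=> i; split; first by move=> k l _ _ _; rewrite !ord1.
  by apply/seteqP; split=> [x [k _ //]|x xi]; exists ord0.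
pose L k := log_plus (opnorm mN f (A k)).
(* Then [del k * L k] is at most e / (2 (p + 1)), and the p pieces lose at most e / 2; the added
   ones keep the denominator positive. *)
pose del k := e / 2 / (p.+1%:R * (L k + 1)).
have L0 k : 0 <= L k by exact: log_plus_ge0.
have del0 k : 0 < del k by rewrite !divr_gt0 // mulr_gt0 ?ltr0n // ltr_wpDl.
have [B BP] := choice (fun k => let: ex_intro2 B h1 h2 := rk_approx (A k) (del0 k) in
  ex_intro (fun B => carries (A k) B /\ fam_dim mu B <= rk mN f (A k) + del k) B (conj h1 h2)).
exists p, A, B; split => //; first by move=> k; have [] := BP k.
apply: (@le_trans _ _ (\sum_(k < p) (lognorm' mN f (A k) + e / 2 / p.+1%:R))).
  apply: ler_sum => k _; have [_ Bk] := BP k.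
  have h : fam_dim mu (B k) * L k <= rk mN f (A k) * L k + e / 2 / p.+1%:R.
    apply: (@le_trans _ _ ((rk mN f (A k) + del k) * L k)); first by rewrite ler_wpM2r.
    rewrite mulrDl lerD2l /del invfM mulrA -[leRHS]mulr1 -[leLHS]mulrA ler_wpM2l //.
      by rewrite !divr_ge0 // ltW.
    by rewrite mulrC ler_pdivrMr ?mul1r ?lerDl // ltr_wpDl.
  have ep : 0 <= e / 2 / p.+1%:R by rewrite !divr_ge0 // ltW.
  rewrite /lognorm' -/(L k) minEle [X in X + _]minEle; case: ifP => h1; case: ifP => h2.
  - by rewrite lerDl.
  - by rewrite (le_trans h1).
  - by move/negbT: h1; rewrite -ltNge => /ltW h1; rewrite (le_trans h1) // lerDl.
  - exact: h.
rewrite big_split /= sumr_const card_ord -[leRHS]/(_ + e) [e in leRHS](splitr e) addrA lerD //.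
  exact: ltW.
rewrite -[leLHS]mulr_natr mulrAC ler_pdivrMr ?ltr0n //.
by rewrite ler_wpM2l ?(ltW e20) // ler_nat.
Qed.

End LogNorm.

(** * Approximate complexes *)

Section CutIdentities.
Variable S : pzRingType.
Implicit Types p q u x y z : S.

Lemma mulr_compl0 x y : x * (1 - y) = 0 -> x * y = x.
Proof. by rewrite mulrBr mulr1 => /eqP; rewrite subr_eq0 => /eqP. Qed.

Lemma mulr_cut u p x q : u * (x * p - x) = 0 -> u * x * q = u * x ->
  u * x * (p * q) = u * x.
Proof. by rewrite mulrBr => /eqP; rewrite subr_eq0 !mulrA => /eqP -> . Qed.

Lemma mulr_cutl p u x q : u * x * q = u * x -> p * u * x * q = p * u * x.
Proof. by rewrite -!mulrA => ->. Qed.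

Lemma mulr_kill p u x : u * x = 0 -> p * u * x = 0.
Proof. by rewrite -mulrA => ->; rewrite mulr0. Qed.

Lemma mulr_assoc_cut z u p x q : u * (p * x) * q = u * (p * x) ->
  z * (u * p) * x * q = z * (u * p) * x.
Proof. by rewrite -!mulrA => ->. Qed.

End CutIdentities.

Lemma mul_block_bd (S : pzRingType) (m r : nat -> nat)
    (M : forall k, 'M[S]_(m k.+1, m k)) (T : forall k, 'M[S]_(r k, m k))
    (D : forall k, 'M[S]_(r k.+1, r k)) (inn out : forall k, 'M[S]_(r k)) k
    (v : 'rV[S]_(m k.+1 + r k.+1)) :
  v *m block_bd M T D inn out k =
  row_mx (lsubmx v *m M k + rsubmx v *m D k *m inn k *m T k) (rsubmx v *m D k *m out k).
Proof.
by rewrite -{1}(hsubmxK v) mul_row_block mulmx0 add0r !mulmxA.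
Qed.

Section ApproximateComplex.
Variables (R : realType) (G : groupType) (dsp : measure_display).
Variables (Y : measurableType dsp) (nu : probability Y R) (b : pmpAction G nu).
Variable Z : normedRing R.
Local Notation S := (crossedLinf b Z).
Variables (n : nat) (m r : nat -> nat).
Variable B : forall k, 'I_(m k) -> set Y.
Hypothesis mB : forall k i, measurable (@B k i).
Variables (M : forall k, 'M[S]_(m k.+1, m k)) (T : forall k, 'M[S]_(r k, m k)).
Variables (d : forall k, 'M[groupRing G Z]_(r k.+1, r k)).
Variable e : forall k, 'M[groupRing G Z]_(r k).
Variables (eta : 'I_(m 0) -> linfMod b Z) (ep : 'I_(r 0) -> trivmod G Z).
Hypothesis resd : mx_resolution n d e ep.
Variables (E : set Y) (K : {fset G}).
Hypothesis mE : measurable E.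

Hypothesis MB : forall k, (k <= n)%N -> forall i j,
  chi b Z (~` E) * (M k i j * chi b Z (@B k j) - M k i j) = 0.
Hypothesis TB : forall k, (k <= n.+1)%N -> forall i j,
  chi b Z (~` E) * (T k i j * chi b Z (@B k j) - T k i j) = 0.
Hypothesis MM : forall k, (k < n)%N -> forall i j,
  chi b Z (~` E) * (M k.+1 *m M k) i j = 0.
Hypothesis TM : forall k, (k <= n)%N -> forall i j,
  chi b Z (~` E) * (T k.+1 *m M k - bd_mx b d k *m T k) i j = 0.
Hypothesis Meta : forall i,
  linf_indic nu Z (~` E) * (lincomb eta (row i (M 0)) : Linf nu Z) = 0.
Hypothesis Teta : forall j,
  linf_indic nu Z (~` E) * (lincomb eta (row j (T 0)) - linf_const nu (ep j) : Linf nu Z) = 0.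
Hypothesis MK : forall k, (k <= n)%N -> forall i j, (cp_supp (M k i j) `<=` K)%fset.
Hypothesis TK : forall k, (k <= n.+1)%N -> forall i j, (cp_supp (T k i j) `<=` K)%fset.
Hypothesis dK : forall k, (k <= n)%N -> forall i j, (cp_supp (bd_mx b d k i j) `<=` K)%fset.

(* All maps have support in K, so they carry functions supported on
   [good_set k.+1] to functions supported on [good_set k]. *)
Fixpoint good_set k : set Y :=
  match k with
  | 0 => ~` E
  | k.+1 => good_set k `&` \bigcap_(g in [set` K]) (b g^-1%g @^-1` good_set k)
  end.

Lemma good_set_measurable k : measurable (good_set k).
Proof.
elim: k => [|k IH] /=; first exact: measurableC.
apply: measurableI => //; apply: fin_bigcap_measurable => [|g _].
  exact: finite_fset.
exact: pact_meas_preimage.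
Qed.

Lemma good_set_sub k : good_set k `<=` ~` E.
Proof. by elim: k => [|k IH] //= y [/IH]. Qed.

(** Each step joins to the bad set its translates by K, which multiplies the measure by at most the
    cardinality of K plus 1. *)
Lemma bad_set_bound k : fine (nu (~` good_set k)) <= (#|` K|.+1 ^ k)%:R * fine (nu E).
Proof.
elim: k => [|k IH] /=; first by rewrite setCK mul1r.
have mk := good_set_measurable k.
have -> : ~` (good_set k `&` \bigcap_(g in [set` K]) (b g^-1%g @^-1` good_set k)) =
    ~` good_set k `|` \big[setU/set0]_(g <- K) (b g^-1%g @^-1` (~` good_set k)).
  rewrite setCI setC_bigcap; congr (_ `|` _).
  by rewrite -bigcup_fset; apply: eq_bigcupr => g _; rewrite preimage_setC.
have mg g : measurable (b g^-1%g @^-1` (~` good_set k)).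
  by apply: pact_meas_preimage; exact: measurableC.
apply: le_trans (pr_setU_le _ _ _) _; [exact: measurableC|exact: bigsetU_measurable|].
rewrite expnS -[(#|` K|.+1)%N]add1n natrM natrD !mulrDl mul1r lerD //.
apply: le_trans (pr_bigU_le _ _ _ mg) _.
rewrite (eq_bigr (fun=> fine (nu (~` good_set k)))); last first.
  by move=> g _; rewrite pact_preserving //; exact: measurableC.
rewrite big_const_seq count_predT iter_addr_0 -[leLHS]mulr_natl -[leRHS]mulrA.
exact: ler_wpM2l.
Qed.

Lemma good_setI k : good_set k `&` ~` E = good_set k.
Proof. exact/setIidl/good_set_sub. Qed.

Lemma chi_kill k x : chi b Z (~` E) * x = 0 -> chi b Z (good_set k) * x = 0.
Proof.
move=> x0; have mk := good_set_measurable k; have mE' := measurableC mE.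
have -> : chi b Z (good_set k) = chi b Z (good_set k) * chi b Z (~` E).
  by rewrite (chi_mul b Z mk mE') good_setI.
exact: mulr_kill.
Qed.

Lemma indic_kill k (l : Linf nu Z) : linf_indic nu Z (~` E) * l = 0 ->
  linf_indic nu Z (good_set k) * l = 0.
Proof.
move=> l0; have mk := good_set_measurable k; have mE' := measurableC mE.
have -> : linf_indic nu Z (good_set k) = linf_indic nu Z (good_set k) * linf_indic nu Z (~` E).
  by rewrite -(linf_indicI nu Z mk mE') good_setI.
exact: mulr_kill.
Qed.

Lemma good_set_sep k x : (cp_supp x `<=` K)%fset ->
  chi b Z (good_set k.+1) * x * chi b Z (~` good_set k) = 0.
Proof.
move=> xK; apply: (chi_sep (good_set_measurable k.+1) (measurableC (good_set_measurable k)) xK).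
by move=> g y gK /= [_ h]; apply; apply: h.
Qed.

Lemma good_set_in k x : (cp_supp x `<=` K)%fset ->
  chi b Z (good_set k.+1) * x * chi b Z (good_set k) = chi b Z (good_set k.+1) * x.
Proof.
move=> /good_set_sep h.
apply: mulr_compl0; rewrite -(chiC b Z (good_set_measurable k)).
exact: h.
Qed.

Lemma chi_mxl (p q : nat) (D : 'I_p -> set Y) (A : 'M[S]_(p, q)) i j :
  (chi_mx b Z D *m A) i j = chi b Z (D i) * A i j.
Proof. by rewrite /chi_mx mul_diag_mx !mxE. Qed.

Lemma chi_mxr (p q : nat) (D : 'I_q -> set Y) (A : 'M[S]_(p, q)) i j :
  (A *m chi_mx b Z D) i j = A i j * chi b Z (D j).
Proof. by rewrite /chi_mx mul_mx_diag !mxE. Qed.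

Lemma chi_scalar_mx (p : nat) (D : set Y) : (chi b Z D)%:M = chi_mx b Z (fun _ : 'I_p => D).
Proof.
rewrite -diag_const_mx /chi_mx; congr diag_mx.
by apply/rowP => i; rewrite !mxE.
Qed.

Local Notation cut := (cut_mx b Z B good_set).
Local Notation inn := (in_mx b Z r good_set).
Local Notation out := (out_mx b Z r good_set).

Lemma chi_good k W : measurable W ->
  chi b Z (W `&` good_set k) = chi b Z W * chi b Z (good_set k).
Proof. by move=> mW; rewrite chi_mul //; exact: good_set_measurable. Qed.

(** The left factor acts twice: lying off E it kills the defect of the relation with [chi W], and as
    x has support in K it confines the product to [good_set k]. *)
Lemma good_cut k W x : measurable W -> (cp_supp x `<=` K)%fset ->
  chi b Z (~` E) * (x * chi b Z W - x) = 0 ->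
  chi b Z (good_set k.+1) * x * chi b Z (W `&` good_set k) = chi b Z (good_set k.+1) * x.
Proof.
move=> mW xK /(@chi_kill k.+1) h; rewrite (chi_good k mW).
by apply: mulr_cut h _; exact: good_set_in.
Qed.

Lemma approx_cutM k : (k <= n)%N -> cut k.+1 *m M k *m cut k = cut k.+1 *m M k.
Proof.
move=> kn; apply/matrixP => i j; rewrite chi_mxr chi_mxl (chi_good k.+1 (mB i)).
by apply: mulr_cutl; apply: good_cut => //; [exact: MK|exact: MB].
Qed.

Lemma approx_innT k : (k <= n.+1)%N -> inn k *m T k *m cut k = inn k *m T k.
Proof.
move=> kn; rewrite /in_mx chi_scalar_mx; apply/matrixP => i j.
by rewrite chi_mxr chi_mxl; apply: good_cut => //; [exact: TK|exact: TB].
Qed.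

Lemma approx_in_out k : (k <= n)%N -> inn k.+1 *m bd_mx b d k *m out k = 0.
Proof.
move=> kn; rewrite /in_mx /out_mx !chi_scalar_mx; apply/matrixP => i j.
by rewrite chi_mxr chi_mxl [RHS]mxE; apply: good_set_sep; exact: dK.
Qed.

Lemma approx_cutMM k : (k < n)%N -> cut k.+2 *m M k.+1 *m M k = 0.
Proof.
move=> kn; rewrite -mulmxA; apply/matrixP => i j; rewrite chi_mxl chi_good //.
by rewrite [RHS]mxE; apply/mulr_kill/chi_kill/MM.
Qed.

Lemma approx_innTM k : (k <= n)%N ->
  inn k.+1 *m (T k.+1 *m M k - bd_mx b d k *m T k) = 0.
Proof.
move=> kn; rewrite /in_mx chi_scalar_mx; apply/matrixP => i j; rewrite chi_mxl.
by rewrite [RHS]mxE; apply/chi_kill/TM.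
Qed.

Lemma approx_cutMeta v : lincomb eta (v *m cut 1 *m M 0) = 0.
Proof.
rewrite lincomb_mulmx /lincomb big1 // => i _.
rewrite chi_mxr chi_good // mulrA -scalerA chi_scale -/(lincomb eta _) indic_kill ?scaler0 //.
Qed.

Lemma approx_innTeta v :
  lincomb eta (v *m inn 0 *m T 0) = lincomb (ep_linf b ep) (v *m inn 0).
Proof.
rewrite lincomb_mulmx /lincomb; apply: eq_bigr => i _.
rewrite /in_mx chi_scalar_mx chi_mxr -!scalerA; congr (_ *: _).
rewrite !chi_scale -/(lincomb eta _); apply/eqP; rewrite -subr_eq0 -mulrBr.
by apply/eqP/indic_kill/Teta.
Qed.

Definition approx_strict : markedComplex b Z :=
  strict_complex mB good_set_measurable approx_cutM approx_innT approx_in_out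
    approx_cutMM approx_innTM (mxr_dd resd) approx_cutMeta approx_innTeta
    (mxr_epd resd) (mxr_ep_surj resd).

Lemma approx_strict_embeds (C : augComplex (trivmod G Z)) : (forall k, is_free (C k)) ->
  embeds C n approx_strict.
Proof.
move=> freeC; have [phi [phi0 phiS]] := to_mx_resolution resd freeC.
exact: (strict_embeds _ _ _ _ _ _ _ _ _ _ _ _ phi0 phiS).
Qed.

(** In degree n the resolution is retained on the complement of [good_set n.+1], whence the exponent
    and the factor [r n]. *)
Lemma approx_mdim : mdim (mc_mark approx_strict n) <=
  \sum_i fine (nu (@B n i)) + (r n * #|` K|.+1 ^ n.+1)%:R * fine (nu E).
Proof.
rewrite /mdim /fam_dim /= big_split_ord /= lerD //.
  apply: ler_sum => i _; rewrite /strict_set leqnSn (unsplitK (inl i)).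
  by apply: pr_le => //; apply: measurableI => //; exact: good_set_measurable.
rewrite natrM -mulrA mulr_natl -[in leRHS](card_ord (r n)) -sumr_const.
apply: ler_sum => i _; rewrite /strict_set leqnSn (unsplitK (inr i)).
exact: bad_set_bound.
Qed.

Lemma cp_supp_chi_mul W x : (cp_supp x `<=` K)%fset -> (cp_supp (chi b Z W * x) `<=` K)%fset.
Proof.
move=> /fsubsetP xK; apply/fsubsetP => g; apply: contraTT => gK.
rewrite memNfinsupp -/(cp_coef _ _) chi_mul_coef cp_coef_out ?mulr0 //.
by apply: contra gK; exact: xK.
Qed.

Lemma cp_norm1_mul_chi_le W (x : S) : measurable W -> cp_norm1 (x * chi b Z W) <= cp_norm1 x.
Proof.
move=> mW; rewrite (@cp_norm1_sup _ _ _ _ _ _ _ (cp_supp x)); last first.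
  apply/fsubsetP => g; apply: contraTT => gx.
  by rewrite memNfinsupp -/(cp_coef _ _) mul_chi_coef // cp_coef_out // mul0r.
apply: ler_sum => g _; rewrite mul_chi_coef // [_ * linf_indic _ _ _]mulrC.
have := @linf_norm1_sum_le _ _ _ nu Z _ unit [:: tt] [:: tt]
  (fun=> linf_indic nu Z (b g^-1%g @^-1` W) * cp_coef x g) (fun=> cp_coef x g) (fun=> 1) (fun=> ler01).
rewrite !big_cons !big_nil !addr0 mul1r; apply.
have mW' : measurable (b g^-1%g @^-1` W) by exact: pact_meas_preimage.
apply: filterS (linf_abs_indicM (cp_coef x g) mW') => y.
rewrite !big_cons !big_nil !addr0 mul1r => ->; rewrite indicE.
by case: (_ \in _); rewrite ?mul1r // mul0r linf_abs_ge0.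
Qed.

Section LogNormBound.
Variables (p : nat) (Bp : 'I_p -> 'I_(m n.+1) -> set Y) (Np : 'I_p -> 'I_(m n) -> set Y).
Variables (c : 'I_p -> R) (cd cT : R).
Hypothesis mBp : forall k i, measurable (Bp k i).
Hypothesis mNp : forall k j, measurable (Np k j).
Hypothesis c0 : forall k, 0 <= c k.
Hypothesis cd0 : 0 <= cd.
Hypothesis cT0 : 0 <= cT.
Hypothesis Bp_disj : forall y i k l, ~ E y -> Bp k i y -> Bp l i y -> k = l.
Hypothesis Bp_cover : forall y i, ~ E y -> (@B n.+1 i y <-> exists k, Bp k i y).
Hypothesis Np_sub : forall y k j, ~ E y -> Np k j y -> @B n j y.
Hypothesis BMN : forall k i j,
  chi b Z (~` E) * (chi b Z (Bp k i) * M n i j * chi b Z (Np k j) - chi b Z (Bp k i) * M n i j) = 0.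
Hypothesis Mc : forall k i, {ae nu, forall y, ~ E y -> Bp k i y ->
  \sum_j \sum_(g <- K) linf_abs (cp_coef (M n i j) g) y <= c k}.
Hypothesis dc : forall i, {ae nu, forall y,
  \sum_j \sum_(g <- K) linf_abs (cp_coef (bd_mx b d n i j) g) y <= cd}.
Hypothesis Tc : forall i, {ae nu, forall y,
  \sum_j \sum_(g <- K) linf_abs (cp_coef (T n i j) g) y <= cT}.

Local Notation D := approx_strict.

(* The last piece is the free summand, which lives on a set of small measure; its
   norm is bounded by the constants cd and cT, independent of E. *)
Definition piece (k : 'I_(p + 1)) (i : 'I_(m n.+1 + r n.+1)) : set Y :=
  match fintype.split k, fintype.split i with
  | inl k, inl i => Bp k i `&` good_set n.+1
  | inr _, inr _ => ~` good_set n.+2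
  | _, _ => set0
  end.

Definition piece_range (k : 'I_p) (j : 'I_(m n + r n)) : set Y :=
  match fintype.split j with inl j => Np k j `&` good_set n | inr _ => set0 end.

Fact piece_measurable k i : measurable (piece k i).
Proof.
rewrite /piece; case: fintype.split => [l|_]; case: fintype.split => [j|_] //.
  by apply: measurableI => //; exact: good_set_measurable.
by apply: measurableC; exact: good_set_measurable.
Qed.

(** The pieces are cut down to a good set, where disjointness and covering, assumed only off E,
    become exact. *)
Lemma piece_decomposition : @marked_decomposition _ _ _ _ _ _ _ _ (mc_mark D n.+1) _ piece.
Proof.
split=> [k i|i]; first exact: piece_measurable.
split.
  move=> k l _ _ [y []]; rewrite /piece -[k]splitK -[l]splitK !unsplitK.
  case: (fintype.split k) => k'; case: (fintype.split l) => l';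
    case: fintype.split => j //=; last by rewrite !ord1.
  move=> [h1 h2] [h3 _]; congr (unsplit (inl _)).
  by apply: Bp_disj h1 h3; exact: (@good_set_sub n.+1 y h2).
have SE : mk_set (i : mk_idx (mc_mark D n.+1)) =
  match fintype.split i with inl j => @B n.+1 j `&` good_set n.+1 | inr _ => ~` good_set n.+2 end.
  by rewrite /= /strict_set leqnn.
rewrite SE /piece; case: (fintype.split i) => j; apply/seteqP; split=> y.
- move=> [k _]; case: fintype.split => // k' [h1 h2]; split=> //.
  by apply/Bp_cover; [exact: (@good_set_sub n.+1 y h2)|exists k'].
- move=> [h1 h2]; have /Bp_cover h := good_set_sub h2.
  have [k hk] := (h j).1 h1; exists (unsplit (inl k)) => //.
  by rewrite unsplitK.
- by move=> [k _]; case: fintype.split.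
- by move=> h; exists (unsplit (inr ord0)) => //; rewrite unsplitK.
Qed.

Definition strict_vec k (z : D k) : 'rV[S]_(m k + r k) :=
  @from_fixmx _ _ (chi_mx b Z (strict_set n B good_set (k := k))) z.

Lemma strict_coord k (z : D k) i : mk_coord (mc_mark D k) z i = strict_vec z 0 i :> S.
Proof. by rewrite /= ffunE. Qed.

Lemma strict_bdE (z : D n.+1) : strict_vec (ch_bd D n z) =
  row_mx (lsubmx (strict_vec z) *m M n + rsubmx (strict_vec z) *m bd_mx b d n *m inn n *m T n)
         (rsubmx (strict_vec z) *m bd_mx b d n *m out n).
Proof.
rewrite -[LHS]/(strict_vec z *m strict_bd n good_set M T d n) /strict_bd leqnn.
exact: mul_block_bd.
Qed.

Lemma strict_mnorm k (z : D k) : mnorm (mc_mark D k) z =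
  \sum_i cp_norm1 (lsubmx (strict_vec z) 0 i) + \sum_j cp_norm1 (rsubmx (strict_vec z) 0 j).
Proof.
rewrite /mnorm (eq_bigr (fun i => cp_norm1 (strict_vec z 0 i))); last first.
  by move=> i _; rewrite strict_coord.
rewrite big_split_ord; congr (_ + _); apply: eq_bigr => i _;
  by congr cp_norm1; rewrite mxE.
Qed.

Lemma cyc_set0 (x : S) : cyc set0 x -> x = 0.
Proof. by move=> [u ->]; rewrite -/(chi b Z set0) chi0 mulr0. Qed.

Lemma summand_piece_l k (z : D n.+1) : summand (m := mc_mark D n.+1) (piece (lshift 1 k)) z ->
  (forall i, lsubmx (strict_vec z) 0 i * chi b Z (Bp k i `&` good_set n.+1) =
     lsubmx (strict_vec z) 0 i) /\ rsubmx (strict_vec z) = 0.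
Proof.
move=> zk; split=> [i|].
  have := zk (lshift _ i); rewrite strict_coord /piece (unsplitK (inl k)) (unsplitK (inl i)).
  rewrite mxE => h; apply/cyc_chi => //.
  by apply: measurableI => //; exact: good_set_measurable.
apply/rowP => j; have := zk (rshift _ j).
rewrite strict_coord /piece (unsplitK (inl k)) (unsplitK (inr j)) => /cyc_set0.
by rewrite !mxE.
Qed.

Lemma summand_piece_r (z : D n.+1) : summand (m := mc_mark D n.+1) (piece (rshift p ord0)) z ->
  lsubmx (strict_vec z) = 0.
Proof.
move=> zk; apply/rowP => j; have := zk (lshift _ j).
rewrite strict_coord /piece (unsplitK (inr ord0)) (unsplitK (inl j)) => /cyc_set0.
by rewrite !mxE.
Qed.

Lemma strict_bd_l (z : D n.+1) : rsubmx (strict_vec z) = 0 ->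
  lsubmx (strict_vec (ch_bd D n z)) = lsubmx (strict_vec z) *m M n /\
  rsubmx (strict_vec (ch_bd D n z)) = 0.
Proof.
by move=> z0; rewrite strict_bdE row_mxKl row_mxKr z0 !mul0mx addr0.
Qed.

Lemma strict_bd_r (z : D n.+1) : lsubmx (strict_vec z) = 0 ->
  lsubmx (strict_vec (ch_bd D n z)) = rsubmx (strict_vec z) *m bd_mx b d n *m inn n *m T n /\
  rsubmx (strict_vec (ch_bd D n z)) = rsubmx (strict_vec z) *m bd_mx b d n *m out n.
Proof.
by move=> z0; rewrite strict_bdE row_mxKl row_mxKr z0 mul0mx add0r.
Qed.

Lemma sum_cp_norm1_0 q : \sum_i cp_norm1 ((0 : 'rV[S]_q) 0 i) = 0.
Proof. by apply: big1 => i _; rewrite mxE cp_norm1_0. Qed.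

Lemma piece_bounded_l k : mk_bounded (mM := mc_mark D n.+1) (mc_mark D n) (ch_bd D n)
  (piece (lshift 1 k)) (c k).
Proof.
split=> // z /summand_piece_l[zl zr]; have [fl fr] := strict_bd_l zr.
rewrite !strict_mnorm fl fr zr !sum_cp_norm1_0 !addr0.
apply: (mx_norm_bound _ (MK (leqnn n)) (c0 k) _ zl).
  by move=> i; apply: measurableI => //; exact: good_set_measurable.
move=> i; apply: filterS (Mc k i) => y h [yB yg].
by apply: h => //; exact: (good_set_sub yg).
Qed.

Lemma sum_cp_norm1_mul_chi q (v : 'rV[S]_q) W : measurable W ->
  \sum_i cp_norm1 ((v *m chi_mx b Z (fun=> W)) 0 i) <= \sum_i cp_norm1 (v 0 i).
Proof.
by move=> mW; apply: ler_sum => i _; rewrite chi_mxr; exact: cp_norm1_mul_chi_le.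
Qed.

(** The boundary of a row t of the resolution is (t d inn T, t d out). Multiplying by indicators
    does not increase norms, so the components contribute cT cd and cd. *)
Lemma piece_bounded_r : mk_bounded (mM := mc_mark D n.+1) (mc_mark D n) (ch_bd D n)
  (piece (rshift p ord0)) (cT * cd + cd).
Proof.
split=> [|z /summand_piece_r zl]; first by rewrite addr_ge0 ?mulr_ge0.
have [fl fr] := strict_bd_r zl.
rewrite !strict_mnorm fl fr zl sum_cp_norm1_0 add0r.
set t := rsubmx (strict_vec z).
have td : \sum_i cp_norm1 ((t *m bd_mx b d n) 0 i) <= cd * \sum_i cp_norm1 (t 0 i).
  apply: (@mx_norm_bound _ _ _ _ _ _ _ _ _ _ (fun=> setT) K) => //; first exact: dK.
    by move=> i; apply: filterS (dc i).
  by move=> i; rewrite chiT mulr1.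
have mg := good_set_measurable n.+1.
rewrite mulrDl lerD //.
  rewrite -mulrA; apply: le_trans (_ : cT * \sum_i cp_norm1 ((t *m bd_mx b d n *m inn n) 0 i) <= _).
    apply: (@mx_norm_bound _ _ _ _ _ _ _ _ _ _ (fun=> setT) K) => //; first by apply: TK; exact: leqnSn.
      by move=> i; apply: filterS (Tc i).
    by move=> i; rewrite chiT mulr1.
  rewrite ler_wpM2l //; apply: le_trans td.
  by rewrite /in_mx chi_scalar_mx; exact: sum_cp_norm1_mul_chi.
apply: le_trans td; rewrite /out_mx chi_scalar_mx; apply: sum_cp_norm1_mul_chi.
exact: measurableC.
Qed.

(** Off E the carrier relation [BMN] puts the image of a piece in [Np], and the supports in K put it
    in [good_set n]; [good_cut] gives both at once. *)
Lemma piece_carries k : carries (mM := mc_mark D n.+1) (mN := mc_mark D n) (ch_bd D n)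
  (piece (lshift 1 k)) (piece_range k).
Proof.
split=> [j|z /summand_piece_l[zl zr] j].
  have SE : mk_set (j : mk_idx (mc_mark D n)) =
    match fintype.split j with inl j => @B n j `&` good_set n | inr _ => ~` good_set n.+1 end.
    by rewrite /= /strict_set leqnSn.
  rewrite SE /piece_range; case: fintype.split => i; split => //.
    by apply: measurableI => //; exact: good_set_measurable.
  move=> y [h1 h2]; split=> //.
  by apply: Np_sub h1; exact: (good_set_sub h2).
have [fl fr] := strict_bd_l zr.
rewrite strict_coord /piece_range -[j]splitK unsplitK; case: (fintype.split j) => i.
  rewrite -[unsplit _]/(lshift (r n) i).
  have -> : strict_vec (ch_bd D n z) 0 (lshift (r n) i) = (lsubmx (strict_vec z) *m M n) 0 i.
    by rewrite -fl [RHS]mxE.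
  have mN : measurable (Np k i `&` good_set n).
    by apply: measurableI => //; exact: good_set_measurable.
  apply/cyc_chi => //; rewrite mxE mulr_suml; apply: eq_bigr => l _.
  have mBl := mBp k l; have mg := good_set_measurable n.+1.
  rewrite -{1}(zl l) -[in RHS](zl l).
  have -> : chi b Z (Bp k l `&` good_set n.+1) = chi b Z (good_set n.+1) * chi b Z (Bp k l).
    by rewrite setIC (chi_mul b Z mg mBl).
  have := good_cut n (mNp k i) (cp_supp_chi_mul (Bp k l) (MK (leqnn n) l i)) (BMN k l i).
  exact: mulr_assoc_cut.
rewrite -[unsplit _]/(rshift (m n) i).
have -> : strict_vec (ch_bd D n z) 0 (rshift (m n) i) = 0.
  by have := congr1 (fun v : 'rV[S]__ => v 0 i) fr; rewrite !mxE.
by exists 0; rewrite mul0r.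
Qed.

Lemma piece_fam_dim_l k : fam_dim nu (piece (lshift 1 k)) <= \sum_i fine (nu (Bp k i)).
Proof.
rewrite /fam_dim big_split_ord /= [X in _ + X]big1 ?addr0; last first.
  by move=> i _; rewrite /piece (unsplitK (inl k)) (unsplitK (inr i)) measure0.
apply: ler_sum => i _; rewrite /piece (unsplitK (inl k)) (unsplitK (inl i)).
by apply: pr_le => //; apply: measurableI => //; exact: good_set_measurable.
Qed.

Lemma piece_fam_dim_r : fam_dim nu (piece (rshift p ord0)) <=
  (r n.+1 * #|` K|.+1 ^ n.+2)%:R * fine (nu E).
Proof.
rewrite /fam_dim big_split_ord /= [X in X + _]big1 ?add0r; last first.
  by move=> i _; rewrite /piece (unsplitK (inr ord0)) (unsplitK (inl i)) measure0.
rewrite natrM -mulrA mulr_natl -[in leRHS](card_ord (r n.+1)) -sumr_const.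
apply: ler_sum => i _; rewrite /piece (unsplitK (inr ord0)) (unsplitK (inr i)).
exact: (bad_set_bound n.+2).
Qed.

Lemma piece_range_dim k : fam_dim nu (piece_range k) <= \sum_j fine (nu (Np k j)).
Proof.
rewrite /fam_dim big_split_ord /= [X in _ + X]big1 ?addr0; last first.
  by move=> i _; rewrite /piece_range (unsplitK (inr i)) measure0.
apply: ler_sum => i _; rewrite /piece_range (unsplitK (inl i)).
by apply: pr_le => //; apply: measurableI => //; exact: good_set_measurable.
Qed.

Lemma approx_lognorm :
  lognorm (mc_mark D n.+1) (mc_mark D n) (ch_bd D n) <=
  \sum_(k < p) Num.min ((\sum_i fine (nu (Bp k i))) * log_plus (c k))
                       ((\sum_j fine (nu (Np k j))) * log_plus (c k)) +
  (r n.+1 * #|` K|.+1 ^ n.+2)%:R * fine (nu E) * log_plus (cT * cd + cd).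
Proof.
apply: (le_trans (lognorm_le (mc_mark D n) (ch_bd D n) piece_decomposition)).
rewrite big_split_ord big_ord1 lerD //.
  apply: ler_sum => k _.
  pose P : mk_idx (mc_mark D n.+1) -> set Y := piece (lshift 1 k).
  have op0 := opnorm_ge0 (mc_mark D n) (ch_bd D n) P.
  have lp := log_plus_le op0 (opnorm_le (piece_bounded_l k)).
  have l0 := log_plus_ge0 (opnorm (mc_mark D n) (ch_bd D n) P).
  rewrite /lognorm' le_min !ge_min; apply/andP; split; apply/orP; [left|right].
    by apply: ler_pM => //; [exact: fam_dim_ge0|exact: piece_fam_dim_l].
  apply: ler_pM => //; first exact: rk_ge0.
  by apply: le_trans (rk_le (piece_carries k)) _; exact: piece_range_dim.
(* The glued piece is estimated by its dimension, a multiple of nu(E). *)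
rewrite /lognorm' ge_min; apply/orP; left; apply: ler_pM.
- exact: fam_dim_ge0.
- exact: log_plus_ge0.
- exact: piece_fam_dim_r.
apply: log_plus_le; first exact: opnorm_ge0.
exact: (opnorm_le piece_bounded_r).
Qed.

End LogNormBound.

End ApproximateComplex.

(** * Transport of embeddings *)

Section LargeSeq.
Variable T : eqType.

(* Q holds eventually along the finite subsets of T. *)
Definition large_seq (Q : seq T -> Prop) := exists s0 : seq T, forall s : seq T, {subset s0 <= s} -> Q s.

Lemma large_seq_mem x : large_seq (fun s => x \in s).
Proof. by exists [:: x] => s; apply; rewrite mem_head. Qed.

Lemma large_seq_and Q Q' : large_seq Q -> large_seq Q' -> large_seq (fun s => Q s /\ Q' s).
Proof.
move=> [s Qs] [s' Qs']; exists (s ++ s') => t st; split; [apply: Qs|apply: Qs'] => x xs;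
  by apply: st; rewrite mem_cat xs ?orbT.
Qed.

Lemma large_seq_all (I : eqType) (r : seq I) (Q : I -> seq T -> Prop) :
  (forall i, large_seq (Q i)) -> large_seq (fun s => forall i, i \in r -> Q i s).
Proof.
move=> LQ; elim: r => [|i r [s0 IH]]; first by exists [::].
have [s1 s1P] := large_seq_and (LQ i) (ex_intro _ s0 IH).
exists s1 => s /s1P[Qi Qr] j; rewrite in_cons => /orP[/eqP ->//|]; exact: Qr.
Qed.

Lemma large_seq_fin (I : finType) (Q : I -> seq T -> Prop) :
  (forall i, large_seq (Q i)) -> large_seq (fun s => forall i, Q i s).
Proof.
move=> /(large_seq_all (enum I))[s sP]; exists s => t st i.
by apply: sP; rewrite ?mem_enum.
Qed.

Lemma large_seq_lt (N : nat) (Q : nat -> seq T -> Prop) :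
  (forall k, large_seq (Q k)) -> large_seq (fun s => forall k, (k < N)%N -> Q k s).
Proof.
move=> /(large_seq_all (iota 0 N))[s sP]; exists s => t st k kN.
by apply: sP; rewrite ?mem_iota.
Qed.

End LargeSeq.

Section LargeSeqGroup.
Variables (G : groupType) (I : Type) (Z : pzRingType).

Lemma large_seq_fset (Q : {fset G} -> Prop) F0 :
  (forall F, (F0 `<=` F)%fset -> Q F) -> large_seq (fun s : seq G => Q [fset g in s]%fset).
Proof.
move=> QF; exists F0 => s sF; apply: QF; apply/fsubsetP => g /sF gs.
by rewrite in_fset.
Qed.

Lemma large_seq_local_on (f : locfun G I Z) :
  large_seq (fun s : seq G => local_on [fset g in s]%fset f).
Proof.
have /asboolP[F lF] := loc_valP f.
by apply: (@large_seq_fset (fun F => local_on F f) F) => F' FF'; exact: local_on_sub lF.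
Qed.

Lemma large_seq_sym_local (u : symRing G I Z) :
  large_seq (fun s : seq G => sym_local_on [fset g in s]%fset u).
Proof.
have [F lF] := sym_local u.
by apply: (@large_seq_fset (fun F => sym_local_on F u) F) => F' FF' g; exact: local_on_sub (lF g).
Qed.

Lemma large_seq_supp (A : pzRingType) (ac : ringAction G A) (x : crossed ac) :
  large_seq (fun s : seq G => (cp_supp x `<=` [fset g in s])%fset).
Proof. by apply: (@large_seq_fset (fun F => cp_supp x `<=` F)%fset (cp_supp x)). Qed.

End LargeSeqGroup.

Section RealizationBounds.
Variables (R : realType) (G : groupType) (d : measure_display).
Variables (X : measurableType d) (mu : probability X R) (a : pmpAction G mu).
Variables (Z : normedRing R) (I : finType) (c : X -> I).
Hypothesis mc : fin_measurable c.

Lemma realize_abs (f : locfun G I Z) :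
  {ae mu, forall x, linf_abs (realize_loc a mc f) x = nr_norm (f (pattern a c x))}.
Proof.
have := @linf_repr_ae _ _ _ mu Z (realize_loc a mc f) (realize_fun a mc f) erefl.
by apply: filterS => x; rewrite /linf_abs => ->.
Qed.

Lemma linf_const_abs (z : Z) : {ae mu, forall x, linf_abs (linf_const mu z) x = nr_norm z}.
Proof.
have := @linf_repr_ae _ _ _ mu Z (linf_const mu z) _ erefl.
by apply: filterS => x; rewrite /linf_abs => ->.
Qed.

Lemma cp_supp_realize u : (cp_supp (realize a Z mc u) `<=` cp_supp u)%fset.
Proof.
apply/fsubsetP => g; apply: contraTT => gu.
by rewrite memNfinsupp -/(cp_coef _ _) realize_coef cp_coef_out // rmorph0.
Qed.

Lemma cp_supp_grp_incl (x : groupRing G Z) : (cp_supp (grp_incl a x) `<=` cp_supp x)%fset.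
Proof.
apply/fsubsetP => g; apply: contraTT => gu.
by rewrite memNfinsupp -/(cp_coef _ _) grp_incl_coef cp_coef_out // rmorph0.
Qed.

Lemma realize_lincomb q (e : 'I_q -> symMod G I Z) (v : 'rV[symRing G I Z]_q) :
  realize_loc a mc (lincomb e v) =
  lincomb (fun i => realize_loc a mc (e i) : linfMod a Z) (map_mx (realize a Z mc) v).
Proof.
rewrite /lincomb (rmorph_sum (realize_loc a mc)); apply: eq_bigr => i _.
by rewrite mxE; exact: realize_scale.
Qed.

End RealizationBounds.

(** The bound covers all patterns, not just those occurring in X: points of E may have any pattern,
    and the transported T must be bounded there by a constant known before E. *)
Lemma locfun_bounded (R : realType) (G : groupType) (Z : normedRing R) (I : finType)
    (f : locfun G I Z) : exists C : R, 0 <= C /\ forall p, nr_norm (f p) <= C.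
Proof.
have /asboolP[F lF] := loc_valP f.
have [[i0 _]|nI] := pselect (exists i : I, True); last first.
  by exists 0; split=> // p; case: nI; exists (p 1%g).
pose ext (w : {ffun F -> I}) : G -> I := fun g => if insub g is Some h then w h else i0.
exists (\sum_(w : {ffun F -> I}) nr_norm (f (ext w))); split.
  by apply: sumr_ge0 => w _; exact: nr_norm_ge0.
move=> p; pose w : {ffun F -> I} := [ffun h => p (val h)].
have -> : f p = f (ext w).
  by apply: lF => g gF; rewrite /ext insubT ffunE.
by rewrite (bigD1 w) //= lerDl; apply: sumr_ge0 => w' _; exact: nr_norm_ge0.
Qed.

Section ComplexMatrices.
Variables (R : realType) (G : groupType) (dsp : measure_display).
Variables (X : measurableType dsp) (mu : probability X R) (a : pmpAction G mu).
Variable Z : normedRing R.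
Local Notation S := (crossedLinf a Z).
Variable D : markedComplex a Z.

Definition cx_rank k := #|mk_idx (mc_mark D k)|.
Definition cx_set k (i : 'I_(cx_rank k)) : set X := mk_set (enum_val i : mk_idx (mc_mark D k)).
Definition cx_vec k (z : D k) : 'rV[S]_(cx_rank k) :=
  \row_i (mk_coord (mc_mark D k) z (enum_val i) : S).
Definition cx_gen k (i : 'I_(cx_rank k)) : D k := mk_gen (enum_val i : mk_idx (mc_mark D k)).
Definition cx_bd k : 'M[S]_(cx_rank k.+1, cx_rank k) :=
  \matrix_(i, j) cx_vec (ch_bd D k (cx_gen i)) 0 j.
Definition cx_aug (i : 'I_(cx_rank 0)) : linfMod a Z := ch_aug D (cx_gen i).

Lemma cx_set_measurable k i : measurable (@cx_set k i).
Proof. exact: mk_measurable. Qed.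

Lemma cx_vec_chi k (z : D k) i : cx_vec z 0 i * chi a Z (cx_set i) = cx_vec z 0 i.
Proof. by rewrite mxE; exact: mk_coord_chi. Qed.

Lemma cx_vec0 k : cx_vec (0 : D k) = 0.
Proof. by apply/rowP => i; rewrite !mxE linear0 ffunE. Qed.

Lemma cx_vec_bd k (z : D k.+1) : cx_vec (ch_bd D k z) = cx_vec z *m cx_bd k.
Proof.
apply/rowP => j; rewrite !mxE (mk_coord_linear (mc_mark D k.+1)) [LHS]sum_enum_val.
by apply: eq_bigr => i _; rewrite !mxE.
Qed.

Lemma cx_row_bd k i : row i (cx_bd k) = cx_vec (ch_bd D k (cx_gen i)).
Proof. by apply/rowP => j; rewrite !mxE. Qed.

Lemma cx_augE (z : D 0) : ch_aug D z = lincomb cx_aug (cx_vec z).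
Proof.
rewrite (linear_mk_decomp (mc_mark D 0) (ch_aug D)) [LHS]sum_enum_val.
by apply: eq_bigr => i _; rewrite mxE.
Qed.

Lemma cx_bd_bd k : cx_bd k.+1 *m cx_bd k = 0.
Proof.
apply/row_matrixP => i; rewrite row_mul cx_row_bd -cx_vec_bd ch_bdbd cx_vec0.
by rewrite row0.
Qed.

Lemma cx_aug_bd i : lincomb cx_aug (row i (cx_bd 0)) = 0.
Proof. by rewrite cx_row_bd -cx_augE ch_augbd. Qed.

Lemma cx_vec_sum k q (s : 'I_q -> S) (z : 'I_q -> D k) :
  cx_vec (\sum_i s i *: z i) = \sum_i s i *: cx_vec (z i).
Proof.
apply/rowP => j; rewrite mxE linear_sum sum_ffunE summxE; apply: eq_bigr => i _.
by rewrite linearZ ffunE !mxE.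
Qed.

End ComplexMatrices.

Lemma ae_fin (R : realType) (d : measure_display) (X : measurableType d)
    (mu : probability X R) (T : finType) (P : T -> X -> Prop) :
  (forall t, {ae mu, forall x, P t x}) -> {ae mu, forall x, forall t, P t x}.
Proof.
by move=> /(ae_seq (enum T)); apply: filterS => x Px t; apply: Px; rewrite mem_enum.
Qed.

Section RealizeExpressions.
Variables (R : realType) (G : groupType) (dsp : measure_display).
Variables (X : measurableType dsp) (mu : probability X R) (a : pmpAction G mu).
Variables (Z : normedRing R) (I : finType) (c : X -> I).
Hypothesis mc : fin_measurable c.
Local Notation rho := (realize a Z mc).
Local Notation U := (symRing G I Z).

Lemma realize_cut (x : U) (h : pred I) : rho (x * sym_chi G Z h - x) =
  rho x * chi a Z (c @^-1` [set i | h i]) - rho x.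
Proof. by rewrite rmorphB rmorphM realize_sym_chi. Qed.

Lemma realize_cut2 (x : U) (h h' : pred I) :
  rho (sym_chi G Z h' * x * sym_chi G Z h - sym_chi G Z h' * x) =
  chi a Z (c @^-1` [set i | h' i]) * rho x * chi a Z (c @^-1` [set i | h i]) -
  chi a Z (c @^-1` [set i | h' i]) * rho x.
Proof. by rewrite rmorphB !rmorphM !realize_sym_chi. Qed.

Lemma realize_mulmx m1 m2 m3 (A : 'M[U]_(m1, m2)) (B : 'M[U]_(m2, m3)) i j :
  rho ((A *m B) i j) = (map_mx rho A *m map_mx rho B) i j.
Proof. by rewrite -map_mxM [RHS]mxE. Qed.

Lemma realize_mulmxB m1 m2 m2' m3 (A : 'M[U]_(m1, m2)) (B : 'M[U]_(m2, m3))
    (A' : 'M[U]_(m1, m2')) (B' : 'M[U]_(m2', m3)) i j :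
  rho ((A *m B - A' *m B') i j) =
  (map_mx rho A *m map_mx rho B - map_mx rho A' *m map_mx rho B') i j.
Proof. by rewrite -!map_mxM -map_mxB [RHS]mxE. Qed.

Lemma realize_bd_mx (r : nat -> nat) (d : forall k, 'M[groupRing G Z]_(r k.+1, r k)) k :
  map_mx rho (map_mx (sym_incl G I Z) (d k)) = bd_mx a d k.
Proof. by apply/matrixP => i j; rewrite !mxE realize_sym_incl. Qed.

End RealizeExpressions.

Section Transport.
Variables (R : realType) (G : groupType) (dX dY : measure_display).
Variables (X : measurableType dX) (Y : measurableType dY).
Variables (mu : probability X R) (nu : probability Y R).
Variables (a : pmpAction G mu) (b : pmpAction G nu).
Hypothesis ab : weakly_contained a b.
Variable Z : normedRing R.
Hypothesis nr1 : nr_norm (1 : Z) = 1.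
Variables (n : nat) (r : nat -> nat).
Variables (d : forall k, 'M[groupRing G Z]_(r k.+1, r k)).
Variables (e : forall k, 'M[groupRing G Z]_(r k)) (ep : 'I_(r 0) -> trivmod G Z).
Hypothesis resd : mx_resolution n d e ep.
Local Notation S := (crossedLinf a Z).

(* Symbols for the matrices of an embedded complex, over a finite colouring of
   X: they realize to the given matrices over a, and, for a colouring of Y
   provided by weak containment, to an approximate complex over b. *)
Section Symbols.
Variable D : markedComplex a Z.
Local Notation m := (cx_rank D).
Local Notation aug := (@cx_aug _ _ _ _ _ _ _ D).
Variable T : forall k, 'M[S]_(r k, m k).
Hypothesis TB : forall k, (k <= n.+1)%N -> forall i j,
  T k i j * chi a Z (cx_set j) = T k i j.
Hypothesis TM : forall k, (k <= n)%N -> T k.+1 *m cx_bd D k = bd_mx a d k *m T k.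
Hypothesis Taug : forall j, lincomb aug (row j (T 0)) = linf_const mu (ep j) :> Linf mu Z.
Variables (p : nat) (A : 'I_p -> mk_idx (mc_mark D n.+1) -> set X).
Variable B : 'I_p -> mk_idx (mc_mark D n) -> set X.
Hypothesis dA : marked_decomposition A.
Hypothesis AB : forall k, carries (ch_bd D n) (A k) (B k).
Variables (I : finType) (c : X -> I).
Hypothesis mc : fin_measurable c.
Variables (u : S -> symRing G I Z) (w : Linf mu Z -> locfun G I Z) (h : set X -> pred I).
Local Notation rho := (realize a Z mc).
Hypothesis uM : forall k, (k <= n.+1)%N -> forall i j, rho (u (cx_bd D k i j)) = cx_bd D k i j.
Hypothesis uT : forall k, (k <= n.+1)%N -> forall i j, rho (u (T k i j)) = T k i j.
Hypothesis weta : forall i, realize_loc a mc (w (aug i)) = aug i.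
Hypothesis hD : forall k, (k <= n.+1)%N -> forall i : 'I_(m k), cx_set i = c @^-1` [set x | h (cx_set i) x].
Hypothesis hA : forall k i, A k i = c @^-1` [set x | h (A k i) x].
Hypothesis hB : forall k j, B k j = c @^-1` [set x | h (B k j) x].

Let sM k : 'M[symRing G I Z]_(m k.+1, m k) := map_mx u (cx_bd D k).
Let sT k : 'M[symRing G I Z]_(r k, m k) := map_mx u (T k).
Let sd k : 'M[symRing G I Z]_(r k.+1, r k) := map_mx (sym_incl G I Z) (d k).
Let seta (i : 'I_(m 0)) : symMod G I Z := w (aug i).
Let sAi k (i : 'I_(m n.+1)) := A k (enum_val i).
Let sBj k (j : 'I_(m n)) := B k (enum_val j).
Let L k := opnorm (mc_mark D n) (ch_bd D n) (A k).

Let rho_sM k : (k <= n.+1)%N -> map_mx rho (sM k) = cx_bd D k.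
Proof. by move=> kn; apply/matrixP => i j; rewrite [LHS]mxE [X in rho X]mxE uM. Qed.
Let rho_sT k : (k <= n.+1)%N -> map_mx rho (sT k) = T k.
Proof. by move=> kn; apply/matrixP => i j; rewrite [LHS]mxE [X in rho X]mxE uT. Qed.

(** This and the next relations vanish over [a]; each is a single expression in symbols, so that the
    transfer makes it vanish over [b] off E. *)
Let z_MB k i j : (k <= n)%N ->
  rho (sM k i j * sym_chi G Z (h (cx_set j)) - sM k i j) = 0.
Proof.
move=> kn; rewrite realize_cut -hD ?(leqW kn) // [sM k i j]mxE uM ?(leqW kn) //.
have -> : cx_bd D k i j = cx_vec (ch_bd D k (cx_gen i)) 0 j by rewrite mxE.
by rewrite cx_vec_chi subrr.
Qed.

Let z_TB k i j : (k <= n.+1)%N ->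
  rho (sT k i j * sym_chi G Z (h (cx_set j)) - sT k i j) = 0.
Proof.
by move=> kn; rewrite realize_cut -hD // [sT k i j]mxE uT // TB // subrr.
Qed.

Let z_MM k i j : (k < n)%N -> rho ((sM k.+1 *m sM k) i j) = 0.
Proof.
move=> kn; rewrite realize_mulmx !rho_sM ?cx_bd_bd ?mxE //; first exact: leqW (ltnW kn).
by rewrite leqW.
Qed.

Let z_TM k i j : (k <= n)%N -> rho ((sT k.+1 *m sM k - sd k *m sT k) i j) = 0.
Proof.
move=> kn; rewrite realize_mulmxB rho_sM ?rho_sT ?(leqW kn) //.
by rewrite realize_bd_mx TM // subrr mxE.
Qed.

Let z_Maug i : realize_loc a mc (lincomb seta (row i (sM 0))) = 0.
Proof.
rewrite realize_lincomb (_ : map_mx rho (row i (sM 0)) = row i (cx_bd D 0)); last first.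
  by rewrite map_row rho_sM.
apply: etrans (cx_aug_bd i); rewrite /lincomb; apply: eq_bigr => l _.
by have -> : realize_loc a mc (seta l) = aug l by exact: weta.
Qed.

Let z_Taug j : realize_loc a mc (lincomb seta (row j (sT 0)) - loc_const G I (ep j) : locfun G I Z) = 0.
Proof.
rewrite rmorphB /= realize_const [realize_loc _ _ _]realize_lincomb.
rewrite (_ : map_mx rho (row j (sT 0)) = row j (T 0)); last by rewrite map_row rho_sT.
transitivity (lincomb aug (row j (T 0)) - linf_const mu (ep j) : Linf mu Z).
  congr (_ - _); rewrite /lincomb; apply: eq_bigr => l _.
  by have -> : realize_loc a mc (seta l) = aug l by exact: weta.
by rewrite Taug subrr.
Qed.

(** Applied to [chi (A k i)] times the i-th generator, the inclusion of the image of a piece in its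
    carrier becomes a relation between matrix entries. *)
Let z_AMB k i j : rho (sym_chi G Z (h (sAi k i)) * sM n i j * sym_chi G Z (h (sBj k j)) -
  sym_chi G Z (h (sAi k i)) * sM n i j) = 0.
Proof.
rewrite realize_cut2 -hA -hB [sM n i j]mxE uM //.
have mA : measurable (sAi k i) by have [+ _] := dA; apply.
have [subB fAB] := AB k; have [mB _] := subB (enum_val j).
have Asub : sAi k i `<=` cx_set i.
  have [_ /(_ (enum_val i))[_ AE]] := dA.
  by rewrite /cx_set -AE => x Ax; exists k.
have := fAB (chi a Z (sAi k i) *: cx_gen i).
have Az : summand (A k) (chi a Z (sAi k i) *: cx_gen i).
  move=> l; rewrite linearZ ffunE mk_genE; case: eqP => [->|_]; last first.
    by exists 0; rewrite mul0r; exact: mulr0.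
  apply/cyc_chi; first exact: mA.
  rewrite -[_ *: _]/(chi a Z (sAi k i) * chi a Z (cx_set i)) chi_mul //; last exact: cx_set_measurable.
  by rewrite (setIidl Asub) chi_idem.
move=> /(_ Az (enum_val j))/cyc_chi => /(_ mB).
rewrite !linearZ ffunE => hE.
have -> : cx_bd D n i j = (mk_coord (mc_mark D n) (ch_bd D n (cx_gen i)) (enum_val j) : S).
  by rewrite !mxE.
by apply/eqP; rewrite subr_eq0; apply/eqP.
Qed.

(** By [opnorm_ae] the norm on a piece becomes a pointwise bound on row sums, which is a local
    condition on patterns and can be transferred. *)
Let bound_M (K : {fset G}) k i : {ae mu, forall x, A k (enum_val i) x ->
  \sum_j \sum_(g <- K) nr_norm (cp_coef (sM n i j) g (pattern a c x)) <= L k}.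
Proof.
have [mA AE] := dA.
have [c1 c1P] := mk_bounded_ex (mc_mark D n) (ch_bd D n) (A k).
have opb := opnorm_bounded c1P.
have Asub : A k (enum_val i) `<=` mk_set (enum_val i).
  by have [_ <-] := AE (enum_val i); move=> x Ax; exists k.
have H := opnorm_ae nr1 (i := enum_val i) K opb (mA k _) Asub.
have H' := ae_fin (fun j => ae_seq K (fun g => realize_abs a mc (cp_coef (sM n i j) g))).
apply: filterS (filterI H H') => x /= [Hx Hx'] Ax.
apply: le_trans (Hx Ax); rewrite [leRHS]sum_enum_val; apply: ler_sum => j _.
rewrite big_seq [leRHS]big_seq; apply: ler_sum => g gK.
rewrite -Hx' // -realize_coef /sM mxE uM //.
by rewrite !mxE.
Qed.

Lemma symbols_support : exists K : {fset G}, forall k, (k <= n.+1)%N ->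
  [/\ forall i j, (cp_supp (sM k i j) `<=` K)%fset,
      forall i j, (cp_supp (sT k i j) `<=` K)%fset &
      forall i j, (cp_supp (d k i j) `<=` K)%fset].
Proof.
have [|s sP] := @large_seq_lt G n.+2 (fun k s =>
  (forall ij, (cp_supp (sM k ij.1 ij.2) `<=` [fset g in s])%fset) /\
  ((forall ij, (cp_supp (sT k ij.1 ij.2) `<=` [fset g in s])%fset) /\
   (forall ij, (cp_supp (d k ij.1 ij.2) `<=` [fset g in s])%fset))).
  move=> k; do 2?[apply: large_seq_and]; apply: large_seq_fin => ij; exact: large_seq_supp.
exists [fset g in s]%fset => k kn; have [h1 [h2 h3]] := sP s (fun _ => id) k kn.
by split=> i j; [exact: (h1 (i, j))|exact: (h2 (i, j))|exact: (h3 (i, j))].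
Qed.

Lemma symbols_local : exists F : {fset G}, [/\ 1%g \in F,
  forall k, (k <= n.+1)%N ->
    [/\ forall i j, sym_local_on F (sM k i j * sym_chi G Z (h (cx_set j)) - sM k i j),
        forall i j, sym_local_on F (sT k i j * sym_chi G Z (h (cx_set j)) - sT k i j),
        forall i j, sym_local_on F ((sM k.+1 *m sM k) i j) &
        forall i j, sym_local_on F ((sT k.+1 *m sM k - sd k *m sT k) i j)],
  forall i, local_on F (lincomb seta (row i (sM 0)) : locfun G I Z),
  forall j, local_on F (lincomb seta (row j (sT 0)) - loc_const G I (ep j) : locfun G I Z) &
  (forall i j, sym_local_on F (sM n i j)) /\
  (forall k i j, sym_local_on F (sym_chi G Z (h (sAi k i)) * sM n i j * sym_chi G Z (h (sBj k j)) -
  sym_chi G Z (h (sAi k i)) * sM n i j))].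
Proof.
have [|s sP] := @large_seq_lt G n.+2 (fun k s => let F := [fset g in s]%fset in
  (forall ij, sym_local_on F (sM k ij.1 ij.2 * sym_chi G Z (h (cx_set ij.2)) - sM k ij.1 ij.2)) /\
  ((forall ij, sym_local_on F (sT k ij.1 ij.2 * sym_chi G Z (h (cx_set ij.2)) - sT k ij.1 ij.2)) /\
  ((forall ij, sym_local_on F ((sM k.+1 *m sM k) ij.1 ij.2)) /\
   (forall ij, sym_local_on F ((sT k.+1 *m sM k - sd k *m sT k) ij.1 ij.2))))).
  move=> k; do 3?[apply: large_seq_and]; apply: large_seq_fin => ij; exact: large_seq_sym_local.
have l1 := large_seq_fin (fun i => large_seq_local_on (lincomb seta (row i (sM 0)) : locfun G I Z)).
have l2 := large_seq_fin (fun j => large_seq_local_on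
  (lincomb seta (row j (sT 0)) - loc_const G I (ep j) : locfun G I Z)).
have l3 := large_seq_fin (fun ij : 'I_(m n.+1) * 'I_(m n) => large_seq_sym_local (sM n ij.1 ij.2)).
have l4 := large_seq_fin (fun kij : 'I_p * ('I_(m n.+1) * 'I_(m n)) => large_seq_sym_local
  (sym_chi G Z (h (sAi kij.1 kij.2.1)) * sM n kij.2.1 kij.2.2 * sym_chi G Z (h (sBj kij.1 kij.2.2)) -
  sym_chi G Z (h (sAi kij.1 kij.2.1)) * sM n kij.2.1 kij.2.2)).
have [s' sP'] := large_seq_and (ex_intro _ s sP) (large_seq_and (large_seq_mem 1%g)
  (large_seq_and l1 (large_seq_and l2 (large_seq_and l3 l4)))).
have [hk [h1 [hM [hT [hM' hA']]]]] := sP' s' (fun _ => id).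
exists [fset g in s']%fset; split => //; first by rewrite in_fset.
  move=> k kn; have [a1 [a2 [a3 a4]]] := hk k kn.
  by split=> i j; [exact: (a1 (i, j))|exact: (a2 (i, j))|exact: (a3 (i, j))|exact: (a4 (i, j))].
by split=> [i j|k i j]; [exact: (hM' (i, j))|exact: (hA' (k, (i, j)))].
Qed.

Lemma transport_symbols (C : augComplex (trivmod G Z)) (del : R) :
  (forall k, is_free (C k)) -> 0 < del ->
  exists D' : markedComplex b Z, [/\ embeds C n D',
    mdim (mc_mark D' n) <= mdim (mc_mark D n) + del &
    lognorm (mc_mark D' n.+1) (mc_mark D' n) (ch_bd D' n) <=
    \sum_(k < p) Num.min (fam_dim mu (A k) * log_plus (L k))
                         (fam_dim mu (B k) * log_plus (L k)) + del].
Proof.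
move=> freeC del0.
have [K KP] := symbols_support.
have [F [F1 FP Faug FTaug [FM FAMB]]] := symbols_local.
have [CT CTP] := choice (fun ijg : 'I_(r n) * 'I_(m n) * G =>
  locfun_bounded (cp_coef (sT n ijg.1.1 ijg.1.2) ijg.2)).
pose cT := \sum_i \sum_j \sum_(g <- K) CT (i, j, g).
pose cd := \sum_i \sum_j \sum_(g <- K) nr_norm (cp_coef (d n i j) g).
have cT0 : 0 <= cT.
  apply: sumr_ge0 => i _; apply: sumr_ge0 => j _; apply: sumr_ge0 => g _.
  by have [] := CTP (i, j, g).
have cd0 : 0 <= cd.
  apply: sumr_ge0 => i _; apply: sumr_ge0 => j _; apply: sumr_ge0 => g _.
  exact: nr_norm_ge0.
(* Error per unit of eps: each transported set may gain measure eps, and the retained resolution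
   costs a multiple of nu(E). [c1] counts this for the dimension; [c2] weights it with the
   logarithms for the lognorm. *)
pose c1 := (m n)%:R + (r n * #|` K|.+1 ^ n.+1)%:R : R.
pose c2 := \sum_(k < p) (m n.+1 + m n)%:R * log_plus (L k) +
  (r n.+1 * #|` K|.+1 ^ n.+2)%:R * log_plus (cT * cd + cd).
have c10 : 0 <= c1 by rewrite addr_ge0.
have c20 : 0 <= c2.
  rewrite addr_ge0 // ?mulr_ge0 ?log_plus_ge0 //.
  by apply: sumr_ge0 => k _; rewrite mulr_ge0 ?log_plus_ge0.
pose eps := del / (c1 + c2 + 1).
have c0 : 0 < c1 + c2 + 1 by apply: ltr_wpDl => //; exact: addr_ge0.
have eps0 : 0 < eps by exact: divr_gt0.
have epsE : eps * (c1 + c2 + 1) = del.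
  by rewrite /eps divfK // gt_eqF.
have epsc1 : c1 * eps <= del.
  by rewrite -epsE mulrC ler_pM2l // -addrA lerDl addr_ge0.
have epsc2 : c2 * eps <= del.
  by rewrite -epsE mulrC ler_pM2l // [c1 + c2]addrC -addrA lerDl addr_ge0.
have [c' [E [mc' mE EE transf meas]]] := transfer_colouring ab mc F eps0.
have kill (x : symRing G I Z) : sym_local_on F x -> rho x = 0 -> chi b Z (~` E) * realize b Z mc' x = 0.
  exact: (realize_transfer mc' mE transf).
have killL (f : locfun G I Z) : local_on F f -> realize_loc a mc f = 0 ->
    linf_indic nu Z (~` E) * realize_loc b mc' f = 0.
  exact: (realize_loc_transfer mc' mE transf).
(* Off E every colour used on Y is a colour of some x in X, so disjointness, covering and inclusion
   of unions of colour classes carry over pointwise. *)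
have same y : ~ E y -> exists x, c' y = c x.
  move=> nE; have := transf (fun q => exists x, q 1%g = c x) _ _ y nE.
  rewrite /pattern invg1 pact1; apply.
    by move=> q q' qq' /=; rewrite qq'.
  by apply: aeW => x; exists x; rewrite ?pact1.
pose B' k (i : 'I_(m k)) : set Y := c' @^-1` [set x | h (cx_set i) x].
pose M' k := map_mx (realize b Z mc') (sM k).
pose T' k := map_mx (realize b Z mc') (sT k).
pose eta' (i : 'I_(m 0)) : linfMod b Z := realize_loc b mc' (seta i).
pose Bp k (i : 'I_(m n.+1)) : set Y := c' @^-1` [set x | h (sAi k i) x].
pose Np k (j : 'I_(m n)) : set Y := c' @^-1` [set x | h (sBj k j) x].
have mpre (J : set I) : measurable (c' @^-1` J) by exact: fin_measurable_preimage.
have h1 k : (k <= n)%N -> forall i j,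
    chi b Z (~` E) * (M' k i j * chi b Z (B' k j) - M' k i j) = 0.
  move=> kn i j; have [+ _ _ _] := FP k (leqW kn) => /(_ i j) FM1.
  have := kill _ FM1 (z_MB i j kn); rewrite realize_cut.
  by have -> : M' k i j = realize b Z mc' (sM k i j) by rewrite [LHS]mxE.
have h2 k : (k <= n.+1)%N -> forall i j,
    chi b Z (~` E) * (T' k i j * chi b Z (B' k j) - T' k i j) = 0.
  move=> kn i j; have [_ + _ _] := FP k kn => /(_ i j) FM1.
  have := kill _ FM1 (z_TB i j kn); rewrite realize_cut.
  by have -> : T' k i j = realize b Z mc' (sT k i j) by rewrite [LHS]mxE.
have h3 k : (k < n)%N -> forall i j, chi b Z (~` E) * (M' k.+1 *m M' k) i j = 0.
  move=> kn i j; have [_ _ + _] := FP k (leqW (ltnW kn)) => /(_ i j) FM1.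
  by have := kill _ FM1 (z_MM i j kn); rewrite realize_mulmx.
have h4 k : (k <= n)%N -> forall i j,
    chi b Z (~` E) * (T' k.+1 *m M' k - bd_mx b d k *m T' k) i j = 0.
  move=> kn i j; have [_ _ _ +] := FP k (leqW kn) => /(_ i j) FM1.
  by have := kill _ FM1 (z_TM i j kn); rewrite realize_mulmxB realize_bd_mx.
have h5 i : linf_indic nu Z (~` E) * (lincomb eta' (row i (M' 0%N)) : Linf nu Z) = 0.
  have := killL _ (Faug i) (z_Maug i); rewrite realize_lincomb.
  by rewrite map_row.
have h6 j : linf_indic nu Z (~` E) *
    (lincomb eta' (row j (T' 0%N)) - linf_const nu (ep j) : Linf nu Z) = 0.
  have := killL _ (FTaug j) (z_Taug j); rewrite rmorphB /= realize_const.
  by rewrite [realize_loc b mc' _]realize_lincomb map_row.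
have h7 k : (k <= n)%N -> forall i j, (cp_supp (M' k i j) `<=` K)%fset.
  move=> kn i j; have [hK _ _] := KP k (leqW kn); apply: fsubset_trans (hK i j).
  by rewrite [M' k i j]mxE; exact: cp_supp_realize.
have h8 k : (k <= n.+1)%N -> forall i j, (cp_supp (T' k i j) `<=` K)%fset.
  move=> kn i j; have [_ hK _] := KP k kn; apply: fsubset_trans (hK i j).
  by rewrite [T' k i j]mxE; exact: cp_supp_realize.
have h9 k : (k <= n)%N -> forall i j, (cp_supp (bd_mx b d k i j) `<=` K)%fset.
  move=> kn i j; have [_ _ hK] := KP k (leqW kn); apply: fsubset_trans (hK i j).
  by rewrite [bd_mx b d k i j]mxE; exact: cp_supp_grp_incl.
have mB' k i : measurable (@B' k i) by exact: mpre.
pose D' := approx_strict mB' resd mE h1 h2 h3 h4 h5 h6 h7 h8 h9.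
have nuE : fine (nu E) <= eps by exact: ltW.
have setb (P : set X) : P = c @^-1` [set x | h P x] ->
    fine (nu (c' @^-1` [set x | h P x])) <= fine (mu P) + eps.
  by move=> PE; rewrite [in leRHS]PE; exact: meas.
have dim_le q (Qs : 'I_q -> set Y) (Ps : 'I_q -> set X) :
    (forall i, fine (nu (Qs i)) <= fine (mu (Ps i)) + eps) ->
    \sum_i fine (nu (Qs i)) <= \sum_i fine (mu (Ps i)) + q%:R * eps.
  move=> QP; apply: (@le_trans _ _ (\sum_(i < q) (fine (mu (Ps i)) + eps))).
    exact: ler_sum.
  by rewrite big_split /= sumr_const card_ord [q%:R * eps]mulr_natl.
exists D'; split.
- exact: approx_strict_embeds.
- apply: le_trans (approx_mdim mB' resd mE h1 h2 h3 h4 h5 h6 h7 h8 h9) _.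
  have s1 : \sum_i fine (nu (B' n i)) <= mdim (mc_mark D n) + (m n)%:R * eps.
    rewrite [mdim _]sum_enum_val; apply: (dim_le _ _ (fun i : 'I_(m n) => cx_set i)) => i.
    by apply: setb; exact: hD.
  apply: le_trans (lerD s1 (ler_wpM2l _ nuE)) _ => //.
  by rewrite -addrA lerD2l -mulrDl.
have Bpx y x k i : c' y = c x -> Bp k i y -> A k (enum_val i) x.
  by move=> yx; rewrite hA /Bp /= yx.
have enc k : 0 <= log_plus (L k) by exact: log_plus_ge0.
apply: le_trans (approx_lognorm mB' resd mE h1 h2 h3 h4 h5 h6 h7 h8 h9 (Bp := Bp) (Np := Np)
  (c := L) _ _ _ cd0 cT0 _ _ _ _ _ _ _) _.
- by move=> k i; exact: mpre.
- by move=> k j; exact: mpre.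
- by move=> k; exact: opnorm_ge0.
- move=> y i k l /same[x yx] /(Bpx _ _ _ _ yx) hk /(Bpx _ _ _ _ yx) hl.
  by have [tr _] := dA.2 (enum_val i); apply: tr => //; exists x.
- move=> y i /same[x yx].
  have -> : B' n.+1 i y = cx_set i x by rewrite /B' /= yx [in RHS](hD (leqnn _)).
  rewrite /cx_set -(dA.2 (enum_val i)).2; split=> [[k _ Ak]|[k Bk]].
    by exists k; rewrite /Bp /= yx; move: Ak; rewrite {1}hA.
  by exists k => //; exact: (Bpx _ _ _ _ yx Bk).
- move=> y k j /same[x yx] Ny.
  have -> : B' n j y = cx_set j x by rewrite /B' /= yx [in RHS](hD (leqnSn _)).
  have [subB _] := AB k; have [_] := subB (enum_val j); apply.
  by move: Ny; rewrite hB /Np /= yx.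
- move=> k i j; have := kill _ (FAMB k i j) (z_AMB k i j); rewrite realize_cut2.
  by have -> : M' n i j = realize b Z mc' (sM n i j) by rewrite [LHS]mxE.
- move=> k i.
  (* The row-sum bound on a piece is transferred as an implication on patterns, so the same constant
     [L k] holds over [b]. *)
  have PF : local_on F (fun q : G -> I => h (sAi k i) (q 1%g) ->
      \sum_j \sum_(g <- K) nr_norm (cp_coef (sM n i j) g q) <= L k).
    move=> q q' qq'; rewrite (qq' _ F1).
    suff -> : \sum_j \sum_(g <- K) nr_norm (cp_coef (sM n i j) g q) =
        \sum_j \sum_(g <- K) nr_norm (cp_coef (sM n i j) g q') by [].
    apply: eq_bigr => j _; apply: eq_bigr => g _.
    by rewrite (FM i j g q q' qq').
  have Pae := transf _ PF.
  have {}Pae : forall y, ~ E y -> h (sAi k i) (pattern b c' y 1%g) ->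
      \sum_j \sum_(g <- K) nr_norm (cp_coef (sM n i j) g (pattern b c' y)) <= L k.
    apply: Pae; apply: filterS (bound_M K k i) => x Hx; rewrite /pattern invg1 pact1 => hx.
    by apply: Hx; rewrite hA.
  have H' := ae_fin (fun j => ae_seq K (fun g => realize_abs b mc' (cp_coef (sM n i j) g))).
  apply: filterS H' => y Hy nE By.
  apply: le_trans (Pae y nE _); last by rewrite /pattern invg1 pact1.
  apply: ler_sum => j _; rewrite big_seq [leRHS]big_seq; apply: ler_sum => g gK.
  by rewrite -Hy // -realize_coef; have -> : M' n i j = realize b Z mc' (sM n i j) by rewrite [LHS]mxE.
- move=> i.
  have H' := ae_fin (fun j => ae_seq K (fun g => linf_const_abs nu (cp_coef (d n i j) g))).
  apply: filterS H' => y Hy.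
  apply: (@le_trans _ _ (\sum_j \sum_(g <- K) nr_norm (cp_coef (d n i j) g))).
    apply: ler_sum => j _; rewrite big_seq [leRHS]big_seq; apply: ler_sum => g gK.
    have -> : bd_mx b d n i j = grp_incl b (d n i j) by rewrite [LHS]mxE.
    by rewrite grp_incl_coef Hy.
  rewrite /cd (bigD1 i) //= lerDl; apply: sumr_ge0 => i' _; apply: sumr_ge0 => j _.
  by apply: sumr_ge0 => g _; exact: nr_norm_ge0.
- move=> i.
  have H' := ae_fin (fun j => ae_seq K (fun g => realize_abs b mc' (cp_coef (sT n i j) g))).
  apply: filterS H' => y Hy.
  apply: (@le_trans _ _ (\sum_j \sum_(g <- K) CT (i, j, g))).
    apply: ler_sum => j _; rewrite big_seq [leRHS]big_seq; apply: ler_sum => g gK.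
    have -> : T' n i j = realize b Z mc' (sT n i j) by rewrite [LHS]mxE.
    by rewrite realize_coef Hy //; have [_] := CTP (i, j, g); apply.
  rewrite /cT (bigD1 i) //= lerDl; apply: sumr_ge0 => i' _; apply: sumr_ge0 => j _.
  by apply: sumr_ge0 => g _; have [] := CTP (i', j, g).
have dimA k : \sum_i fine (nu (Bp k i)) <= fam_dim mu (A k) + (m n.+1)%:R * eps.
  rewrite [fam_dim _ _]sum_enum_val; apply: (dim_le _ _ (fun i : 'I_(m n.+1) => sAi k i)) => i.
  by apply: setb; exact: hA.
have dimB k : \sum_j fine (nu (Np k j)) <= fam_dim mu (B k) + (m n)%:R * eps.
  rewrite [fam_dim _ _]sum_enum_val; apply: (dim_le _ _ (fun j : 'I_(m n) => sBj k j)) => j.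
  by apply: setb; exact: hB.
have termk k : Num.min ((\sum_i fine (nu (Bp k i))) * log_plus (L k))
      ((\sum_j fine (nu (Np k j))) * log_plus (L k)) <=
    Num.min (fam_dim mu (A k) * log_plus (L k)) (fam_dim mu (B k) * log_plus (L k)) +
    (m n.+1 + m n)%:R * log_plus (L k) * eps.
  have hA1 : (\sum_i fine (nu (Bp k i))) * log_plus (L k) <=
      fam_dim mu (A k) * log_plus (L k) + (m n.+1 + m n)%:R * log_plus (L k) * eps.
    apply: le_trans (ler_wpM2r (enc k) (dimA k)) _.
    rewrite mulrDl lerD2l mulrAC ler_wpM2r ?(ltW eps0) // ler_wpM2r // ler_nat.
    exact: leq_addr.
  have hB1 : (\sum_j fine (nu (Np k j))) * log_plus (L k) <=
      fam_dim mu (B k) * log_plus (L k) + (m n.+1 + m n)%:R * log_plus (L k) * eps.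
    apply: le_trans (ler_wpM2r (enc k) (dimB k)) _.
    rewrite mulrDl lerD2l mulrAC ler_wpM2r ?(ltW eps0) // ler_wpM2r // ler_nat.
    exact: leq_addl.
  by rewrite -lerBlDr le_min !lerBlDr !ge_min hA1 hB1 orbT.
apply: (@le_trans _ _ (\sum_(k < p) (Num.min (fam_dim mu (A k) * log_plus (L k))
    (fam_dim mu (B k) * log_plus (L k)) + (m n.+1 + m n)%:R * log_plus (L k) * eps) +
    (r n.+1 * #|` K|.+1 ^ n.+2)%:R * eps * log_plus (cT * cd + cd))).
  apply: lerD; first by apply: ler_sum => k _; exact: termk.
  by rewrite ler_wpM2r ?log_plus_ge0 // ler_wpM2l.
rewrite big_split /= -addrA lerD2l; apply: le_trans epsc2.
by rewrite -mulr_suml [_ * eps * log_plus _]mulrAC -mulrDl.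
Qed.

End Symbols.

Hypothesis ballZ : finite_balls Z.
Variable C : augComplex (trivmod G Z).
Hypothesis freeC : free_resolution C.

(** The comparison map from the resolution followed by the embedding is determined by the images of
    the basis vectors, the rows of [T]. This trades C for finite matrices. *)
Lemma embeds_mx (D : markedComplex a Z) : embeds C n D ->
  exists T : forall k, 'M[S]_(r k, cx_rank D k),
  [/\ forall k i j, T k i j * chi a Z (cx_set j) = T k i j,
      forall k, (k <= n)%N -> T k.+1 *m cx_bd D k = bd_mx a d k *m T k &
      forall j, lincomb (@cx_aug _ _ _ _ _ _ _ D) (row j (T 0%N)) =
        linf_const mu (ep j) :> Linf mu Z].
Proof.
move=> [f [f0 fP]]; have [psi [psi0 psiP]] := from_mx_resolution resd freeC.1.
pose t k j := f k (psi k (delta_mx 0 j)).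
pose T k : 'M[S]_(r k, cx_rank D k) := \matrix_(i, j) cx_vec (t k i) 0 j.
have rowT k i : row i (T k) = cx_vec (t k i) by apply/rowP => j; rewrite !mxE.
exists T; split.
- move=> k i j; have -> : T k i j = cx_vec (t k i) 0 j by rewrite [LHS]mxE.
  exact: cx_vec_chi.
- move=> k kn; apply/row_matrixP => i.
  rewrite row_mul rowT -cx_vec_bd -fP // -psiP // -rowE.
  rewrite [row i (d k)]row_sum_delta !linear_sum /=.
  rewrite (eq_bigr (fun l => grp_incl a (d k i l) *: t k l)); last first.
    by move=> l _; rewrite !linearZ /= mxE.
  rewrite cx_vec_sum row_mul [RHS]mulmx_sum_row; apply: eq_bigr => l _.
  by rewrite rowT !mxE.
- move=> j; rewrite rowT -cx_augE f0 psi0.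
  by rewrite lincomb_delta.
Qed.

Lemma transport_complex (D : markedComplex a Z) (del : R) (p : nat)
    (A : 'I_p -> mk_idx (mc_mark D n.+1) -> set X) (B : 'I_p -> mk_idx (mc_mark D n) -> set X) :
  embeds C n D -> marked_decomposition A ->
  (forall k, carries (ch_bd D n) (A k) (B k)) -> 0 < del ->
  exists D' : markedComplex b Z, [/\ embeds C n D',
    mdim (mc_mark D' n) <= mdim (mc_mark D n) + del &
    lognorm (mc_mark D' n.+1) (mc_mark D' n) (ch_bd D' n) <=
    \sum_(k < p) Num.min
      (fam_dim mu (A k) * log_plus (opnorm (mc_mark D n) (ch_bd D n) (A k)))
      (fam_dim mu (B k) * log_plus (opnorm (mc_mark D n) (ch_bd D n) (A k))) + del].
Proof.
move=> /embeds_mx[T [TB TM Taug]] dA AB del0.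
have [LM LMP] := @large_seq_lt S n.+2 (fun k s =>
    (forall ij, cx_bd D k ij.1 ij.2 \in s) /\ (forall ij, T k ij.1 ij.2 \in s))
  (fun k => large_seq_and (large_seq_fin (fun ij => large_seq_mem (cx_bd D k ij.1 ij.2)))
    (large_seq_fin (fun ij => large_seq_mem (T k ij.1 ij.2)))).
have [LV LVP] := large_seq_fin (fun i : 'I_(cx_rank D 0) => large_seq_mem (cx_aug i : Linf mu Z)).
have [LS LSP] := large_seq_and
  (@large_seq_lt (set X) n.+2 (fun k s => forall i : 'I_(cx_rank D k), cx_set i \in s)
    (fun k => large_seq_fin (fun i => large_seq_mem (cx_set i))))
  (large_seq_and (large_seq_fin (fun ki : 'I_p * _ => large_seq_mem (A ki.1 ki.2)))
    (large_seq_fin (fun ki : 'I_p * _ => large_seq_mem (B ki.1 ki.2)))).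
have [hD [hA hB]] := LSP LS (fun _ => id).
(* [LS] is only known to contain the required sets, so the measurable ones are filtered out. *)
pose LA := [seq P <- LS | `[< measurable P >]].
have LAP P : P \in LS -> measurable P -> P \in LA.
  by move=> PL mP; rewrite mem_filter PL andbT; apply/asboolP.
have [|I [c [mc [u [w [h [uP wP hP]]]]]]] := lift_colouring (a := a) ballZ LM LV (LA := LA).
  by move=> P; rewrite mem_filter => /andP[/asboolP].
apply: (transport_symbols (fun k _ => TB k) TM Taug dA AB (mc := mc)
  (u := u) (w := w) (h := h) _ _ _ _ _ _ freeC.2 del0).
- move=> k kn i j; apply: uP; have [hM _] := LMP LM (fun _ => id) k kn.
  exact: (hM (i, j)).
- move=> k kn i j; apply: uP; have [_ hT] := LMP LM (fun _ => id) k kn.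
  exact: (hT (i, j)).
- by move=> i; apply: wP; exact: LVP.
- move=> k kn i; apply/hP/LAP; [exact: hD|exact: cx_set_measurable].
- by move=> k i; apply/hP/LAP; [exact: (hA (k, i))|have [+ _] := dA; apply].
- move=> k j; apply/hP/LAP; first exact: (hB (k, j)).
  by have [+ _] := AB k => /(_ j)[].
Qed.

Lemma medim_le : (medim b C n <= medim a C n)%E.
Proof.
apply: le_ereal_inf_tmp => _ [D [DC ->]]; apply/lee_addgt0Pr => del del0.
(* Any decomposition with carriers will do here, as only the dimension is compared. *)
have [p [A [B [dA AB _]]]] := lognorm_approx (mc_mark D n.+1) (mc_mark D n) (ch_bd D n) del0.
have [D' [D'C dimD' _]] := transport_complex DC dA AB del0.
apply: (@le_trans _ _ (mdim (mc_mark D' n))%:E); last by rewrite -EFinD lee_fin.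
by apply: ereal_inf_lbound; exists D'.
Qed.

Lemma mevol_le : (mevol b C n <= mevol a C n)%E.
Proof.
apply: le_ereal_inf_tmp => _ [D [DC ->]]; apply/lee_addgt0Pr => del del0.
have del20 : 0 < del / 2 by rewrite divr_gt0.
have [p [A [B [dA AB LN]]]] := lognorm_approx (mc_mark D n.+1) (mc_mark D n) (ch_bd D n) del20.
have [D' [D'C _ logD']] := transport_complex DC dA AB del20.
apply: (@le_trans _ _ (lognorm (mc_mark D' n.+1) (mc_mark D' n) (ch_bd D' n))%:E).
  by apply: ereal_inf_lbound; exists D'.
rewrite -EFinD lee_fin (le_trans logD') // [in leRHS](splitr del) addrA lerD2r.
exact: LN.
Qed.

End Transport.

(** * The two kinds of coefficients and the conclusion *)

Lemma finite_balls_int (R : realType) : finite_balls (intZ R).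
Proof.
move=> r; pose N := (Num.truncn `|r|).+1.
pose V : seq int := [seq Posz k | k <- iota 0 N] ++ [seq - Posz k | k <- iota 0 N].
suff VP (z : int) : (`|z|%N < N)%N -> z \in V.
  exists V => z zr; apply: VP; rewrite -(ltr_nat R).
  apply: (@le_lt_trans _ _ `|r|); last exact: truncnS_gt.
  apply: le_trans (ler_norm r); apply: le_trans zr.
  by rewrite /= /int_norm -intr_norm -abszE pmulrn.
move=> zN; have zi : `|z|%N \in iota 0 N by rewrite mem_iota.
rewrite mem_cat; apply/orP; have [z0|/ltW z0] := leP 0 z.
  by left; apply/mapP; exists `|z|%N => //; rewrite gez0_abs.
by right; apply/mapP; exists `|z|%N => //; rewrite lez0_abs // opprK.
Qed.

Lemma finite_balls_fin (R : realType) (F : finFieldType) : finite_balls (finZ R F).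
Proof. by move=> r; exists (enum F) => z _; rewrite mem_enum. Qed.

Theorem theorem1p7 (R : realType) (n : nat) (G : groupType)
    (d d' : measure_display) (X : measurableType d) (Y : measurableType d')
    (mu : probability X R) (nu : probability Y R)
    (alpha : pmpAction G mu) (beta : pmpAction G nu)
    (countG : countable [set: G]) (fpG : type_FP G n.+1)
    (std_alpha : standard_action alpha) (std_beta : standard_action beta)
    (alpha_beta : weakly_contained alpha beta) :
  [/\ forall C : augComplex (trivmod G (intZ R)), free_resolution C ->
        (medim beta C n <= medim alpha C n)%E,
      forall (F : finFieldType) (C : augComplex (trivmod G (finZ R F))),
        free_resolution C -> (medim beta C n <= medim alpha C n)%E
    & forall C : augComplex (trivmod G (intZ R)), free_resolution C ->
        (mevol beta C n <= mevol alpha C n)%E].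
Proof.
have [r [dr [e [ep res]]]] := type_FP_mx_resolution fpG.
have ballZ := @finite_balls_int R.
have nr1 : @nr_norm R (intZ R) 1 = 1 by exact: normr1.
split=> [C freeC|F C freeC|C freeC].
- exact: (medim_le alpha_beta nr1 (res : @mx_resolution G (intZ R) n r dr e ep) ballZ freeC).
- have nrF : @nr_norm R (finZ R F) 1 = 1 by rewrite /= /triv_norm oner_eq0.
  exact: (medim_le alpha_beta nrF
    (mx_resolution_finField F res : @mx_resolution G (finZ R F) n r _ _ _)
    (@finite_balls_fin R F) freeC).
- exact: (mevol_le alpha_beta nr1 (res : @mx_resolution G (intZ R) n r dr e ep) ballZ freeC).
Qed.
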